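(* Let $n\ge 1$, let $\theta\in\mathrm{Perm}(n)$ be a permutation, let $\gamma:\langle n\rangle\to\langle n\rangle$ be any map, put $k=c(\theta)$, and let $\nu:\langle n\rangle\to\langle k\rangle$ be an onto map which is $\theta$-invariant (i.e. $\nu\circ\theta=\nu$). Let $(\mathcal A,\varphi)$ be a faithful tracial $C^*$-probability space and let $\{\mathbf z(i,j)\}_{(i,j)\in\langle k\rangle\times\langle n\rangle}$ be a family of free standard semicircular variables in $(\mathcal A,\varphi)$. Then $$|\mathrm{Map}_0(\theta,\gamma)|=\varphi\Big(\mathrm{Arb}_{\theta,\gamma,\nu}\big|_{\mathbf Z(i,j)=\mathbf z(i,j)\ \text{for}\ (i,j)\in\langle k\rangle\times\langle n\rangle}\Big).$$
   Context: Notation: $\langle n\rangle=\{1,\dots,n\}$; $\mathrm{Perm}(n)$ is the group of bijections of $\langle n\rangle$, with $(\sigma\tau)(s)=\sigma(\tau(s))$; a cycle $(i_1\cdots i_n)$ sends $i_1\mapsto i_2\mapsto\cdots\mapsto i_n\mapsto i_1$; $c(\theta)$ is the number of cycles of $\theta$ (fixed points count as cycles). $\mathbf 1\{\cdots\}$ is $1$ if the condition holds and $0$ otherwise. A standard semicircular variable is a self-adjoint element with law $\frac{1}{2\pi}\sqrt{4-x^2}\,\mathbf 1\{|x|\le 2\}\,dx$. Colored planar maps: $\mathrm{Match}(n)\subset\mathrm{Perm}(n)$ is the set of fixed-point-free elements of order $2$. $\mathrm{Map}(\theta,\gamma)$ is the set of $\iota\in\mathrm{Match}(n)$ such that $\theta$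 and $\iota$ generate a group acting transitively on $\langle n\rangle$ and $\gamma\circ\iota=\gamma$. $\mathrm{Map}_0(\theta,\gamma)=\{\iota\in\mathrm{Map}(\theta,\gamma)\mid c(\theta)+c(\theta\iota)=2+n/2\}$. Trees and weights: a tree $\mathfrak T$ spanning $\langle k\rangle$ is a connected graph with vertex set $\langle k\rangle$ and $k-1$ (unoriented) edges, each edge being a two-element subset of $\langle k\rangle$. Given $\mathfrak T$ with edge set $E$, let $\{x_e\}_{e\in E}$ be i.i.d. random variables uniformly distributed in $(0,1)$; $\mathrm{wt}_{\mathfrak T}$ is the random $k\times k$ real symmetric matrix with diagonal entries $1$ and, for $i\ne j$, $(i,j)$ entry equal to the minimum of $x_e$ over the edges $e$ of the unique path in $\mathfrak T$ from $i$ to $j$. Almost surely $\mathrm{wt}_{\mathfrak T}$ is positive definite; $\sqrt{\mathrm{wt}_{\mathfrak T}}$ is its positive definite square root. Splicing involutions: for a tree $\mathfrak T$ spanning $\langle k\rangle$, $\mathrm{Splice}_{\mathfrak T}(\nu)\subset\mathrm{Perm}(n)$ is the set of involutions $\tau$ ($\tau^2=1$) admitting a factorization $\tau=(i_1\,j_1)\cdots(i_{k-1}\,j_{k-1})$ into disjoint transpositions such that the edge set of $\mathfrak T$ is $\{\{\nu(i_1),\nu(j_1)\},\dots,\{\nu(i_{k-1}),\nu(j_{k-1})\}\}$. $\mathrm{Splice}_{\mathfrak T}(\nu,\gamma)=\{\tau\in\mathrm{Splice}_{\mathfrak T}(\nu)\mid\gamma\circ\tau=\gamma\}$. For $\tau\in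 \mathrm{Splice}_{\mathfrak T}(\nu)$ the permutation $\theta\tau$ is a single cycle of length $n$. Splicing polynomial: in the noncommutative polynomial algebra $\mathbb C\langle \mathbf X_1,\dots,\mathbf X_n\rangle$, $$\mathrm{Poly}_{\theta,\gamma,\nu,\mathfrak T}=\sum_{\tau\in\mathrm{Splice}_{\mathfrak T}(\nu,\gamma)}\mathbf X_{i_1}^{\mathbf 1\{i_1=\tau(i_1)\}}\cdots\mathbf X_{i_n}^{\mathbf 1\{i_n=\tau(i_n)\}},$$ where for each $\tau$ the sequence $i_1,\dots,i_n$ is the unique one with $\theta\tau=(i_1\cdots i_n)$ and $i_1=1$. $\mathrm{Arb}$: let $\{\mathbf Z(i,j)\}_{(i,j)\in\langle k\rangle\times\langle n\rangle}$ be independent noncommutative variables, put $\mathbf Z_{\mathfrak T}(i,j)=\sum_{i'=1}^k\sqrt{\mathrm{wt}_{\mathfrak T}}(i,i')\,\mathbf Z(i',j)$, and $$\mathrm{Arb}_{\theta,\gamma,\nu}=\sum_{\mathfrak T}\mathbb E\Big(\mathrm{Poly}_{\theta,\gamma,\nu,\mathfrak T}\big|_{\mathbf X_i=\mathbf Z_{\mathfrak T}(\nu(i),\gamma(i))\ \text{for}\ i\in\langle n\rangle}\Big)\in\mathbb C\langle\{\mathbf Z(i,j)\}\rangle,$$ the sum being over all trees $\mathfrak T$ spanning $\langle k\rangle$ and the expectation being taken coefficient by coefficient after expansion into monomials in the $\mathbf Z(i,j)$. *)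

(* Defs.v *)
From HB Require Import structures.
From mathcomp Require Import all_boot all_order all_algebra all_fingroup.
(* The notations of monalg clash with those of MathComp-Analysis. *)
From mathcomp.multinomials Require Import -(notations) monalg.
From mathcomp Require Import all_classical all_reals all_analysis.
From mathcomp Require Import complex.

Set Implicit Arguments.
Unset Strict Implicit.
Unset Printing Implicit Defensive.

Import Order.TTheory GRing.Theory Num.Theory.
Import numFieldNormedType.Exports.

Local Open Scope classical_set_scope.
Local Open Scope ring_scope.

(* [(s * t)%g] is "first s, then t" in MathComp; [pcomp s t] is the usual
   composition x |-> s (t x). *)
Definition pcomp (T : finType) (s t : {perm T}) : {perm T} := (t * s)%g.

Definition ncycles (T : finType) (s : {perm T}) : nat := #|porbits s|.

Definition Match (n : nat) : {set 'S_n} :=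
  [set iota : 'S_n | (#[iota]%g == 2%N) && [forall s, iota s != s]].

Definition Map (n : nat) (theta : 'S_n) (gamma : 'I_n -> 'I_n) : {set 'S_n} :=
  [set iota in Match n |
     [transitive <<[set theta; iota]%SET>>%g, on [set: 'I_n]%SET | 'P]
     && [forall s, gamma (iota s) == gamma s]].

(* [n./2] is exact here: n is even as soon as [Match n] is nonempty. *)
Definition Map0 (n : nat) (theta : 'S_n) (gamma : 'I_n -> 'I_n) : {set 'S_n} :=
  [set iota in Map theta gamma |
     (ncycles theta + ncycles (pcomp theta iota) == 2 + n./2)%N].

(* A graph on 'I_k is given by its set of edges, which are 2-element sets. *)
Definition adj (k : nat) (E : {set {set 'I_k}}) : rel 'I_k :=
  fun i j => [set i; j]%SET \in E.

Definition is_tree (k : nat) (E : {set {set 'I_k}}) : bool :=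
  [&& [forall e in E, #|e| == 2%N],
      [forall i, [forall j, connect (adj E) i j]] & #|E|.+1 == k].

(* The vertices, after i, of the simple path from i to j. *)
Definition tree_path (k : nat) (E : {set {set 'I_k}}) (i j : 'I_k) :
    seq 'I_k :=
  xget [::] [set p | [/\ path (adj E) i p, uniq (i :: p) & last i p = j]].

Definition path_edges (k : nat) (E : {set {set 'I_k}}) (i j : 'I_k) :
    seq {set 'I_k} :=
  pairmap (fun a b => [set a; b]%SET) i (tree_path E i j).

(* For i != j the path has at least one edge, so that the minimum below is
   taken over a nonempty sequence, whose head is only used as a seed. *)
Definition wt (R : realType) (k : nat) (E : {set {set 'I_k}})
    (x : {set 'I_k} -> R) : 'M[R]_k :=
  \matrix_(i, j)
    if i == j then 1
    else let es := path_edges E i j in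
         \big[Num.min/x (head finset.set0 es)]_(e <- es) x e.

Definition posdefmx (R : realType) (k : nat) (A : 'M[R]_k) : Prop :=
  A^T = A /\
  forall v : 'rV[R]_k, v != 0 -> 0 < (v *m A *m v^T) ord0 ord0.

Definition sqrtmx (R : realType) (k : nat) (A : 'M[R]_k) : 'M[R]_k :=
  xget 0 [set S : 'M[R]_k | posdefmx S /\ S *m S = A].

Definition mutually_independent (R : realType) (d : measure_display)
    (Omega : measurableType d) (P : probability Omega R) (I : finType)
    (E : {set I}) (x : I -> {RV P >-> R}) : Prop :=
  forall (F : {set I}) (B : I -> set R), F \subset E ->
    (forall e, e \in F -> measurable (B e)) ->
    P (\bigcap_(e in [set` F]) (x e @^-1` B e)) =
    (\prod_(e in F) P (x e @^-1` B e))%E.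

Definition iid_uniform (R : realType) (d : measure_display)
    (Omega : measurableType d) (P : probability Omega R) (I : finType)
    (E : {set I}) (x : I -> {RV P >-> R}) : Prop :=
  mutually_independent E x /\
  forall e, e \in E -> forall B : set R, measurable B ->
    distribution P (x e) B = uniform_prob (@ltr01 R) B.

(* The free algebra C<X_i : i in I>: the algebra of the free monoid of words
   in I. *)
Notation ncpoly C I := (malg (fmonom I) C).

Definition ncX (C : nzRingType) (I : choiceType) (i : I) : ncpoly C I :=
  mkmalgU (fmu i) 1.

(* Substitution X_i := a i. *)
Definition nceval (C : nzRingType) (I : choiceType) (A : lalgType C)
    (a : I -> A) (p : ncpoly C I) : A :=
  mmap (fun c : C => c%:A) (fun w : fmonom I => \prod_(i <- fmonom_val w) a i)
    p.

Definition cexpectation (R : realType) (d : measure_display)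
    (Omega : measurableType d) (P : probability Omega R)
    (X : Omega -> R[i]) : R[i] :=
  Complex (fine 'E_P[fun w => complex.Re (X w)])
          (fine 'E_P[fun w => complex.Im (X w)]).

(* Coefficientwise expectation: the polynomial whose coefficient at each word m
   is the expectation of the coefficient of W at m (0 if there is no such
   polynomial, which cannot happen when W has bounded degree and I is finite). *)
Definition ncexpectation (R : realType) (d : measure_display)
    (Omega : measurableType d) (P : probability Omega R) (I : choiceType)
    (W : Omega -> ncpoly R[i] I) : ncpoly R[i] I :=
  xget 0 [set Q : ncpoly R[i] I | forall m : fmonom I,
            mcoeff m Q = cexpectation P (fun w => mcoeff m (W w))].

Definition Splice (n k : nat) (E : {set {set 'I_k}}) (nu : 'I_n -> 'I_k) :
    {set 'S_n} :=
  [set tau : 'S_n |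
     (tau * tau == 1)%g &&
     [exists s : k.-1.-tuple ('I_n * 'I_n)%type,
        [&& uniq (flatten [seq [:: p.1; p.2] | p <- s]),
            tau == (\prod_(p <- s) tperm p.1 p.2)%g &
            E == [set:: [seq [set nu p.1; nu p.2]%SET | p <- s]]%SET]]].

Definition SpliceC (n k : nat) (E : {set {set 'I_k}}) (nu : 'I_n -> 'I_k)
    (gamma : 'I_n -> 'I_n) : {set 'S_n} :=
  [set tau in Splice E nu | [forall s, gamma (tau s) == gamma s]].

(* [Ordinal n_gt0] is the first element of 'I_n; [traject] lists the cycle
   i_1, ..., i_n of theta o tau starting at that element. *)
Definition splicing_poly (C : nzRingType) (n k : nat) (n_gt0 : (0 < n)%N)
    (theta : 'S_n) (gamma : 'I_n -> 'I_n) (nu : 'I_n -> 'I_k)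
    (E : {set {set 'I_k}}) : ncpoly C 'I_n :=
  \sum_(tau in SpliceC E nu gamma)
    \prod_(i <- traject (pcomp theta tau) (Ordinal n_gt0) n)
      ncX C i ^+ (i == tau i).

Definition ncZ (R : realType) (n k : nat) (S : 'M[R]_k) (i : 'I_k)
    (j : 'I_n) : ncpoly R[i] ('I_k * 'I_n)%type :=
  \sum_(i' < k) (S i i')%:C%C *: ncX R[i] (i', j).

(* [x E] is the family of edge variables used for the tree E. *)
Definition Arb (R : realType) (d : measure_display) (Omega : measurableType d)
    (P : probability Omega R) (n k : nat) (n_gt0 : (0 < n)%N)
    (x : {set {set 'I_k}} -> {set 'I_k} -> {RV P >-> R})
    (theta : 'S_n) (gamma : 'I_n -> 'I_n) (nu : 'I_n -> 'I_k) :
    ncpoly R[i] ('I_k * 'I_n)%type :=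
  \sum_(E : {set {set 'I_k}} | is_tree E)
    ncexpectation P (fun w =>
      nceval
        (fun i => ncZ (sqrtmx (wt E (fun e => x E e w))) (nu i) (gamma i))
        (splicing_poly R[i] n_gt0 theta gamma nu E)).

(* Unital C*-algebras. MathComp-Analysis has no join of [normedModType] with
   [algType], so the norm is part of the mixin. *)
HB.mixin Record isCStarAlgebra (R : realType) A of GRing.Algebra R[i] A := {
  star : A -> A;
  starK : involutive star;
  starD : forall a b : A, star (a + b) = star a + star b;
  starZ : forall (c : R[i]) (a : A), star (c *: a) = c^*%C *: star a;
  starM : forall a b : A, star (a * b) = star b * star a;
  cnorm : A -> R;
  cnorm_eq0 : forall a : A, cnorm a = 0 -> a = 0;
  cnormD : forall a b : A, cnorm (a + b) <= cnorm a + cnorm b;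
  cnormZ : forall (c : R[i]) (a : A),
    cnorm (c *: a) = complex.Re `|c| * cnorm a;
  cnormM : forall a b : A, cnorm (a * b) <= cnorm a * cnorm b;
  cnorm_star : forall a : A, cnorm (star a * a) = cnorm a ^+ 2;
  cnorm_complete : forall u : nat -> A,
    (forall e : R, 0 < e -> exists N : nat, forall m n : nat,
       (N <= m)%N -> (N <= n)%N -> cnorm (u m - u n) < e) ->
    exists l : A, forall e : R, 0 < e -> exists N : nat, forall m : nat,
      (N <= m)%N -> cnorm (u m - l) < e
}.

#[short(type="cstarAlgType")]
HB.structure Definition CStarAlgebra (R : realType) :=
  { A of isCStarAlgebra R A & GRing.Algebra R[i] A }.

Definition faithful_tracial_state (R : realType) (A : cstarAlgType R)
    (phi : {scalar A}) : Prop :=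
  [/\ phi 1 = 1,
      forall a : A, 0 <= phi (star a * a),
      forall a b : A, phi (a * b) = phi (b * a)
    & forall a : A, phi (star a * a) = 0 -> a = 0].

Definition semicircle_pdf (R : realType) (x : R) : R :=
  if `|x| <= 2 then (2 * pi)^-1 * Num.sqrt (4 - x ^+ 2) else 0.

(* The law of a self-adjoint element is the compactly supported probability
   measure with the same moments. *)
Definition standard_semicircular (R : realType) (A : cstarAlgType R)
    (phi : {scalar A}) (a : A) : Prop :=
  star a = a /\
  forall m : nat, phi (a ^+ m) =
    (\int[lebesgue_measure]_x (x ^+ m * semicircle_pdf x))%:C%C.

Definition free_subalgebras (R : realType) (A : cstarAlgType R)
    (phi : {scalar A}) (I : eqType) (B : I -> set A) : Prop :=
  forall s : seq (I * A), s != [::] ->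
    sorted (fun p q : I * A => p.1 != q.1) s ->
    (forall p, p \in s -> B p.1 p.2 /\ phi p.2 = 0) ->
    phi (\prod_(p <- s) p.2) = 0.

(* Freeness of the unital subalgebras C[a i] (which are *-subalgebras when the
   a i are self-adjoint). *)
Definition free_variables (R : realType) (A : cstarAlgType R)
    (phi : {scalar A}) (I : eqType) (a : I -> A) : Prop :=
  free_subalgebras phi (fun i => range (horner_alg (a i))).

(* Main.v *)
(* The trace of a word in real linear combinations [y] of free semicircular elements obeys
   the recursion [phi (y_1 ... y_m) = \sum_i K i m * phi (y_1 ... y_(i-1)) *
   phi (y_(i+1) ... y_(m-1))], where [K] is the covariance, because alternating products of
   Chebyshev polynomials in the variables have trace 0.  Weighted sums over the planar
   matchings of a cycle obey the same recursion.  As [sqrt wt] squares to [wt], the trace of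
   the splicing polynomial of a tree is therefore a sum over pairs [(tau, p)], where [tau] is
   a splicing involution and [p] a planar matching of its fixed points, of products of
   entries of [wt].  Gluing [tau] and [p] gives an element [iota] of [Map_0]; conversely
   [tau] is recovered from [iota] and the set [F] of its transpositions that are mapped by
   [nu] onto the edges of the tree.  It remains to see that for each [iota]
   [\sum_F E (\prod_(f notin F) wt_F f) = 1], where [F] runs over the spanning trees of the
   multigraph of transpositions of [iota].  Give the edges independent uniform weights: the
   summand is the probability that [F] is the maximal spanning tree, for this happens iff
   each [f] outside [F] is lighter than all the edges of the path of [F] joining its ends. *)

From HB Require Import structures.
Require Import Defs.
From mathcomp Require Import all_boot all_order all_algebra all_fingroup.
From mathcomp.multinomials Require Import -(notations) monalg.
From mathcomp Require Import all_classical all_reals all_analysis.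
From mathcomp Require Import complex ring lra zify.
From mathcomp Require Import measurable_realfun.
From mathcomp Require cyclic spectral.

Set Implicit Arguments.
Unset Strict Implicit.
Unset Printing Implicit Defensive.

Import Order.TTheory GRing.Theory Num.Theory.
Import numFieldNormedType.Exports.

Local Open Scope ring_scope.

(** * Words in free semicircular variables *)

(** The i.i.d. hypothesis concerns each family [x E] separately and only its values on the edges of
    [E]; no joint law is given for the families of two trees or for the transpositions outside a
    tree. The maximal spanning tree can therefore not be realized on [Omega]. Instead, all
    transpositions receive weights on a finite grid and the outcomes of Kruskal's algorithm are
    counted exactly; each expectation is compared with its share of the count, and the sum, which
    does not depend on the mesh, must be 1.

    The second obstacle is that [sqrtmx] is a choice and that [wt] is positive definite only almost
    surely. Random quantities are cut off by the indicator of [good_event], and the entries of the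
    root become measurable as limits of polynomials in [wt]; the trace of [wt] is constant, so the
    same polynomials serve at every sample point.

    Planarity is expressed by counting cycles, never by forbidding crossings: gluing [tau] to [p] is
    then a product of permutations, and genus zero of the glued map is arithmetic. *)

Section NCEval.
Variables (C : comNzRingType) (I : choiceType) (A : lalgType C) (a : I -> A).

Let h := fun w : fmonom I => \prod_(i <- fmonom_val w) a i.

Fact word_eval_is_mmorphism : mmorphism h.
Proof.
split=> [w w'|]; rewrite /h; last by rewrite fm1 big_nil.
by rewrite fmM big_cat.
Qed.

HB.instance Definition _ := monalg.isMultiplicative.Build (fmonom I) A h word_eval_is_mmorphism.

Let ncevalE p : nceval a p = mmap (in_alg A) h p. Proof. by []. Qed.

Lemma nceval1 : nceval a 1 = 1.
Proof. by rewrite ncevalE mmap1. Qed.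

Lemma ncevalX i : nceval a (ncX C i) = a i.
Proof. by rewrite ncevalE mmapU /= /h fmU big_seq1 scale1r mul1r. Qed.

Lemma ncevalZ c p : nceval a (c *: p) = c *: nceval a p.
Proof. by rewrite !ncevalE mmapZ mulr_algl. Qed.

Lemma ncevalD p q : nceval a (p + q) = nceval a p + nceval a q.
Proof. by rewrite ncevalE raddfD. Qed.

Lemma nceval_sum (J : Type) (r : seq J) (P : pred J) (F : J -> ncpoly C I) :
  nceval a (\sum_(j <- r | P j) F j) = \sum_(j <- r | P j) nceval a (F j).
Proof. by rewrite ncevalE raddf_sum. Qed.

Hypothesis scalar_central : forall (c : C) (u : A), u * c%:A = c%:A * u.

Lemma ncevalM p q : nceval a (p * q) = nceval a p * nceval a q.
Proof.
rewrite !ncevalE.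
have [-> //] : multiplicative (mmap (in_alg A) h).
by apply: commr_mmap_is_multiplicative => g m m'; rewrite /GRing.comm -scalar_central.
Qed.

Lemma nceval_prod (J : Type) (r : seq J) (P : pred J) (F : J -> ncpoly C I) :
  nceval a (\prod_(j <- r | P j) F j) = \prod_(j <- r | P j) nceval a (F j).
Proof. exact: (big_morph (nceval a) ncevalM nceval1). Qed.

End NCEval.

Lemma algType_scalar_central (C : comNzRingType) (A : algType C) (c : C) (u : A) :
  u * c%:A = c%:A * u.
Proof. by rewrite mulr_algl mulr_algr. Qed.

(** Needed because substitution is also performed with values in the free algebra itself, when the
    [ncZ] are plugged into the splicing polynomial. *)
Lemma ncpoly_scalar_central (C : comNzRingType) (I : choiceType) (c : C) (p : ncpoly C I) :
  p * c%:A = c%:A * p.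
Proof.
have -> : c%:A = mkmalgU mone c :> ncpoly C I by rewrite -mul_malgC mulr1.
rewrite !malgM_def fgmulgU fgmulUg; apply: eq_bigr => w _.
by rewrite mulrC mulm1 mul1m.
Qed.

Lemma ncpoly_scalerAr (C : comNzRingType) (I : choiceType) (c : C) (p q : ncpoly C I) :
  c *: (p * q) = p * (c *: q).
Proof. by rewrite -[c *: q]mulr_algl mulrA ncpoly_scalar_central -mulrA mulr_algl. Qed.


(** * Wick products of linear combinations of letters *)

Section Wick.
Variables (C : comNzRingType) (A : algType C) (L : finType) (z : L -> A).

(* The Wick (noncommutative Chebyshev) product of the letters of [w]. *)
Fixpoint wick (w : seq L) : A :=
  if w is l :: w1 then
    z l * wick w1 - (if w1 is l' :: w2 then (l == l')%:R *: wick w2 else 0)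
  else 1.

Variables (J : Type) (alpha : J -> L -> C).

Fixpoint multilin (V : lmodType C) (t : seq J) (f : seq L -> V) : V :=
  if t is a :: t1 then \sum_l alpha a l *: multilin t1 (fun w => f (l :: w))
  else f [::].

Lemma eq_multilin (V : lmodType C) t (f g : seq L -> V) :
  f =1 g -> multilin t f = multilin t g.
Proof.
elim: t f g => [|a t IH] f g fg /=; first exact: fg.
by apply: eq_bigr => l _; congr (_ *: _); apply: IH => w; exact: fg.
Qed.

Lemma multilin_linear (V W : lmodType C) (F : {linear V -> W}) t (f : seq L -> V) :
  F (multilin t f) = multilin t (F \o f).
Proof.
elim: t f => [//|a t IH] f /=.
by rewrite linear_sum; apply: eq_bigr => l _; rewrite linearZ /= IH.
Qed.

Lemma multilinD (V : lmodType C) t (f g : seq L -> V) :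
  multilin t (fun w => f w + g w) = multilin t f + multilin t g.
Proof.
elim: t f g => [//|a t IH] f g /=.
by rewrite -big_split; apply: eq_bigr => l _; rewrite IH scalerDr.
Qed.

Lemma multilinZ (V : lmodType C) t c (f : seq L -> V) :
  multilin t (fun w => c *: f w) = c *: multilin t f.
Proof.
elim: t f => [//|a t IH] f /=.
rewrite scaler_sumr; apply: eq_bigr => l _.
by rewrite IH !scalerA mulrC.
Qed.

Let y a := \sum_l alpha a l *: z l.
Let K a b := \sum_l alpha a l * alpha b l.
Let psi t := multilin t wick.

(** The correction term in [wick] contracts equal adjacent letters; summed against the coefficients
    of [a] and [b], the Kronecker delta becomes the covariance [K a b]. *)
Lemma mul_psi a t :
  y a * psi t = psi (a :: t) + (if t is b :: t' then K a b *: psi t' else 0).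
Proof.
rewrite /y mulr_suml /psi /=.
transitivity (\sum_l alpha a l *: multilin t (fun w => z l * wick w)).
  apply: eq_bigr => l _; rewrite -scalerAl; congr (_ *: _).
  exact: (multilin_linear (z l \*o (idfun : {linear A -> A}))).
have E l t' : multilin t' (fun w => z l * wick w) =
    multilin t' (fun w => wick (l :: w)) +
    multilin t' (fun w => if w is l' :: w2 then (l == l')%:R *: wick w2 else 0).
  rewrite -multilinD; apply: eq_multilin => w /=; by rewrite subrK.
rewrite (eq_bigr _ (fun l _ => congr1 (fun v => alpha a l *: v) (E l t))).
rewrite (eq_bigr _ (fun l _ => scalerDr _ _ _)) big_split /=; congr (_ + _).
case: t => [|b t] /=; first by apply: big1 => l _; rewrite scaler0.
rewrite /K scaler_suml; apply: eq_bigr => l _.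
rewrite (bigD1 l) //= big1 ?addr0 => [|l' ne].
  rewrite scalerA; congr (_ *: _); apply: eq_multilin => w.
  by rewrite eqxx scale1r.
rewrite (@eq_multilin _ _ _ (fun w => 0 *: wick w)) => [|w].
  by rewrite multilinZ scale0r scaler0.
by rewrite eq_sym (negbTE ne).
Qed.

End Wick.

Section StackRecursion.
Variables (C : comNzRingType) (J : Type) (K : J -> J -> C).
(** To be read as the trace of the product of the letters [s] times the Wick product of the stack
    [t]. The last letter of [s] is either pushed on the stack or contracted with its top. *)
Variable P : seq J -> seq J -> C.
Hypothesis P_nil : forall t, P [::] t = (nilp t)%:R.
Hypothesis P_rcons : forall s a t,
  P (rcons s a) t = P s (a :: t) + (if t is b :: t' then K a b * P s t' else 0).

(* The letter matched with the top [b] of the stack cuts [s] in two. *)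
Lemma stack_top s b t : P s (b :: t) =
  \sum_(i < size s)
    K (nth b s i) b * P (drop i.+1 s) [::] * P (take i s) t.
Proof.
have [m] := ubnP (size s); elim: m => // m IHm in s b t *.
case/lastP: s => [|s a]; first by rewrite P_nil big_ord0.
rewrite size_rcons !ltnS => le_m; rewrite P_rcons (IHm s a (b :: t)) //.
rewrite big_ord_recr /= nth_rcons ltnn eqxx.
have -> : drop (size s).+1 (rcons s a) = [::].
  by rewrite -(size_rcons s a) drop_size.
rewrite P_nil mulr1 -cats1 take_size_cat //; congr (_ + _).
(* The last summand, already cancelled, matched [a] with [b]. In the others [i] is the partner of
   [a] and [j < i] that of [b]; for fixed [j] the sum over [i] is the induction hypothesis for the
   letters after [j] with [a] alone on the stack. *)
transitivity (\sum_(i < size s) \sum_(j < size s | (j < i)%N)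
   K (nth a s i) a * P (drop i.+1 s) [::] *
   (K (nth b s j) b * P (drop j.+1 (take i s)) [::] * P (take j s) t)).
  apply: eq_bigr => i _; rewrite IHm; last first.
    by rewrite size_take ltn_ord (ltn_trans (ltn_ord i)).
  rewrite size_take ltn_ord.
  rewrite (big_ord_widen_cond _ xpredT (fun j => K (nth b (take i s) j) b *
     P (drop j.+1 (take i s)) [::] * P (take j (take i s)) t) (ltnW (ltn_ord i))).
  rewrite mulr_sumr; apply: eq_bigr => j ltji.
  by rewrite nth_take // take_takel // ltnW.
rewrite (exchange_big_dep xpredT) //=; apply: eq_bigr => j _.
rewrite nth_cat ltn_ord drop_cat.
have -> : take j (s ++ [:: a]) = take j s by rewrite takel_cat // ltnW.
have Gr s' : P (rcons s' a) [::] = P s' [:: a] by rewrite P_rcons addr0.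
have -> : (if (j.+1 < size s)%N then drop j.+1 s ++ [:: a]
   else drop (j.+1 - size s) [:: a]) = rcons (drop j.+1 s) a.
  case: ltnP => [_|le]; first by rewrite cats1.
  have -> : j.+1 = size s by apply/eqP; rewrite eqn_leq le ltn_ord.
  by rewrite subnn drop_size.
rewrite Gr IHm; last by rewrite size_drop (leq_ltn_trans (leq_subr _ _)).
rewrite mulr_sumr mulr_suml size_drop.
pose f i := K (nth b s j) b * (K (nth a s i) a * P (drop i.+1 s) [::] *
  P (take (i - j.+1) (drop j.+1 s)) [::]) * P (take j s) t.
transitivity (\sum_(j.+1 <= i < size s) f i); last first.
  rewrite -[j.+1]add0n big_addn big_mkord; apply: eq_bigr => i _.
  by rewrite /f addnK nth_drop drop_drop addSn [(j.+1 + i)%N]addnC.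
rewrite big_geq_mkord; apply: eq_bigr => i ltji.
rewrite /f take_drop subnK //; ring.
Qed.

End StackRecursion.

(** * Chebyshev polynomials of the second kind *)

Section Chebyshev.
Variable C : comNzRingType.

(** [cheb m] is U_m(X/2), with U_m the Chebyshev polynomial of the second kind. Carrying two
    consecutive ones makes the three-term recursion structural. *)
Fixpoint cheb2 (m : nat) : {poly C} * {poly C} :=
  if m is m1.+1 then let: (u, v) := cheb2 m1 in (v, 'X * v - u) else (1, 'X).

Definition cheb m := (cheb2 m).1.

Lemma chebSS m : cheb m.+2 = 'X * cheb m.+1 - cheb m.
Proof. by rewrite /cheb /=; case: (cheb2 m). Qed.

(** ['X * cheb m - cheb m.+1] stands for the polynomial of index m - 1 and makes sense also at m =
    0. After rescaling this is the classical (1 - x^2) U_m' = - m x U_m + (m + 1) U_(m-1). *)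
Lemma cheb_deriv m : (4 - 'X ^+ 2) * (cheb m)^`() + m%:R * 'X * cheb m
  - 2 * m.+1%:R * ('X * cheb m - cheb m.+1) = 0.
Proof.
suff [] : let F m := (4 - 'X ^+ 2) * (cheb m)^`() + m%:R * 'X * cheb m
  - 2 * m.+1%:R * ('X * cheb m - cheb m.+1) in F m = 0 /\ F m.+1 = 0 by [].
elim: m => [|m [IH0 IH1]] F.
  rewrite /F chebSS /cheb /= derivC derivX; split; ring.
split=> //; rewrite -[RHS](_ : ('X * F m.+1 - F m) = 0); last first.
  by rewrite /F IH0 IH1 mulr0 subr0.
rewrite /F !chebSS !poly.derivE; ring.
Qed.

Lemma cheb_ode m : (4 - 'X ^+ 2) * (cheb m)^`()^`() - 3 * 'X * (cheb m)^`()
  + m%:R * m.+2%:R * cheb m = 0.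
Proof.
suff [] : let F m := (4 - 'X ^+ 2) * (cheb m)^`()^`() - 3 * 'X * (cheb m)^`()
  + m%:R * m.+2%:R * cheb m in F m = 0 /\ F m.+1 = 0 by [].
elim: m => [|m [IH0 IH1]] F.
  rewrite /F /cheb /= derivC derivX linear0 derivC; split; ring.
have R1 := cheb_deriv m.+1; rewrite chebSS in R1.
(* Differentiating ['X * cheb m.+1] twice produces twice the first derivative of [cheb m.+1]; the
   multiple of [cheb_deriv] added here absorbs it. *)
split=> //; rewrite -[RHS](_ : ('X * F m.+1 - F m) + 2 * (
 (4 - 'X ^+ 2) * (cheb m.+1)^`() + m.+1%:R * 'X * cheb m.+1
  - 2 * m.+2%:R * ('X * cheb m.+1 - ('X * cheb m.+1 - cheb m))) = 0); last first.
  by rewrite /F IH0 IH1 R1 !mulr0 subr0 addr0.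
rewrite /F !chebSS !poly.derivE; ring.
Qed.

End Chebyshev.

Section ChebyshevMoments.
Variables (C : numFieldType) (A : algType C) (phi : {scalar A}) (a : A).
(** For j = 2r + 1 this is the Catalan recursion (r + 2) C_(r+1) = 2 (2r + 1) C_r. At j = 0, where
    the factor [j%:R] makes [j.-1] harmless, it says that the mean is 0. *)
Hypothesis moment : forall j,
  4 * j%:R * phi (a ^+ j.-1) = j.+3%:R * phi (a ^+ j.+1).

Let pL (p : {poly C}) : C := phi (horner_alg a p).

Fact pL_is_scalar : scalar pL.
Proof.
move=> c p q; rewrite /pL -mul_polyC rmorphD rmorphM /= horner_algC mulr_algl.
exact: linearP.
Qed.

HB.instance Definition _ := GRing.isLinear.Build C {poly C} C *%R pL pL_is_scalar.

Let pLX j : pL 'X^j = phi (a ^+ j).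
Proof. by rewrite /pL rmorphXn /= horner_algX. Qed.

(** Stein's identity of the semicircle law: with s = sqrt (4 - x^2), the polynomial times s is the
    derivative of (4 - x^2) s p, which vanishes at both ends of the support. On monomials it is the
    hypothesis [moment]. *)
Lemma moment_stein (p : {poly C}) : pL ((4 - 'X ^+ 2) * p^`() - 3 * 'X * p) = 0.
Proof.
rewrite -[p]coefK poly_def linear_sum /= !mulr_sumr -sumrB linear_sum big1 // => j _.
set c := p`_j; rewrite linearZ /= -!scalerAr -scalerBr linearZ /=.
have -> : (4 - 'X ^+ 2) * ('X^j)^`() - 3 * 'X * 'X^j =
    (4 * j%:R) *: 'X^(j.-1) - j.+3%:R *: 'X^(j.+1) :> {poly C}.
  case: (nat_of_ord j) => [|i]; rewrite derivXn -!mul_polyC /= !rmorph_nat !exprS; ring.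
rewrite linearB !linearZ /= !pLX moment.
by rewrite [_ *: _]mulrN subrr mulr0.
Qed.

(** By the differential equation, - m (m + 2) [cheb m] is the Stein operator applied to the
    derivative of [cheb m], so its trace is 0 as soon as m > 0. *)
Lemma phi_cheb m : phi 1 = 1 -> phi (horner_alg a (cheb C m)) = (m == 0)%:R.
Proof.
move=> phi1; case: m => [|m]; first by rewrite /cheb /= rmorph1.
apply: (@mulfI _ (m.+1%:R * m.+3%:R)); first by rewrite mulf_neq0 ?pnatr_eq0.
rewrite mulr0.
have -> : m.+1%:R * m.+3%:R * phi (horner_alg a (cheb C m.+1)) =
    pL ((m.+1%:R * m.+3%:R) *: cheb C m.+1) by rewrite linearZ.
have /eqP := cheb_ode C m.+1; rewrite addrC addr_eq0 => /eqP E.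
by rewrite -mul_polyC rmorphM /= !rmorph_nat E linearN /= moment_stein oppr0.
Qed.
End ChebyshevMoments.

Section FreeSemicircular.
Variables (R : realType) (A : cstarAlgType R) (phi : {scalar A}) (L : finType).
Variable z : L -> A.
Hypothesis phi1 : phi 1 = 1.
Hypothesis moment : forall l j,
  4 * j%:R * phi (z l ^+ j.-1) = j.+3%:R * phi (z l ^+ j.+1).
Hypothesis z_free : free_variables phi z.

(** Inside a run of equal letters the Wick recursion is the Chebyshev recursion; the first letter of
    [w] must differ from [l] so that no contraction crosses the end of the run. *)
Lemma wick_run l m w : (if w is l' :: _ then l' != l else true) ->
  wick z (nseq m l ++ w) = horner_alg (z l) (cheb R[i] m) * wick z w.
Proof.
move=> w_l.
suff [] : wick z (nseq m l ++ w) = horner_alg (z l) (cheb R[i] m) * wick z w /\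
  wick z (nseq m.+1 l ++ w) = horner_alg (z l) (cheb R[i] m.+1) * wick z w by [].
elim: m => [|m [IH0 IH1]]; split=> //.
- by rewrite /cheb /= rmorph1 mul1r.
- rewrite /cheb /= horner_algX; case: w w_l => [|l' w] /=; first by rewrite subr0.
  by rewrite eq_sym => /negbTE ->; rewrite scale0r subr0.
rewrite [LHS]/(z l * wick z (nseq m.+1 l ++ w) - (l == l)%:R *: wick z (nseq m l ++ w)).
rewrite IH1 IH0 eqxx scale1r chebSS rmorphB rmorphM /= horner_algX.
by rewrite mulrBl mulrA.
Qed.

(** Cut [w] into maximal runs: each contributes a centred polynomial in its variable. The clause on
    [ohead] carries the leading letter through the induction, so that alternation survives adding a
    run in front. *)
Lemma wick_alternating w : exists s : seq (L * A),
  [/\ sorted (fun p q : L * A => p.1 != q.1) s,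
      forall p, p \in s -> range (horner_alg (z p.1)) p.2 /\ phi p.2 = 0,
      \prod_(p <- s) p.2 = wick z w &
      ohead [seq p.1 | p <- s] = ohead w].
Proof.
have [m] := ubnP (size w); elim: m w => // m IHm [|l w] ltm.
  by exists [::]; split; rewrite ?big_nil.
have [j [w' [def_w w'_l]]] : exists j w', l :: w = nseq j.+1 l ++ w' /\
    is_true (if w' is l' :: _ then l' != l else true).
  elim: w l {ltm} => [|l' w IH] l; first by exists 0, [::].
  have [->|ne] := eqVneq l' l; last by exists 0, (l' :: w).
  by have [j [w' [-> w'l]]] := IH l; exists j.+1, w'.
rewrite def_w (wick_run _ w'_l).
have [|s [s_alt s_cent s_prod s_hd]] := IHm w'.
  move: ltm; rewrite def_w size_cat size_nseq addSn ltnS.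
  exact: leq_ltn_trans (leq_addl _ _).
exists ((l, horner_alg (z l) (cheb R[i] j.+1)) :: s); split=> //.
- case: s s_alt s_hd {s_cent s_prod} => [|p s] //= -> hd; rewrite andbT.
  by case: w' w'_l {def_w} hd => // l' w' ne [->]; rewrite eq_sym.
- move=> p; rewrite inE => /orP[/eqP -> /=|/s_cent //]; split; first by eexists.
  by rewrite (phi_cheb (moment l)).
- by rewrite big_cons s_prod.
Qed.

Lemma phi_wick w : phi (wick z w) = (nilp w)%:R.
Proof.
have [s [s_alt s_cent <- s_hd]] := wick_alternating w.
case: s s_alt s_cent s_hd => [|p s] s_alt s_cent.
  by case: w => //= _; rewrite big_nil phi1.
by case: w => //= l w _; apply: z_free.
Qed.

Variables (J : Type) (alpha : J -> L -> R[i]).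
Let y a := \sum_l alpha a l *: z l.
Let K a b := \sum_l alpha a l * alpha b l.

Lemma phi_word_rcons s a : phi (\prod_(b <- rcons s a) y b) =
  \sum_(i < size s) K (nth a s i) a * phi (\prod_(b <- drop i.+1 s) y b) *
     phi (\prod_(b <- take i s) y b).
Proof.
pose psi t := multilin alpha t (wick z).
pose P s t := phi (\prod_(b <- s) y b * psi t).
have psi0 s' : P s' [::] = phi (\prod_(b <- s') y b) by rewrite /P /psi /= mulr1.
have P0 t : P [::] t = (nilp t)%:R.
  rewrite /P big_nil mul1r /psi (multilin_linear alpha phi).
  rewrite (eq_multilin _ _ phi_wick).
  case: t => //= b t; apply: big1 => l _.
  rewrite (@eq_multilin _ _ _ _ _ _ _ (fun w => 0 *: (1 : R[i]^o))) => [|w].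
    by rewrite multilinZ scale0r scaler0.
  by rewrite scale0r.
have Pr s' b t : P (rcons s' b) t = P s' (b :: t) +
    (if t is c :: t' then K b c * P s' t' else 0).
  rewrite /P -cats1 big_cat big_seq1 /= -mulrA mul_psi mulrDr linearD; congr (_ + _).
  case: t => [|c t]; first by rewrite mulr0 linear0.
  by rewrite -scalerAr linearZ.
rewrite -psi0 Pr addr0 (stack_top P0 Pr).
by apply: eq_bigr => i _; rewrite !psi0.
Qed.

End FreeSemicircular.

(** * Moments of the semicircle law *)

Section SemicircleMoments.
Local Open Scope classical_set_scope.
Variable R : realType.
Local Notation mu := (@lebesgue_measure R).

Let s (x : R) : R := Num.sqrt (4 - x ^+ 2).

Let s_cont : continuous s.
Proof.
move=> x; apply: (@continuous_comp _ _ _ (fun x : R => 4 - x ^+ 2) Num.sqrt).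
  by apply: cvgB; [exact: cvg_cst|exact: exprn_continuous].
exact: sqrt_continuous.
Qed.

Let mono_cont j : continuous (fun x : R => x ^+ j * s x).
Proof. by move=> x; apply: cvgM; [exact: exprn_continuous|exact: s_cont]. Qed.

Let mono_integrable j : mu.-integrable `[-2, 2] (EFin \o (fun x : R => x ^+ j * s x)).
Proof.
apply: continuous_compact_integrable; first exact: segment_compact.
exact: continuous_subspaceT.
Qed.

Let scaled_integrable (c : R) j :
  mu.-integrable `[-2, 2] (EFin \o (fun x : R => c * (x ^+ j * s x))).
Proof.
apply: continuous_compact_integrable; first exact: segment_compact.
apply: continuous_subspaceT => x; apply: cvgM; first exact: cvg_cst.
exact: mono_cont.
Qed.

Let momentE j : \int[mu]_x (x ^+ j * semicircle_pdf x) =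
  (2 * pi)^-1 * \int[mu]_(x in `[-2, 2]) (x ^+ j * s x).
Proof.
rewrite -RintegralZl // [RHS]Rintegral_mkcond; apply: eq_Rintegral => x _.
rewrite patchE /semicircle_pdf mem_setE in_itv /= ler_norml.
by case: ifP => _; rewrite ?mulr0 // mulrCA.
Qed.

(** The primitive (4 - x^2)^(3/2) x^j, which vanishes at both ends of the support. *)
Let F j (x : R) : R := (4 - x ^+ 2) * s x * x ^+ j.

Let F_derive j (x : R) : -2 < x < 2 -> is_derive x 1 (F j)
  (4 * j%:R * (x ^+ j.-1 * s x) - j.+3%:R * (x ^+ j.+1 * s x)).
Proof.
move=> /andP[x1 x2].
have x_gt0 : 0 < 4 - x ^+ 2 by nra.
have s_gt0 : 0 < s x by rewrite sqrtr_gt0.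
have s2 : s x ^+ 2 = 4 - x ^+ 2 by rewrite sqr_sqrtr // ltW.
have dq : is_derive x 1 (fun x : R => 4 - x ^+ 2) (- (2 * x)).
  by apply: is_derive_eq; rewrite ?scaler1 /GRing.scale /=; ring.
have ds : is_derive x 1 s ((2 * s x)^-1 * - (2 * x)).
  rewrite /s; apply: (@is_derive1_comp _ Num.sqrt (fun x : R => 4 - x ^+ 2)).
  exact: is_derive1_sqrt.
have dp : is_derive x 1 (fun x : R => x ^+ j) (j%:R * x ^+ j.-1).
  apply: DeriveDef; first exact: exprn_derivable.
  by rewrite exp_derive /GRing.scale /= mulr1.
have dF := is_deriveM (is_deriveM dq ds) dp.
apply: (eq_rect _ (fun v => is_derive x 1 (F j) v) dF).
rewrite /GRing.scale /= -[(_ * _) x]/((4 - x ^+ 2) * s x) -s2.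
have -> : s x ^+ 2 * ((2 * s x)^-1 * - (2 * x)) = - x * s x by field; lra.
have x2E : x ^+ 2 = 4 - s x ^+ 2 by rewrite s2; ring.
case: (j) => [|i] /=; first by rewrite expr0 expr1; ring.
rewrite !exprS; set e := x ^+ i.
transitivity (e * s x * (i.+1%:R * s x ^+ 2 - 3 * x ^+ 2)); first by ring.
transitivity (e * s x * (4 * i.+1%:R - i.+4%:R * x ^+ 2)); last by ring.
by rewrite x2E; ring.
Qed.

Lemma semicircle_moment j :
  4 * j%:R * \int[mu]_x (x ^+ j.-1 * semicircle_pdf x) =
  j.+3%:R * \int[mu]_x (x ^+ j.+1 * semicircle_pdf x).
Proof.
rewrite !momentE !(mulrCA _ (2 * pi)^-1); congr (_ * _).
apply/eqP; rewrite -subr_eq0 -!RintegralZl // -RintegralB //; apply/eqP.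
(* The square root is not differentiable at -2 and 2; the fundamental theorem asks for the
   derivative inside the segment and for continuity at its ends. *)
rewrite /Rintegral (@continuous_FTC2 _ _ (F j)) /=.
- by rewrite /F sqrrN expr2 -[4]/(2 * 2)%:R natrM subrr !mul0r subrr.
- by lra.
- apply: continuous_subspaceT => x.
  by apply: cvgB; apply: cvgM; [exact: cvg_cst|exact: mono_cont|exact: cvg_cst|exact: mono_cont].
- have F_cont : continuous (F j).
    rewrite /F => x; apply: cvgM; last exact: exprn_continuous.
    apply: cvgM; last exact: s_cont.
    by apply: cvgB; [exact: cvg_cst|exact: exprn_continuous].
  split=> [x||].
  - by rewrite in_itv /= => /F_derive - /(_ j) [].
  - by apply: cvg_at_right_filter; exact: F_cont.
  - by apply: cvg_at_left_filter; exact: F_cont.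
- by move=> x; rewrite in_itv /= derive1E => /F_derive - /(_ j) [].
Qed.

End SemicircleMoments.

(** * Spectral decomposition of real positive definite matrices *)

Section RealSpectral.
Variable R : realType.
Local Notation C := R[i].
Local Notation toC := (real_complex R).

Lemma Re_sum (I : Type) (r : seq I) (P : pred I) (F : I -> C) :
  complex.Re (\sum_(i <- r | P i) F i) = \sum_(i <- r | P i) complex.Re (F i).
Proof. by apply: (big_morph (@complex.Re R)) => // [[a b] [c d]]. Qed.

Lemma quadratic_form k (A : 'M[R]_k) (v : 'rV[R]_k) :
  (v *m A *m v^T) ord0 ord0 = \sum_i \sum_j v ord0 i * v ord0 j * A i j.
Proof.
rewrite mxE exchange_big; apply: eq_bigr => j _; rewrite !mxE mulr_suml.
by apply: eq_bigr => i _; rewrite mulrAC.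
Qed.

Import sesquilinear spectral.
Local Open Scope sesquilinear_scope.

(* The spectral projections of [A] are [al l i * al l j + be l i * be l j]. *)
Lemma real_spectral k (A : 'M[R]_k.+1) : posdefmx A ->
  exists (d : 'I_k.+1 -> R) (al be : 'M[R]_k.+1),
    [/\ forall l, 0 < d l,
        forall l, \sum_i (al l i ^+ 2 + be l i ^+ 2) = 1 &
        forall (p : {poly R}) i j, horner_mx A p i j =
          \sum_l (al l i * al l j + be l i * be l j) * p.[d l]].
Proof.
move=> [A_sym A_pos]; pose AC := map_mx toC A.
have conjE (x : C) : x^* = conjc x by [].
have AC_herm : AC \is hermsymmx.
  apply/is_hermitianmxP; rewrite expr0 scale1r; apply/matrixP => i j.
  by rewrite !mxE -{1}A_sym mxE conjE conjc_real.
have /orthomx_spectralP := hermitian_normalmx AC_herm.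
have := spectral_unitarymx AC; have := hermitian_spectral_diag_real AC_herm.
move: (spectralmx AC) (spectral_diag AC) => P D D_real P_unit.
rewrite invmx_unitary // => AC_def.
have PP : P *m P^t* = 1%:M by apply/unitarymxP.
pose d l := complex.Re (D ord0 l).
have dE l : D ord0 l = (d l)%:C%C by rewrite RRe_real //; exact: (mxOverP D_real).
pose al := map_mx (@complex.Re R) P; pose be := map_mx (@complex.Im R) P.
have PE l i : P l i = (al l i +i* be l i)%C by rewrite !mxE; case: (P l i).
have norm1 l : \sum_i (al l i ^+ 2 + be l i ^+ 2) = 1.
  have /matrixP/(_ l l) := PP; rewrite !mxE eqxx => /(congr1 (@complex.Re R)).
  rewrite Re_sum /= => <-; apply: eq_bigr => i _; rewrite !mxE conjE PE /=.
  ring.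
have PsP : P^t* *m P = 1%:M by apply: mulmx1C.
have mulCr (a : R) (x : C) : complex.Re (x * a%:C%C) = complex.Re x * a.
  by case: x => u w /=; ring.
have normP l i j : complex.Re (P^t* i l * P l j) = al l i * al l j + be l i * be l j.
  by rewrite !mxE conjE; case: (P l i) (P l j) => a b [c e] /=; ring.
exists d, al, be; split=> // [l|p i j].
  have row_pos (v : 'rV[R]_k.+1) : 0 <= (v *m A *m v^T) ord0 ord0.
    have [->|/A_pos/ltW //] := eqVneq v 0.
    by rewrite mul0mx mul0mx mxE.
  (* [al l + i be l] is an eigenvector for [d l]. In the real part of its Hermitian form the cross
     terms drop out and the two real forms remain; they cannot both vanish, since the vector has
     norm 1. *)
  have -> : d l = (row l al *m A *m (row l al)^T) ord0 ord0
                + (row l be *m A *m (row l be)^T) ord0 ord0.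
    have : (P *m AC *m P^t*) l l = D ord0 l.
      by rewrite AC_def !mulmxA PP mul1mx -mulmxA PP mulmx1 mxE eqxx.
    move=> /(congr1 (@complex.Re R)); rewrite -/(d l) => <-.
    rewrite !quadratic_form -big_split mxE Re_sum /=.
    rewrite (eq_bigr _ (fun i _ => esym (big_split _ _ _ _ _))) exchange_big /=.
    apply: eq_bigr => j _; rewrite mxE mulr_suml Re_sum; apply: eq_bigr => i _.
    rewrite !mxE conjE; case: (P l i) (P l j) => a b [c e] /=; ring.
  rewrite lt_neqAle addr_ge0 // andbT eq_sym paddr_eq0 //.
  apply/negP => /andP[/eqP ha /eqP hb].
  have row0 (M : 'M[R]_k.+1) : (row l M *m A *m (row l M)^T) ord0 ord0 = 0 -> forall i, M l i = 0.
    move=> h i; apply/eqP; have [/rowP/(_ i)|/A_pos] := eqVneq (row l M) 0.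
      by rewrite !mxE => ->.
    by rewrite h ltxx.
  have := norm1 l; rewrite big1 => [/eqP|i _]; first by rewrite eq_sym oner_eq0.
  by rewrite (row0 _ ha) (row0 _ hb) expr0n addr0.
have main : map_mx toC (horner_mx A p) = P^t* *m diag_mx (\row_l (p.[d l])%:C%C) *m P.
  elim/poly_ind: p => [|p c IH].
    rewrite rmorph0 map_mx0; have -> : \row_l ((0 : {poly R}).[d l])%:C%C = 0 :> 'rV[C]_k.+1.
      by apply/rowP => l; rewrite !mxE horner0.
    by rewrite linear0 mulmx0 mul0mx.
  rewrite rmorphD rmorphM /= horner_mx_X horner_mx_C map_mxD map_mxM IH.
  have -> : \row_l ((p * 'X + c%:P).[d l])%:C%C =
     \row_l ((p.[d l])%:C%C * D ord0 l) + const_mx c%:C%C :> 'rV[C]_k.+1.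
    by apply/rowP => l; rewrite !mxE !hornerE rmorphD rmorphM /= dE.
  rewrite linearD /= mulmxDr mulmxDl diag_const_mx map_scalar_mx; congr (_ + _); last first.
    by rewrite mul_mx_scalar -scalemxAl PsP scalemx1.
  rewrite -/AC AC_def -!mulmxA; congr (_ *m _); rewrite !mulmxA.
  rewrite -[diag_mx _ *m P *m _]mulmxA PP mulmx1 mulmx_diag; congr (diag_mx _ *m _).
  by apply/rowP => l; rewrite !mxE.
have /matrixP/(_ i j) := main; rewrite mxE => /(congr1 (@complex.Re R)) /= ->.
rewrite mxE Re_sum; apply: eq_bigr => l _.
rewrite mul_mx_diag -normP mxE; set u := (P^t*) i l.
by rewrite [X in _ * X * _]mxE mulrAC mulCr.
Qed.

End RealSpectral.

(** * Expectation of bounded random variables *)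

Section Expectation.
Local Open Scope classical_set_scope.
Context (R : realType) (d : measure_display) (Omega : measurableType d).
Variable P : probability Omega R.
Implicit Types (f g : Omega -> R) (G : set Omega).

Import HBNNSimple.

(* Comparing simple functions below [F] and [H] avoids measurability hypotheses. *)
Lemma ge0_integral_le_on (F H : Omega -> \bar R) G : measurable G -> P G = 1%E ->
  (forall w, 0 <= F w)%E -> (forall w, 0 <= H w)%E -> (forall w, G w -> F w <= H w)%E ->
  (\int[P]_w F w <= \int[P]_w H w)%E.
Proof.
move=> mG PG F0 H0 FH; rewrite !ge0_integralTE //.
apply: ge_ereal_sup => _ [h hF <-].
have PGC : P (~` G) = 0%E.
  by rewrite probability_setC // PG subee.
have -> : sintegral P h = sintegral P (proj_nnsfun h mG).
  rewrite -!integralT_nnsfun; apply: ge0_ae_eq_integral => //.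
  - exact/measurable_EFinP.
  - exact/measurable_EFinP.
  - by move=> x _; rewrite lee_fin.
  - by move=> x _; rewrite lee_fin.
  exists (~` G); split=> //; first exact: measurableC.
  move=> w /= nw Gw; apply: nw => _.
  by rewrite -[mindic R mG w]/(\1_G w) indicE mem_set // mulr1.
apply: ereal_sup_ubound; exists (proj_nnsfun h mG) => //= w.
rewrite -[mindic R mG w]/(\1_G w) indicE; have [wG|wG] := boolP (w \in G).
  by rewrite mulr1; apply: le_trans (hF w) (FH _ _); rewrite inE in wG.
by rewrite mulr0.
Qed.

(** No measurability is asked of [f] and [g]: off the almost sure event nothing is known about the
    chosen square root of the weight matrix. *)
Lemma integral_eq_on f g G : measurable G -> P G = 1%E ->
  (forall w, G w -> f w = g w) -> (\int[P]_w (f w)%:E = \int[P]_w (g w)%:E)%E.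
Proof.
move=> mG PG fg; rewrite integralE [RHS]integralE; congr (_ - _)%E; apply/eqP;
  rewrite eq_le; apply/andP; split; apply: (ge0_integral_le_on mG PG) => //= w Gw;
  by rewrite ?funeposE ?funenegE fg.
Qed.

Definition bounded_rv f := measurable_fun setT f /\ exists M, forall w, `|f w| <= M.

Lemma bounded_rv_integrable f : bounded_rv f -> P.-integrable setT (EFin \o f).
Proof.
move=> [mf [M fM]]; apply: measurable_bounded_integrable => //.
  by apply: le_lt_trans (probability_le1 P measurableT) (ltry _).
exists M; split; first exact: num_real.
by move=> x Mx w _ /=; apply: le_trans (fM w) (ltW Mx).
Qed.

Lemma bounded_rv_cst c : bounded_rv (fun=> c).
Proof. by split; [exact: measurable_cst|exists `|c|]. Qed.

Lemma bounded_rvD f g : bounded_rv f -> bounded_rv g -> bounded_rv (fun w => f w + g w).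
Proof.
move=> [mf [M fM]] [mg [M' gM]]; split; first exact: measurable_funD.
by exists (M + M') => w; apply: le_trans (ler_normD _ _) _; apply: lerD.
Qed.

Lemma bounded_rvM f g : bounded_rv f -> bounded_rv g -> bounded_rv (fun w => f w * g w).
Proof.
move=> [mf [M fM]] [mg [M' gM]]; split; first exact: measurable_funM.
by exists (M * M') => w; rewrite normrM; apply: ler_pM.
Qed.

Lemma bounded_rvZ c f : bounded_rv f -> bounded_rv (fun w => c * f w).
Proof. by move=> bf; apply: bounded_rvM => //; exact: bounded_rv_cst. Qed.

Lemma bounded_rv_sum (I : Type) (r : seq I) (Q : pred I) (f : I -> Omega -> R) :
  (forall i, Q i -> bounded_rv (f i)) -> bounded_rv (fun w => \sum_(i <- r | Q i) f i w).
Proof.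
move=> bf; elim: r => [|i r IH].
  suff -> : (fun w => \sum_(i <- [::] | Q i) f i w) = (fun=> 0) by exact: bounded_rv_cst.
  by apply/funext => w; rewrite big_nil.
suff -> : (fun w => \sum_(j <- i :: r | Q j) f j w) =
    fun w => (if Q i then f i w else 0) + \sum_(j <- r | Q j) f j w.
  apply: bounded_rvD => //; case Qi: (Q i); last exact: bounded_rv_cst.
  exact: bf.
by apply/funext => w; rewrite big_cons; case: ifP => // _; rewrite add0r.
Qed.

Lemma bounded_rv_prod (I : Type) (r : seq I) (Q : pred I) (f : I -> Omega -> R) :
  (forall i, Q i -> bounded_rv (f i)) -> bounded_rv (fun w => \prod_(i <- r | Q i) f i w).
Proof.
move=> bf; elim: r => [|i r IH].
  suff -> : (fun w => \prod_(i <- [::] | Q i) f i w) = (fun=> 1) by exact: bounded_rv_cst.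
  by apply/funext => w; rewrite big_nil.
suff -> : (fun w => \prod_(j <- i :: r | Q j) f j w) =
    fun w => (if Q i then f i w else 1) * \prod_(j <- r | Q j) f j w.
  apply: bounded_rvM => //; case Qi: (Q i); last exact: bounded_rv_cst.
  exact: bf.
by apply/funext => w; rewrite big_cons; case: ifP => // _; rewrite mul1r.
Qed.

Lemma bounded_rv_indic G : measurable G -> bounded_rv (\1_G : Omega -> R).
Proof.
move=> mG; split; first exact: measurable_indic.
by exists 1 => w; rewrite indicE; case: (_ \in _); rewrite ?normr1 ?normr0.
Qed.

Definition mean f : R := fine 'E_P[f].

Lemma meanE f : mean f = \int[P]_w f w.
Proof. by rewrite /mean unlock. Qed.

Lemma mean_eq_on f g G : measurable G -> P G = 1%E ->
  (forall w, G w -> f w = g w) -> mean f = mean g.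
Proof. by move=> mG PG fg; rewrite /mean unlock (integral_eq_on mG PG fg). Qed.

Lemma mean_cst c : mean (fun=> c) = c.
Proof. by rewrite /mean (expectation_cst P c). Qed.

Lemma meanD f g : bounded_rv f -> bounded_rv g ->
  mean (fun w => f w + g w) = mean f + mean g.
Proof. by move=> bf bg; rewrite !meanE RintegralD //; exact: bounded_rv_integrable. Qed.

Lemma meanZ c f : bounded_rv f -> mean (fun w => c * f w) = c * mean f.
Proof. by move=> bf; rewrite !meanE RintegralZl //; exact: bounded_rv_integrable. Qed.

Lemma mean_sum (I : Type) (r : seq I) (Q : pred I) (f : I -> Omega -> R) :
  (forall i, Q i -> bounded_rv (f i)) ->
  mean (fun w => \sum_(i <- r | Q i) f i w) = \sum_(i <- r | Q i) mean (f i).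
Proof.
move=> bf; elim: r => [|i r IH].
  rewrite big_nil -[RHS](mean_cst 0); congr mean.
  by apply/funext => w; rewrite big_nil.
rewrite big_cons; case: ifP => Qi; last first.
  by rewrite -IH; congr mean; apply/funext => w; rewrite big_cons Qi.
rewrite -IH -meanD; [|exact: bf|exact: bounded_rv_sum].
by congr mean; apply/funext => w; rewrite big_cons Qi.
Qed.

Lemma mean_indic G : measurable G -> mean (\1_G : Omega -> R) = fine (P G).
Proof. by move=> mG; rewrite /mean expectation_indic. Qed.

Lemma mean_dist f g c : bounded_rv f -> bounded_rv g ->
  (forall w, `|f w - g w| <= c) -> `|mean f - mean g| <= c.
Proof.
move=> bf bg fg.
have -> : mean f - mean g = mean (fun w => f w + (-1) * g w).
  by rewrite meanD ?meanZ ?mulN1r //; exact: bounded_rvZ.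
have bfg : bounded_rv (fun w => f w + (-1) * g w) by apply: bounded_rvD => //; exact: bounded_rvZ.
have bc x : bounded_rv (fun=> x) := bounded_rv_cst x.
rewrite ler_norml -[- c]mean_cst -[X in _ <= _ <= X]mean_cst !meanE.
apply/andP; split; apply: le_Rintegral => //; try exact: bounded_rv_integrable.
  by move=> w _; have := fg w; rewrite mulN1r ler_norml => /andP[].
by move=> w _; have := fg w; rewrite mulN1r ler_norml => /andP[].
Qed.

End Expectation.

Import mathcomp.boot.fintype mathcomp.boot.finset.

(** * Planar matchings *)

Lemma split_last (T : Type) (P : pred T) (c : seq T) : has P c ->
  exists p a q, [/\ c = p ++ a :: q, P a & ~~ has P q].
Proof.
elim: c => //= x c IH; have [/IH[p [a [q [-> Pa Pq]]]] _|Pc] := boolP (has P c).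
  by exists (x :: p), a, q.
by rewrite orbF => Px; exists [::], x, c.
Qed.

Section PlanarMatchings.
Variable n : nat.
Implicit Types (s p q : 'S_n) (X : {set 'I_n}).

(** A matching of [X] is encoded as a permutation of all of ['I_n], the identity off [X], so that
    gluing is multiplication in ['S_n]. *)
Definition matching_on X (p : 'S_n) :=
  [forall i, p (p i) == i] && ([set i | p i != i]%SET == X).

Lemma matching_onP X p : reflect ((forall i, p (p i) = i) /\ (forall i, (p i != i) = (i \in X)))
  (matching_on X p).
Proof.
apply: (iffP andP) => [[/forallP pp /eqP <-]|[pp pX]].
  by split=> i; [exact/eqP|rewrite inE].
by split; [apply/forallP => i; rewrite pp|apply/eqP/setP => i; rewrite inE pX].
Qed.

Lemma matching_on_tperm X q a b : a \in X -> b \in X -> b != a ->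
  matching_on X (tperm a b * q)%g && ((tperm a b * q)%g a == b) =
  matching_on (X :\ a :\ b) q.
Proof.
move=> aX bX ne; rewrite permM tpermL; apply/andP/matching_onP.
  move=> [/matching_onP[pp pX] /eqP qb].
  have qa : q a = a by move: (pp a); rewrite !permM tpermL qb tpermR.
  have q_na i : i != a -> q i != a by rewrite -{2}qa (inj_eq perm_inj).
  have q_nb i : i != b -> q i != b by rewrite -{2}qb (inj_eq perm_inj).
  have q_t i : i != a -> i != b -> (tperm a b * q)%g i = q i.
    by move=> ia ib; rewrite permM tpermD // eq_sym.
  split=> i; rewrite ?inE; have [->|ib] := eqVneq i b; rewrite ?qb ?eqxx //=;
    have [->|ia] := eqVneq i a; rewrite ?qa ?eqxx //=; last by rewrite -q_t.
  by rewrite -[RHS](pp i) [in RHS](q_t i) // q_t // ?q_na ?q_nb.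
move=> [qq qX].
have qb : q b = b by apply/eqP; rewrite -[_ == _]negbK qX !inE eqxx.
have qa : q a = a by apply/eqP; rewrite -[_ == _]negbK qX !inE eqxx /= andbF.
split; last by rewrite qb.
apply/matching_onP; split=> i; rewrite !permM.
  have [->|ia] := eqVneq i a; first by rewrite tpermL qb tpermR.
  have [->|ib] := eqVneq i b; first by rewrite tpermR qa tpermL.
  have q_na : q i != a by rewrite -[X in _ != X]qa (inj_eq perm_inj).
  have q_nb : q i != b by rewrite -[X in _ != X]qb (inj_eq perm_inj).
  by rewrite (tpermD (z := i)) 1?eq_sym // tpermD ?qq // eq_sym.
have [->|ia] := eqVneq i a; first by rewrite tpermL qb ne.
have [->|ib] := eqVneq i b; first by rewrite tpermR qa eq_sym ne.
by rewrite tpermD ?qX ?inE ?ib ?ia // eq_sym.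
Qed.

Lemma matching_on_image X p a : matching_on X p -> a \in X ->
  (p a \in X) && (p a != a).
Proof. by move=> /matching_onP[pp pX] aX; rewrite -!pX pp eq_sym pX aX. Qed.

Lemma matching_on0 p : matching_on set0 p = (p == 1%g).
Proof.
apply/matching_onP/eqP => [[_ p0]|->]; last first.
  by split=> i; rewrite !perm1 ?inE ?eqxx.
by apply/permP => i; rewrite perm1; apply/eqP; rewrite -[_ == _]negbK p0 inE.
Qed.

(* Genus zero: each of the [#|X| / 2] transpositions of [p] adds a cycle. *)
Definition planar s X (p : 'S_n) := #|porbits (p * s)|.*2 == (#|porbits s|.*2 + #|X|)%N.

Lemma matching_tpermC X q a b : matching_on (X :\ a :\ b) q ->
  (tperm a b * q = q * tperm a b)%g.
Proof.
move=> /matching_onP[qq qX].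
have qb : q b = b by apply/eqP; rewrite -[_ == _]negbK qX !inE eqxx.
have qa : q a = a by apply/eqP; rewrite -[_ == _]negbK qX !inE eqxx /= andbF.
by rewrite [LHS]conjgC tpermJ qa qb.
Qed.

Lemma card_setD2 X a b : a \in X -> b \in X -> b != a ->
  #|X| = #|X :\ a :\ b|.+2.
Proof. by move=> aX bX ba; rewrite (cardsD1 a X) aX (cardsD1 b) !inE ba bX. Qed.

Lemma porbits_tperm s a b : b != a ->
  (#|porbits (tperm a b * s)| + (b \notin porbit s a).*2 = #|porbits s|.+1)%N.
Proof.
by move=> ba; have := porbits_mul_tperm s a b; rewrite eq_sym ba addn1 porbit_sym.
Qed.

(** Nonnegativity of the genus: each of the #|X| / 2 transpositions of [p] changes the number of
    cycles by exactly one. *)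
Lemma porbits_matching_leq s X p : matching_on X p ->
  (#|porbits (p * s)|.*2 <= #|porbits s|.*2 + #|X|)%N.
Proof.
have [m] := ubnP #|X|; elim: m => // m IHm in s X p *; rewrite ltnS => leX pM.
have [X0|[a aX]] := set_0Vmem X.
  by move: pM; rewrite X0 matching_on0 => /eqP ->; rewrite mul1g cards0 addn0.
have /andP[bX ba] := matching_on_image pM aX; set b := p a in bX ba.
pose q := (tperm a b * p)%g.
have def_p : p = (tperm a b * q)%g by rewrite tpermKg.
have qM : matching_on (X :\ a :\ b) q.
  by rewrite -matching_on_tperm // -def_p pM eqxx.
have cX := card_setD2 aX bX ba.
rewrite def_p (matching_tpermC qM) -mulgA.
apply: leq_trans (IHm _ _ _ _ qM) _; first by rewrite -ltnS -ltnS -cX ltnW.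
have := porbits_tperm s ba; rewrite cX.
move: #|X :\ a :\ b| #|porbits s| #|porbits (tperm a b * s)%g| => x u v.
by case: (b \in _) => /=; lia.
Qed.

(** Equality in [porbits_matching_leq] forces every transposition to add a cycle, and [tperm a b]
    adds one to [s] exactly when [a] and [b] lie on the same cycle of [s]. *)
Lemma planar_tperm s X q a b : a \in X -> b \in X -> b != a ->
  matching_on (X :\ a :\ b) q ->
  planar s X (tperm a b * q)%g =
  (b \in porbit s a) && planar (tperm a b * s)%g (X :\ a :\ b) q.
Proof.
move=> aX bX ba qM; have := porbits_matching_leq (tperm a b * s)%g qM.
rewrite /planar (matching_tpermC qM) -mulgA (card_setD2 aX bX ba).
have := porbits_tperm s ba.
move: #|X :\ a :\ b| #|porbits (q * _)%g| #|porbits s| #|porbits _| => x w u v.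
by case: (b \in _) => /=; lia.
Qed.

Variables (C : comNzRingType) (K : 'I_n -> 'I_n -> C).
Hypothesis K_sym : forall a b, K a b = K b a.

Definition pair_weight (p : 'S_n) : C := \prod_(i < n | (i < p i)%N) K i (p i).

Lemma pair_weight_tperm X q a b : b != a -> matching_on (X :\ a :\ b) q ->
  pair_weight (tperm a b * q)%g = K b a * pair_weight q.
Proof.
move=> ba qM; have /matching_onP[qq qX] := qM.
have qb : q b = b by apply/eqP; rewrite -[_ == _]negbK qX !inE eqxx.
have qa : q a = a by apply/eqP; rewrite -[_ == _]negbK qX !inE eqxx /= andbF.
wlog lt_ab : a b ba qM qb qa qX / (a < b)%N.
  move=> wl; have [|lt_ba|/val_inj] := ltngtP a b; first exact: wl; last first.
    by move=> ab; rewrite ab eqxx in ba.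
  by rewrite tpermC K_sym; apply: (wl b a) => //; rewrite 1?eq_sym // setDDl setUC -setDDl.
rewrite /pair_weight (bigD1 a) /=; last by rewrite permM tpermL qb.
rewrite permM tpermL qb K_sym; congr (_ * _).
apply: eq_big => [i|i /andP[lti ia]].
  rewrite permM; have [->|ia] := eqVneq i a; first by rewrite qa ltnn andbF.
  have [->|ib] := eqVneq i b; first by rewrite tpermR qa qb ltnn ltnNge ltnW.
  by rewrite tpermD ?andbT // eq_sym.
have ib : i != b.
  by apply: contraTneq lti => ->; rewrite permM tpermR qa -leqNgt ltnW.
by rewrite permM tpermD // eq_sym.
Qed.

Definition planar_sum s X : C :=
  \sum_(p | matching_on X p && planar s X p) pair_weight p.

Lemma planar_sum0 s : planar_sum s set0 = 1.
Proof.
rewrite /planar_sum (eq_bigl (pred1 (1%g : 'S_n))) => [|p].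
  by rewrite big_pred1_eq /pair_weight big1 // => i; rewrite perm1 ltnn.
rewrite matching_on0 /=; apply: andb_idr => /eqP ->.
by rewrite /planar mul1g cards0 addn0.
Qed.

Lemma planar_sum_rec s X a : a \in X ->
  planar_sum s X = \sum_(b in X | (b != a) && (b \in porbit s a))
     K b a * planar_sum (tperm a b * s)%g (X :\ a :\ b).
Proof.
move=> aX; rewrite /planar_sum.
rewrite (partition_big (fun p : 'S_n => p a) (fun b => (b \in X) && (b != a))) /=; last first.
  by move=> p /andP[pM _]; exact: matching_on_image.
rewrite [RHS]big_mkcond [LHS]big_mkcond; apply: eq_bigr => b _.
rewrite andbA; case: ifP => //= /andP[bX ba].
rewrite (reindex_inj (mulgI (tperm a b))) /=.
rewrite (eq_bigl (fun q => matching_on (X :\ a :\ b) q && ((b \in porbit s a) &&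
  planar (tperm a b * s)%g (X :\ a :\ b) q))); last first.
  move=> q; rewrite -andbA [planar _ _ _ && _]andbC andbA matching_on_tperm //.
  by apply: andb_id2l => qM; apply: planar_tperm.
case: (b \in porbit s a) => /=; last by rewrite big_pred0 // => q; rewrite andbF.
rewrite mulr_sumr; apply: eq_bigr => q /andP[qM _].
exact: pair_weight_tperm qM.
Qed.

Lemma mem_porbit_fcycle s c a b : fcycle s c -> a \in c ->
  (b \in porbit s a) = (b \in c).
Proof.
move=> sc ac; rewrite -(fconnect_cycle sc ac).
apply/porbitP/idP => [[i ->]|/iter_findex <-]; first by rewrite permX fconnect_iter.
by exists (findex s a b); rewrite permX.
Qed.

Lemma fpath_reroot s t x y (l : seq 'I_n) : fpath s x (rcons l y) -> t y = s x ->
  {in l, forall z, t z = s z} -> fcycle t (y :: l).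
Proof.
rewrite /= => + tx; case: l => [|h l] /=; first by rewrite tx.
rewrite tx => /andP[-> /= +] ts; elim: l h ts => [|h' l IH] h ts /=.
  by rewrite ts // mem_head.
rewrite ts ?mem_head // => /andP[-> /=]; apply: IH => z zl.
by apply: ts; rewrite inE zl orbT.
Qed.

(** The transposition exchanges the successors of [a] and [b], which cuts the cycle in two: the
    stretch after [b] up to [a], and the rest. *)
Lemma fcycle_tperm s (p1 p2 q : seq 'I_n) a b : uniq (p1 ++ b :: p2 ++ a :: q) ->
  fcycle s (p1 ++ b :: p2 ++ a :: q) ->
  fcycle (tperm a b * s)%g (rcons p2 a) && fcycle (tperm a b * s)%g (p1 ++ b :: q).
Proof.
set c := p1 ++ _ => c_uniq sc; set t := (_ * s)%g.
have c_rot : (b :: p2 ++ a :: q) ++ p1 = b :: p2 ++ a :: q ++ p1.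
  by rewrite /= -catA.
move: c_uniq sc; rewrite /c uniq_catC cycle_catC c_rot.
move=> uq; have : uniq (b :: a :: p2 ++ q ++ p1).
  rewrite -(perm_uniq (s1 := b :: p2 ++ a :: q ++ p1)) //.
  by rewrite perm_cons perm_sym -cat1s perm_catCA.
rewrite /= inE negb_or => /and3P[/andP[ba b_n] a_n _].
have ts z : z \in p2 ++ q ++ p1 -> t z = s z.
  move=> zin; rewrite /t permM tpermD //; first by apply: contraNneq a_n => ->.
  by apply: contraNneq b_n => ->.
rewrite /= rcons_cat cat_path /= rcons_path => /and3P[sp2 e_a].
move=> sq; apply/andP; split.
  rewrite -cats1 cycle_catC.
  apply: (@fpath_reroot s t b); first by rewrite rcons_path sp2.
    by rewrite /t permM tpermL.
  by move=> z zp2; apply: ts; rewrite mem_cat zp2.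
rewrite cycle_catC /=.
apply: (@fpath_reroot s t a); first by rewrite rcons_path.
  by rewrite /t permM tpermR.
by move=> z zp; apply: ts; rewrite mem_cat zp orbT.
Qed.

Variable G : seq 'I_n -> C.
Hypothesis G_nil : G [::] = 1.
Hypothesis G_rcons : forall w a, G (rcons w a) =
  \sum_(i < size w) K (nth a w i) a * G (drop i.+1 w) * G (take i w).

(** Pairing the last point [a] of [X] on a cycle with [b] cuts that cycle; the points of [X] between
    [b] and [a], and those before [b], are the two words of [G_rcons]. The statement is about a list
    of cycles because the recursion creates new ones. *)
Lemma planar_sum_cycles s X ss : uniq (flatten ss) -> all (fcycle s) ss ->
  {subset X <= flatten ss} ->
  planar_sum s X = \prod_(c <- ss) G [seq i <- c | i \in X].
Proof.
have [m] := ubnP #|X|; elim: m => // m IHm in s X ss *; rewrite ltnS => leX.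
elim: ss => [|c ss IHs] /= uq sss Xss.
  rewrite big_nil; suff -> : X = set0 by rewrite planar_sum0.
  by apply/setP => i; rewrite inE; apply/negP => /Xss.
rewrite big_cons; move: uq; rewrite cat_uniq => /and3P[uqc disj uqss].
case/andP: sss => sc sss.
(* Taking the last point [a] of [X] on [c] makes the word of [c] end in [a], the form that [G_rcons]
   expects. A cycle that misses [X] contributes [G [::] = 1], which the inner induction on [ss]
   removes. *)
have [/split_last[p [a [q [def_c aX qX]]]]|nX] := boolP (has (mem X) c); last first.
  rewrite (eq_in_filter (a2 := pred0)) ?filter_pred0 ?G_nil ?mul1r; last first.
    by move=> i ic; apply/negP => iX; case/hasP: nX; exists i.
  apply: IHs => // i iX; have := Xss i iX; rewrite mem_cat => /orP[ic|//].
  by case/hasP: nX; exists i.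
have ac : a \in c by rewrite def_c mem_cat mem_head orbT.
have q0 : [seq i <- q | i \in X] = [::].
  by apply/eqP; rewrite -(negbK (_ == _)) -has_filter.
set w := [seq i <- p | i \in X].
have -> : [seq i <- c | i \in X] = rcons w a.
  by rewrite def_c filter_cat /= [a \in X]aX q0 cats1.
rewrite G_rcons mulr_suml (planar_sum_rec s aX).
have uqp : uniq p by move: uqc; rewrite def_c cat_uniq => /andP[].
have uqw : uniq w by rewrite filter_uniq.
rewrite (eq_bigl (mem w)) => [|b]; last first.
  rewrite /= mem_filter (mem_porbit_fcycle _ sc ac) def_c mem_cat inE.
  have [bX|//] := boolP (b \in X).
  have [->|ba] /= := eqVneq b a.
    by apply/esym/negbTE; move: uqc; rewrite def_c uniq_catC /= mem_cat negb_or => /andP[/andP[]].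
  suff /negbTE -> : b \notin q by rewrite orbF.
  by apply: contra qX => bq; apply/hasP; exists b.
rewrite -big_uniq //= (big_nth a) big_mkord; apply: eq_bigr => i _.
set b := nth a w i; have bw : b \in w by apply: mem_nth.
have := bw; rewrite mem_filter => /andP[bX bp].
have def_p : exists p1 p2 : seq 'I_n, p = p1 ++ b :: p2 by case/splitPr: bp => u v; exists u, v.
case: def_p => p1 [p2 def_p].
have def_w : w = [seq i <- p1 | i \in X] ++ b :: [seq i <- p2 | i \in X].
  by rewrite /w def_p filter_cat /= bX.
have iE : i = size [seq i <- p1 | i \in X] :> nat.
  rewrite -(index_uniq a (ltn_ord i) uqw) -/b def_w index_cat.
  have /negbTE -> : b \notin [seq i <- p1 | i \in X].
    move: uqw; rewrite def_w uniq_catC /= mem_cat negb_or.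
    by case/andP => /andP[].
  by rewrite /= eqxx addn0.
have -> : take i w = [seq i <- p1 | i \in X] by rewrite iE def_w take_size_cat.
have -> : drop i.+1 w = [seq i <- p2 | i \in X].
  by rewrite iE def_w -cat_rcons drop_size_cat // size_rcons.
rewrite -!mulrA; congr (_ * _).
have def_c' : c = p1 ++ b :: p2 ++ a :: q by rewrite def_c def_p -catA.
have ba : b != a.
  apply/eqP => ba; move: uqc; rewrite def_c' uniq_catC /= ba.
  by rewrite -catA mem_cat mem_head orbT.
have perm_c : perm_eq (rcons p2 a ++ p1 ++ b :: q) c.
  have -> : c = (p1 ++ [:: b]) ++ rcons p2 a ++ q by rewrite def_c' -catA cat_rcons.
  by rewrite perm_sym perm_catCA -catA.
have perm_ss : perm_eq (flatten [:: rcons p2 a, p1 ++ b :: q & ss]) (c ++ flatten ss).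
  by rewrite /= catA perm_cat2r.
set X' := X :\ a :\ b.
have filterX' (l : seq 'I_n) : a \notin l -> b \notin l ->
    [seq i <- l | i \in X'] = [seq i <- l | i \in X].
  move=> al bl; apply: eq_in_filter => z zl; rewrite !inE.
  by rewrite (memPn bl) // (memPn al).
have X'a : a \in X' = false by rewrite !inE eqxx andbF.
have X'b : b \in X' = false by rewrite !inE eqxx.
have := uqc; rewrite -(perm_uniq perm_c) => uq3.
have : uniq [:: a, b & p2 ++ p1 ++ q].
  rewrite -(perm_uniq (s1 := rcons p2 a ++ p1 ++ b :: q)) //.
  rewrite -cats1 -catA /= -[a :: _]cat1s perm_catCA /= perm_cons.
  by rewrite catA -[b :: q]cat1s perm_catCA /= catA.
rewrite /= inE negb_or !mem_cat !negb_or => /and3P[].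
move=> /andP[_ /and3P[a2 a1 aq]] /and3P[b2 b1 bq] _.
have s12 := fcycle_tperm (s := s); move: (s12 p1 p2 q a b).
rewrite -def_c' => /(_ uqc sc)/andP[sc1 sc2].
rewrite (IHm _ X' [:: rcons p2 a, p1 ++ b :: q & ss]); first last.
- move=> z zX'; rewrite (perm_mem perm_ss); apply: Xss.
  by move: zX'; rewrite !inE => /and3P[].
- rewrite /= sc1 sc2 /=; apply/allP => c' c'ss.
  have := allP sss _ c'ss; congr (is_true _).
  apply: (@eq_in_cycle _ (mem c')); last exact/allP.
  move=> y z yc' _ /=; rewrite permM tpermD //; apply: contraNneq disj => yE.
    by apply/hasP; exists y; rewrite -?yE //; apply/flattenP; exists c'; rewrite ?yE.
  apply/hasP; exists y; rewrite -?yE ?def_c' ?mem_cat ?mem_head ?orbT //.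
  by apply/flattenP; exists c'; rewrite ?yE.
- by rewrite (perm_uniq perm_ss) cat_uniq uqc disj.
- by rewrite -ltnS -ltnS -(card_setD2 aX bX ba) ltnS ltnW.
rewrite !big_cons !mulrA; congr (_ * _ * _).
- by rewrite -cats1 filter_cat /= X'a cats0 filterX'.
- by rewrite filter_cat /= X'b !filterX' // q0 cats0.
apply: eq_big_seq => c' c'ss; rewrite filterX' //.
  by apply: contra disj => ac'; apply/hasP; exists a => //; apply/flattenP; exists c'.
apply: contra disj => bc'; apply/hasP; exists b; last by rewrite def_c' mem_cat mem_head orbT.
by apply/flattenP; exists c'.
Qed.

End PlanarMatchings.

(** * Trees and maximal spanning trees *)

Lemma mem_pairmap (T1 : Type) (T2 : eqType) (f : T1 -> T1 -> T2) (i : T1) p e :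
  e \in pairmap f i p ->
  exists (p1 : seq T1) (z : T1) (p2 : seq T1),
    p = p1 ++ z :: p2 /\ e = f (last i p1) z.
Proof.
elim: p i => //= z p IH i; rewrite inE => /orP[/eqP ->|/IH].
  by exists [::], z, p.
by move=> [p1 [b [p2 [-> ->]]]]; exists (z :: p1), b, p2.
Qed.

Section Graphs.
Variable k : nat.
Implicit Types (E : {set {set 'I_k}}) (a b i j x y : 'I_k).

Lemma adj_sym E : symmetric (adj E).
Proof. by move=> i j; rewrite /adj setUC. Qed.

Lemma connect_adj_sym E : connect_sym (adj E).
Proof. by apply: sym_connect_sym; exact: adj_sym. Qed.

Lemma connect_adjS E E' i j : E \subset E' ->
  connect (adj E) i j -> connect (adj E') i j.
Proof. by move=> sEE'; apply: connect_sub => x y xy; by apply: connect1; rewrite /adj (subsetP sEE'). Qed.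

Definition connected E := forall i j, connect (adj E) i j.

(** A breadth-first tree: every vertex [v] other than the root [r] is linked to a neighbour [par v]
    closer to [r]. Two vertices sharing this edge would be each other's parents, each closer to [r]
    than the other. *)
Lemma connected_spanning E : connected E -> (0 < k)%N ->
  exists F : {set {set 'I_k}},
    [/\ F \subset E, connected F, #|F|.+1 = k & {in F, forall e : {set 'I_k}, #|e| = 2%N}].
Proof.
move=> E_conn k_gt0; pose r := Ordinal k_gt0.
have ex_d v : exists m, [exists p : m.-tuple 'I_k, path (adj E) r p && (last r p == v)].
  have /connectP[p p_path ->] := E_conn r v.
  by exists (size p); apply/existsP; exists (in_tuple p); rewrite p_path eqxx.
pose d v := ex_minn (ex_d v).
have d_step v : v != r -> exists u, adj E u v && (d u < d v)%N.
  move=> vr; rewrite {2}/d; case: ex_minnP => m /existsP[p /andP[p_path /eqP p_last]] _.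
  case: m p p_path p_last => [|m] p; first by rewrite (tuple0 p) /= => _ rv; rewrite rv eqxx in vr.
  case/lastP: {p}(val p) (size_tuple p) => [//|p v'].
  rewrite size_rcons rcons_path last_rcons => - [sz] /andP[pp adj_v] <-.
  exists (last r p); rewrite adj_v ltnS /d; case: ex_minnP => m' _; apply.
  by apply/existsP; exists (tcast sz (in_tuple p)); rewrite val_tcast /= pp eqxx.
pose par v := odflt r [pick u | adj E u v && (d u < d v)%N].
have parP v : v != r -> adj E (par v) v /\ (d (par v) < d v)%N.
  move=> /d_step[u uP]; rewrite /par; case: pickP => [u' /andP[]//|/(_ u)].
  by rewrite uP.
pose f v := [set par v; v].
have f_inj : {in [set~ r] &, injective f}.
  move=> v v'; rewrite !inE => vr v'r fE; apply/eqP/negPn/negP => ne.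
  have [[_ d1] [_ d2]] := (parP v vr, parP v' v'r).
  have : v \in f v' by rewrite -fE !inE eqxx orbT.
  have : v' \in f v by rewrite fE !inE eqxx orbT.
  rewrite !inE [v' == v]eq_sym (negbTE ne) !orbF => /eqP v'E /eqP vE.
  by move: d1 d2; rewrite -v'E -vE => d1 d2; have := ltn_trans d1 d2; rewrite ltnn.
exists (f @: [set~ r]); split.
- by apply/subsetP => e /imsetP[v]; rewrite !inE => /parP[Ev _] ->.
- have to_r v : connect (adj (f @: [set~ r])) r v.
    have [m] := ubnP (d v); elim: m v => // m IHm v; rewrite ltnS => le_d.
    have [->//|vr] := eqVneq v r; have [_ lt_d] := parP v vr.
    apply: connect_trans (IHm (par v) (leq_trans lt_d le_d)) (connect1 _).
    by apply/imsetP; exists v; rewrite ?inE.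
  by move=> i j; apply: connect_trans (to_r j); rewrite connect_adj_sym.
- by rewrite card_in_imset // cardsC1 card_ord prednK.
- move=> e /imsetP[v]; rewrite !inE => vr ->; rewrite cards2.
  have [_] := parP v vr; have [->|//] := eqVneq (par v) v; by rewrite ltnn.
Qed.

Lemma connected_card E : connected E -> (k <= #|E|.+1)%N.
Proof.
have [k0|k0] := posnP k; first by move=> _; apply: leq_trans (leq0n _); rewrite k0.
move=> /connected_spanning /(_ k0) [F [FE _ cF _]].
by rewrite -[leqLHS]cF ltnS subset_leq_card.
Qed.

Lemma connected_setD1 E e : connected E -> (forall x y, e = [set x; y] ->
  connect (adj (E :\ e)) x y) -> connected (E :\ e).
Proof.
move=> E_conn e_conn i j; move: (E_conn i j); apply: connect_sub => x y xy.
have [xyE|ne] := eqVneq [set x; y] e; first exact: e_conn.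
by apply: connect1; rewrite /adj !inE ne.
Qed.

Lemma connect_ends E a b x y : [set a; b] = [set x; y] ->
  connect (adj E) a b -> connect (adj E) x y.
Proof.
move=> abE; have : x \in [set a; b] by rewrite abE !inE eqxx.
have : y \in [set a; b] by rewrite abE !inE eqxx orbT.
rewrite !inE => /orP[]/eqP-> /orP[]/eqP->; rewrite // ?connect0 //.
by rewrite connect_adj_sym.
Qed.

Lemma is_treeP E : reflect
  [/\ {in E, forall e : {set 'I_k}, #|e| = 2%N}, connected E & #|E|.+1 = k] (is_tree E).
Proof.
apply: (iffP and3P) => -[E2 Ec Ek]; split; try exact/eqP.
- by move=> e eE; apply/eqP; move/forall_inP: E2; apply.
- by move=> i j; move/forallP: Ec => /(_ i)/forallP/(_ j).
- by apply/forall_inP => e /E2 ->.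
- by apply/forallP => i; apply/forallP => j; exact: Ec.
Qed.

Lemma tree_bridge E a b : is_tree E -> [set a; b] \in E ->
  ~~ connect (adj (E :\ [set a; b])) a b.
Proof.
move=> /is_treeP[_ E_conn E_card] abE; apply/negP => ab.
have := connected_card (connected_setD1 E_conn (fun x y e => connect_ends e ab)).
by rewrite -[leqLHS]E_card (cardsD1 [set a; b]) abE ltnn.
Qed.

Lemma tree_pathP E i j : connect (adj E) i j ->
  [/\ path (adj E) i (tree_path E i j), uniq (i :: tree_path E i j)
    & last i (tree_path E i j) = j].
Proof.
move=> /connectP[p0 pp0 ->]; case/shortenP: pp0 => p pp up _; rewrite /tree_path.
by case: xgetP => [_ _ []//|/(_ p)[]].
Qed.

Lemma path_avoids E (P : pred 'I_k) e i p : (forall x y, P x -> P y -> [set x; y] != e) ->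
  all P (i :: p) -> path (adj E) i p -> connect (adj (E :\ e)) i (last i p).
Proof.
move=> Pe Pp pp; apply/connectP; exists p => //.
apply: sub_in_path Pp pp => x y Px Py; rewrite /adj !inE => ->.
by rewrite Pe.
Qed.

(** Before the edge {a, b} the path avoids [b] and after it the path avoids [a], so both stretches
    survive the removal; a connection from [i] to [j] would then bypass the bridge. *)
Lemma tree_path_edge E i j e : is_tree E -> e \in path_edges E i j ->
  ~~ connect (adj (E :\ e)) i j.
Proof.
move=> E_tree; have /is_treeP[_ E_conn _] := E_tree.
have [] := tree_pathP (E_conn i j); rewrite /path_edges.
move: (tree_path E i j) => p pp up pl e_p.
have [p1 [b [p2 [def_p ->]]]] := mem_pairmap e_p.
set a := last i p1; set e' := [set a; b].
move: up; rewrite def_p -cat_cons cat_uniq => /and3P[_ disj /andP[b_p2 _]].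
move: disj => /norP[b_p1 /hasPn p2_p1].
move: pp pl; rewrite def_p cat_path /= => /and3P[pp1 ab pp2].
rewrite last_cat /= => pl; apply/negP => ij.
have ia : connect (adj (E :\ e')) i a.
  apply: (@path_avoids _ (fun x => x != b)) pp1 => [x y xb yb|]; last first.
    by apply/allP => x xp; apply: contraNneq b_p1 => <-.
  apply/eqP => /setP/(_ b); rewrite !inE eqxx orbT.
  by rewrite ![b == _]eq_sym (negbTE xb) (negbTE yb).
have bj : connect (adj (E :\ e')) b j.
  rewrite -pl; apply: (@path_avoids _ (fun x => x != a)) pp2 => [x y xa ya|].
    apply/eqP => /setP/(_ a); rewrite !inE eqxx.
    by rewrite ![a == _]eq_sym (negbTE xa) (negbTE ya).
  apply/allP => x xp; apply/eqP => xa.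
  have a_p1 : a \in i :: p1 by apply: mem_last.
  move: xp; rewrite xa inE => /orP[/eqP ba|/p2_p1].
    by move: b_p1; rewrite -ba a_p1.
  by rewrite a_p1.
have := tree_bridge E_tree ab; rewrite -/e' => /negP; apply.
rewrite connect_adj_sym in bj; rewrite connect_adj_sym in ia.
exact: connect_trans ia (connect_trans ij bj).
Qed.

End Graphs.

Section WeightThreshold.
Variables (R : realType) (k : nat).
Implicit Types (E : {set {set 'I_k}}) (x : {set 'I_k} -> R) (t : R).

Lemma le_bigmin_head (T : eqType) (x0 : T) (es : seq T) (x : T -> R) t : es != [::] ->
  (t <= \big[Num.min/x (head x0 es)]_(e <- es) x e) = all (fun e => t <= x e) es.
Proof.
case: es => //= e0 es _; rewrite big_cons le_min.
apply/andP/andP => -[te h]; split=> //.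
  elim: es h => //= e es IH; rewrite big_cons le_min => /andP[-> /=]; exact: IH.
elim: es h => [|e es IH] /=; first by rewrite big_nil.
by rewrite big_cons le_min => /andP[-> /=]; exact: IH.
Qed.

(** Each edge of the tree path separates [i] from [j], so the edges at or above the level [t]
    connect them iff the whole path is at or above [t]. In this threshold form the minimum meets
    Kruskal's criterion. *)
Lemma le_wt_neq E x t i j : is_tree E -> i != j ->
  (t <= wt E x i j) = connect (adj [set e in E | t <= x e]%SET) i j.
Proof.
move=> E_tree ij; have /is_treeP[_ E_conn _] := E_tree; rewrite mxE (negbTE ij).
rewrite le_bigmin_head; last first.
  rewrite /path_edges; have [_ _] := tree_pathP (E_conn i j).
  by case: (tree_path E i j) => //= e; rewrite e eqxx in ij.
apply/allP/idP => [all_t|conn e e_path].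
  have [pp _ pl] := tree_pathP (E_conn i j).
  apply/connectP; exists (tree_path E i j) => //.
  move: all_t pp; rewrite /path_edges; move: (tree_path E i j) => p {ij pl}.
  elim: p i => //= v p IH i all_t.
  move=> /andP[iv pp]; rewrite {1}/adj inE all_t ?mem_head //= -/(adj E i v) iv /=.
  by apply: IH => // e ep; apply: all_t; rewrite inE ep orbT.
rewrite leNgt; apply/negP => lt_e.
have /negP := tree_path_edge E_tree e_path; apply.
apply: connect_adjS conn; apply/subsetP => e'; rewrite !inE => /andP[-> te'].
by rewrite andbT; apply: contraTneq te' => ->; rewrite -ltNge.
Qed.

Lemma wt_diag E x i : wt E x i i = 1. Proof. by rewrite mxE eqxx. Qed.

Lemma le_wt E x t i j : is_tree E -> t <= 1 ->
  (t <= wt E x i j) = connect (adj [set e in E | t <= x e]%SET) i j.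
Proof.
move=> E_tree t1; have [->|ij] := eqVneq i j; last exact: le_wt_neq.
by rewrite connect0 wt_diag t1.
Qed.

Lemma wt_sym E x i j : is_tree E -> wt E x i j = wt E x j i.
Proof.
move=> E_tree; have [->//|ij] := eqVneq i j.
have le u v : u != v -> wt E x u v <= wt E x v u.
  by move=> uv; rewrite le_wt_neq 1?eq_sym // connect_adj_sym -le_wt_neq.
by apply/eqP; rewrite eq_le !le // eq_sym.
Qed.

Lemma wt_itv E x i j : is_tree E -> (forall e, e \in E -> 0 < x e < 1) ->
  0 <= wt E x i j <= 1.
Proof.
move=> E_tree x01; have /is_treeP[_ E_conn _] := E_tree; apply/andP; split.
  rewrite le_wt //; suff -> : [set e in E | 0 <= x e]%SET = E by exact: E_conn.
  by apply/setP => e; rewrite inE; apply/andb_idr => /x01/andP[/ltW].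
have [->|ij] := eqVneq i j; first by rewrite wt_diag.
rewrite leNgt; apply/negP => lt1.
have := lexx (wt E x i j); rewrite le_wt_neq // => /connectP[[|v p] /=].
  by move=> _ ji; rewrite ji eqxx in ij.
rewrite {1}/adj inE -andbA => /and3P[/x01/andP[_ x1] le_x] _ _.
by have := lt_trans (lt_le_trans lt1 le_x) x1; rewrite ltxx.
Qed.
End WeightThreshold.

(** * Kruskal's algorithm on a multigraph *)

Section Kruskal.
(** A multigraph on ['I_k] with edges indexed by ['I_n]; loops and parallel edges are allowed, and
    [ed] forgets multiplicities. It will be the graph of the transpositions of [iota]. *)
Variables (n k : nat) (ed : 'I_n -> {set 'I_k}) (s t : 'I_n -> 'I_k).
Hypothesis edE : forall f, ed f = [set s f; t f].
Hypothesis k_gt0 : (0 < k)%N.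
Implicit Types (S F D : {set 'I_n}) (f g : 'I_n).

Lemma connect_edges S (E' : {set {set 'I_k}}) i j :
  (forall f, f \in S -> connect (adj E') (s f) (t f)) ->
  connect (adj (ed @: S)) i j -> connect (adj E') i j.
Proof.
move=> SE'; apply: connect_sub => x y /imsetP[f fS]; rewrite edE => /esym.
by move/connect_ends; apply; apply: SE'.
Qed.

Lemma connect_edge S f : f \in S -> connect (adj (ed @: S)) (s f) (t f).
Proof. by move=> fS; apply: connect1; rewrite /adj -edE imset_f. Qed.

Lemma connect_edgesS S S' i j : S \subset S' ->
  connect (adj (ed @: S)) i j -> connect (adj (ed @: S')) i j.
Proof. by move=> SS'; apply: connect_adjS; exact: imsetS. Qed.

Lemma connect_edgesD1 S f i j : connect (adj (ed @: S)) i j ->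
  [\/ connect (adj (ed @: (S :\ f))) i j,
      connect (adj (ed @: (S :\ f))) i (s f) /\ connect (adj (ed @: (S :\ f))) (t f) j |
      connect (adj (ed @: (S :\ f))) i (t f) /\ connect (adj (ed @: (S :\ f))) (s f) j].
Proof.
move=> /connectP[p pp ->]; elim: p i pp => [|v p IH] i /=; first by constructor 1.
move=> /andP[/imsetP[g gS iv] /IH{}IH].
have [gf|gf] := eqVneq g f; last first.
  have iv' : connect (adj (ed @: (S :\ f))) i v.
    by apply: connect1; rewrite /adj iv imset_f // !inE gf.
  case: IH => [h|[h1 h2]|[h1 h2]]; [constructor 1|constructor 2|constructor 3];
    try split=> //; exact: connect_trans iv' _.
have : i \in ed f by rewrite -gf -iv !inE eqxx.
have : v \in ed f by rewrite -gf -iv !inE eqxx orbT.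
rewrite edE !inE => /orP[]/eqP vE /orP[]/eqP iE; move: IH; rewrite vE iE.
- by move=> [h|[h1 h2]|[h1 h2]]; [constructor 1|constructor 2|constructor 3].
- by move=> [h|[_ h]|[_ h]]; [constructor 3|constructor 1|constructor 3].
- by move=> [h|[_ h]|[_ h]]; [constructor 2|constructor 2|constructor 1].
- by move=> [h|[h1 h2]|[h1 h2]]; [constructor 1|constructor 2|constructor 3].
Qed.

(* A minimal set of edges joining the ends of [f], together with [f], is a cycle
   of the multigraph. *)
Lemma edge_cycle S f : f \in S -> connect (adj (ed @: (S :\ f))) (s f) (t f) ->
  exists2 Z : {set 'I_n}, Z \subset S & Z != set0 /\
    forall g, g \in Z -> connect (adj (ed @: (Z :\ g))) (s g) (t g).
Proof.
move=> fS f_conn.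
pose P (Z : {set 'I_n}) := connect (adj (ed @: Z)) (s f) (t f).
have [Z /minsetP[PZ Zmin] ZS] := minset_exists (f_conn : P _).
have fZ : f \notin Z by apply/negP => /(subsetP ZS); rewrite !inE eqxx.
exists (f |: Z).
  by apply/subsetP => g; rewrite !inE => /predU1P[->//|/(subsetP ZS)]; rewrite !inE => /andP[].
split; first by apply/set0Pn; exists f; rewrite !inE eqxx.
move=> g; rewrite !inE => /predU1P[->|gZ]; first by rewrite setU1K.
have gf : g != f by apply: contraNneq fZ => <-.
have nP : ~~ P (Z :\ g).
  apply/negP => Pg; have := Zmin _ Pg (subD1set _ _) => Zg.
  by move: gZ; rewrite -Zg !inE eqxx.
have -> : (f |: Z) :\ g = f |: (Z :\ g).
  by apply/setP => h; rewrite !inE; have [->|//] := eqVneq h f; rewrite eq_sym gf.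
have sub i j : connect (adj (ed @: (Z :\ g))) i j -> connect (adj (ed @: (f |: (Z :\ g)))) i j.
  by apply: connect_edgesS; exact: subsetUr.
have f_in : connect (adj (ed @: (f |: (Z :\ g)))) (s f) (t f).
  by apply: connect_edge; rewrite !inE eqxx.
have symc := connect_adj_sym (ed @: (f |: (Z :\ g))).
(* By minimality the connection inside [Z] runs through [g]; its two remaining pieces, joined by
   [f], connect the ends of [g]. *)
case: (connect_edgesD1 g PZ) => [h|[/sub h1 /sub h2]|[/sub h1 /sub h2]].
- by rewrite /P h in nP.
- rewrite symc in h1; rewrite symc in h2.
  exact: connect_trans h1 (connect_trans f_in h2).
- rewrite symc; rewrite symc in h1; rewrite symc in h2.
  exact: connect_trans h1 (connect_trans f_in h2).
Qed.

Definition spanning F := connected (ed @: F) /\ #|F|.+1 = k.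

Lemma spanning_bridge F f : spanning F -> f \in F ->
  ~~ connect (adj (ed @: (F :\ f))) (s f) (t f).
Proof.
move=> [F_conn cF] fF; apply/negP => f_conn.
have : connected (ed @: (F :\ f)).
  move=> i j; apply: connect_edges (F_conn i j) => g gF.
  have [->//|gf] := eqVneq g f; by apply: connect_edge; rewrite !inE gf.
move=> /connected_card; rewrite -[leqLHS]cF (cardsD1 f) fF /= add1n ltnS => /leq_trans.
by move=> /(_ _ (leq_imset_card _ _)); rewrite ltnn.
Qed.

Lemma bridges_spanning F : connected (ed @: F) ->
  (forall f, f \in F -> ~~ connect (adj (ed @: (F :\ f))) (s f) (t f)) ->
  spanning F.
Proof.
move=> F_conn F_bridge; split=> //.
have [T [TF T_conn cT _]] := connected_spanning F_conn k_gt0.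
rewrite -[RHS]cT.
have TD f : f \in F -> T \subset ed @: (F :\ f) -> False.
  by move=> /F_bridge/negP nf /connect_adjS sub; apply: nf; apply: sub; exact: T_conn.
have -> : T = ed @: F.
  apply/eqP; rewrite eqEsubset TF; apply/subsetP => _ /imsetP[f fF ->].
  apply/negP => fT; apply: (TD f fF); apply/subsetP => e eT.
  have /imsetP[g gF def_e] := subsetP TF _ eT.
  rewrite def_e imset_f // !inE gF andbT; apply/eqP => gf.
  by apply: fT; rewrite -gf -def_e.
rewrite card_in_imset // => f g fF gF fg; apply/eqP/negPn/negP => ne.
case: (TD f fF); apply/subsetP => e eT.
have /imsetP[h hF ->] := subsetP TF _ eT; have [->|hf] := eqVneq h f.
  by rewrite fg imset_f // !inE eq_sym ne.
by rewrite imset_f // !inE hf.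
Qed.

Lemma spanning_tree F : spanning F -> is_tree (ed @: F) /\ {in F &, injective ed}.
Proof.
move=> F_sp; have [F_conn cF] := F_sp.
have [T [TF T_conn cT T2]] := connected_spanning F_conn k_gt0.
have cE : #|ed @: F| = #|F|.
  apply/eqP; rewrite eqn_leq leq_imset_card -ltnS cF -[leqLHS]cT ltnS.
  exact: subset_leq_card.
have TE : T = ed @: F.
  by apply/eqP; rewrite eqEcard TF /= cE -(leq_add2r 1) !addn1 cF cT.
split; last by apply/imset_injP; rewrite cE.
by apply/is_treeP; split; rewrite -?TE // TE cE.
Qed.

Variable w : 'I_n -> nat.
Hypothesis w_inj : injective w.

Definition heavier S f : {set 'I_n} := [set g in S | (w f < w g)%N].

(** What the greedy algorithm keeps when it runs from the heaviest edge down: an edge is accepted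
    iff its ends are not yet joined. *)
Definition kruskal D : {set 'I_n} :=
  [set f in D | ~~ connect (adj (ed @: heavier D f)) (s f) (t f)].

(** Induction from the heaviest edge down: every rejected heavier edge is replaced by a connection
    through still heavier accepted ones. *)
Lemma kruskal_connect D f : f \in D -> f \notin kruskal D ->
  connect (adj (ed @: heavier (kruskal D) f)) (s f) (t f).
Proof.
pose W := \max_g w g; have le_W g : (w g <= W)%N by exact: leq_bigmax.
have [m] := ubnP (W - w f); elim: m f => // m IHm f; rewrite ltnS => le_m fD.
rewrite inE fD negbK => f_conn; apply: connect_edges f_conn => g.
rewrite inE => /andP[gD lt_fg].
have [gK|gK] := boolP (g \in kruskal D); first by apply: connect_edge; rewrite inE gK.
have lt_m : (W - w g < m)%N.
  by apply: leq_trans le_m; apply: ltn_sub2l => //; exact: leq_trans lt_fg (le_W g).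
apply: connect_edgesS (IHm g lt_m gD gK).
by apply/subsetP => h; rewrite !in_set => /andP[-> lt_gh]; exact: ltn_trans lt_gh.
Qed.

Lemma kruskal_spanning D : connected (ed @: D) -> spanning (kruskal D).
Proof.
move=> D_conn; apply: bridges_spanning => [i j|f fK].
  apply: connect_edges (D_conn i j) => f fD.
  have [fK|fK] := boolP (f \in kruskal D); first exact: connect_edge.
  apply: connect_edgesS (kruskal_connect fD fK).
  by apply/subsetP => g; rewrite inE => /andP[].
apply/negP => /(edge_cycle fK)[Z ZK [/set0Pn[g0 g0Z] Zcyc]].
(* The ends of the lightest edge of a cycle are joined by the others, all strictly heavier as the
   weights are distinct, so it cannot have been kept. *)
case: (arg_minnP w g0Z) => g gZ g_min.
have := subsetP ZK _ gZ; rewrite inE => /andP[gD /negP]; apply.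
apply: connect_edgesS (Zcyc g gZ); apply/subsetP => h; rewrite !inE => /andP[hg hZ].
have := subsetP ZK _ hZ; rewrite inE => /andP[-> _] /=.
by rewrite ltn_neqAle g_min // andbT (inj_eq w_inj) eq_sym.
Qed.

(* Kruskal's greedy characterization of the maximal spanning tree. *)
Lemma kruskalP D F : connected (ed @: D) -> F \subset D ->
  spanning F /\ (forall f, f \in D -> f \notin F ->
     connect (adj (ed @: heavier F f)) (s f) (t f)) <-> F = kruskal D.
Proof.
move=> D_conn FD; split=> [[F_sp F_heavy]|->]; last first.
  by split=> [|f fD fK]; [exact: kruskal_spanning|exact: kruskal_connect].
apply/setP => f; have [fD|fD] := boolP (f \in D); last first.
  by rewrite inE (negbTE fD); apply/negbTE; apply: contra fD => /(subsetP FD).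
have [fF|fF] := boolP (f \in F).
  rewrite inE fD /=; apply/esym; apply: contra (spanning_bridge F_sp fF).
  apply: connect_edges => g; rewrite inE => /andP[gD lt_fg].
  have gf : g != f by apply: contraTneq lt_fg => ->; rewrite ltnn.
  have [gF|gF] := boolP (g \in F); first by apply: connect_edge; rewrite !inE gf.
  apply: connect_edgesS (F_heavy g gD gF); apply/subsetP => h.
  rewrite !inE => /andP[-> lt_gh]; rewrite andbT.
  by apply: contraTneq (ltn_trans lt_fg lt_gh) => ->; rewrite ltnn.
rewrite inE fD /=; apply/esym/negbTE; rewrite negbK.
apply: connect_edgesS (F_heavy f fD fF); apply/subsetP => g; rewrite !inE.
by move=> /andP[/(subsetP FD) -> ->].
Qed.

End Kruskal.

(** * Splicing involutions *)

Section DisjointTranspositions.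
Variable n : nat.
Implicit Types (i j : 'I_n) (F : {set 'I_n}) (r : seq ('I_n * 'I_n)) (tau iota : 'S_n).

Definition tperm_prod r : 'S_n := (\prod_(p <- r) tperm p.1 p.2)%g.
Definition pair_points r : seq 'I_n := flatten [seq [:: p.1; p.2] | p <- r].

Lemma tperm_prod_notin r i : i \notin pair_points r -> tperm_prod r i = i.
Proof.
rewrite /tperm_prod; elim: r => [|p r IH] /=; first by rewrite big_nil perm1.
rewrite !inE !negb_or => /and3P[i1 i2 ir]; rewrite big_cons permM tpermD ?IH //.
  by rewrite eq_sym.
by rewrite eq_sym.
Qed.

Lemma mem_pair_points r p : p \in r -> (p.1 \in pair_points r) && (p.2 \in pair_points r).
Proof.
move=> pr; apply/andP; split; apply/flattenP; exists [:: p.1; p.2];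
  by rewrite ?inE ?eqxx ?orbT //; apply/mapP; exists p.
Qed.

Lemma tperm_prod_in r p : uniq (pair_points r) -> p \in r ->
  tperm_prod r p.1 = p.2 /\ tperm_prod r p.2 = p.1.
Proof.
elim: r => //= q r IH; rewrite !inE negb_or -!andbA => /and4P[q12 q1 q2 ur].
rewrite /tperm_prod big_cons !permM => /predU1P[->|pr].
  rewrite tpermL tpermR; split; exact: tperm_prod_notin.
have /andP[p1 p2] := mem_pair_points pr.
have [h1 h2] := IH ur pr.
by rewrite !tpermD //; [apply: contraNneq q1|apply: contraNneq q2|apply: contraNneq q1|apply: contraNneq q2] => ->.
Qed.

(** Each transposition of an involution is represented by its smaller point, so that sets of
    transpositions of [iota] are subsets of [upper iota]. *)
Definition upper tau : {set 'I_n} := [set i : 'I_n | (i < tau i)%N].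

Definition involution tau := forall i, tau (tau i) = i.

Lemma involutionP tau : reflect (involution tau) (tau * tau == 1)%g.
Proof.
apply: (iffP eqP) => [tt i|tt]; first by rewrite -permM tt perm1.
by apply/permP => i; rewrite permM tt perm1.
Qed.

Lemma upper_moved tau i : involution tau ->
  (tau i != i) = (i \in upper tau) || (tau i \in upper tau).
Proof.
by move=> tt; rewrite !inE tt -neq_ltn eq_sym; apply/idP/idP.
Qed.

Lemma card_moved tau : involution tau -> #|[set i | tau i != i]| = (#|upper tau|).*2.
Proof.
move=> tt; have -> : [set i | tau i != i] = upper tau :|: tau @^-1: upper tau.
  by apply/setP => i; rewrite inE upper_moved // !inE.
rewrite cardsU (_ : _ :&: _ = set0) ?cards0 ?subn0; last first.
  by apply/setP => i; rewrite !inE tt; case: ltngtP.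
by rewrite card_preimset ?addnn //; exact: perm_inj.
Qed.

Definition tau_of (F : {set 'I_n}) iota : 'S_n := tperm_prod [seq (i, iota i) | i <- enum F].

Lemma uniq_pair_points F iota : involution iota -> F \subset upper iota ->
  uniq (pair_points [seq (i, iota i) | i <- enum F]).
Proof.
move=> ii FU; have Up i : i \in enum F -> (i < iota i)%N.
  by rewrite mem_enum => /(subsetP FU); rewrite inE.
have := enum_uniq (mem F); elim: (enum F) Up => //= i l IH Up /andP[il ul].
have Ul j : j \in l -> (j < iota j)%N by move=> jl; apply: Up; rewrite inE jl orbT.
have lti := Up i (mem_head _ _).
have mem_pts j : j \in pair_points [seq (i0, iota i0) | i0 <- l] -> (j \in l) || (iota j \in l).
  move=> /flattenP[_ /mapP[_ /mapP[h hl ->] ->]] /=; rewrite !inE => /orP[]/eqP->.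
    by rewrite hl.
  by rewrite ii hl orbT.
have iil : iota i \notin l.
  by apply/negP => /Ul; rewrite ii ltnNge ltnW.
apply/and3P; split; last exact: IH.
  rewrite inE negb_or; apply/andP; split; first by apply/eqP => e; rewrite -e ltnn in lti.
  by apply/negP => /mem_pts; rewrite (negbTE il) (negbTE iil).
by apply/negP => /mem_pts; rewrite ii (negbTE il) (negbTE iil).
Qed.

Lemma tau_ofE F iota i : involution iota -> F \subset upper iota ->
  tau_of F iota i = if (i \in F) || (iota i \in F) then iota i else i.
Proof.
move=> ii FU; have up := uniq_pair_points ii FU.
have inr j : j \in F -> (j, iota j) \in [seq (i, iota i) | i <- enum F].
  by move=> jF; apply/mapP; exists j; rewrite ?mem_enum.
case: ifP => [/orP[iF|iF]|/negbT/norP[iF iiF]].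
- by have [] := tperm_prod_in up (inr _ iF).
- by have [_] := tperm_prod_in up (inr _ iF); rewrite /= ii.
apply: tperm_prod_notin; apply/negP.
move=> /flattenP[_ /mapP[_ /mapP[h + ->] ->]] /=; rewrite !inE mem_enum => hF /orP[]/eqP e.
  by rewrite e hF in iF.
by rewrite e ii hF in iiF.
Qed.

Lemma tau_of_involution F iota : involution iota -> F \subset upper iota ->
  involution (tau_of F iota).
Proof.
move=> ii FU i; rewrite !tau_ofE //.
have [h|h] := boolP ((i \in F) || (iota i \in F)); first by rewrite ii orbC h.
by rewrite (negbTE h).
Qed.

Lemma upper_tau_of F iota : involution iota -> F \subset upper iota ->
  upper (tau_of F iota) = F.
Proof.
move=> ii FU; apply/setP => i; rewrite inE tau_ofE //.
have [iF|iF] /= := boolP (i \in F); first by have := subsetP FU _ iF; rewrite inE.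
case: ifP => [iiF|]; last by rewrite ltnn.
by have := subsetP FU _ iiF; rewrite inE ii; case: ltngtP.
Qed.

End DisjointTranspositions.

Section Splicing.
Variables (n k : nat) (nu : 'I_n -> 'I_k).
Implicit Types (tau iota : 'S_n) (E : {set {set 'I_k}}).

Definition edge (f : 'I_n -> 'I_n) i : {set 'I_k} := [set nu i; nu (f i)].

(** Trades the list of k - 1 pairs for a cardinality: with as many transpositions as edges and every
    edge attained, [edge tau] is a bijection onto [E], and a list of pairs can be read off
    [upper tau]. *)
Lemma spliceP E tau : is_tree E -> reflect
  [/\ involution tau, #|upper tau|.+1 = k & edge tau @: upper tau = E]
  (tau \in Splice E nu).
Proof.
move=> E_tree; have /is_treeP[_ _ cE] := E_tree.
rewrite inE; apply: (iffP andP) => [[/involutionP tt] |].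
  move=> /existsP[r /and3P[ur /eqP def_tau /eqP def_E]].
  have {}E2 : {in E, forall e : {set 'I_k}, #|e| = 2%N} by have /is_treeP[] := E_tree.
  have tauE p : p \in val r -> tau p.1 = p.2 /\ tau p.2 = p.1.
    by move=> pr; rewrite def_tau; exact: tperm_prod_in.
  have upE : edge tau @: upper tau = E.
    rewrite def_E; apply/setP => e; rewrite inE; apply/imsetP/mapP => [[j] | [p pr ->]].
      rewrite inE => lti ->.
      have : j \in pair_points r.
        apply: contraTT lti => ir; rewrite def_tau -/(tperm_prod r).
        by rewrite tperm_prod_notin // ltnn.
      move=> /flattenP[_ /mapP[p pr ->]]; have [t1 t2] := tauE p pr.
      rewrite !inE => /orP[]/eqP->; exists p => //; rewrite /edge ?t1 ?t2 //.
      by rewrite setUC.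
    have [t1 t2] := tauE p pr; have [lt|lt|e12] := ltngtP p.1 p.2.
    - by exists p.1; rewrite ?inE /edge t1.
    - by exists p.2; rewrite ?inE /edge t2 // setUC.
    have : #|[set nu p.1; nu p.2]| = 2%N.
      by apply: E2; rewrite def_E inE; apply/mapP; exists p.
    by rewrite cards2 (val_inj e12) eqxx.
  split=> //; apply/eqP; rewrite eqn_leq; apply/andP; split; last first.
    by rewrite -[leqLHS]cE ltnS -[in leqLHS]upE leq_imset_card.
  have k_gt0 : (0 < k)%N by rewrite -[X in (_ < X)%N]cE.
  rewrite -(prednK k_gt0) ltnS -leq_double -card_moved //.
  have sz : size (pair_points r) = (k.-1).*2.
    suff -> (l : seq ('I_n * 'I_n)) : size (pair_points l) = (size l).*2.
      by rewrite size_tuple.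
    by elim: l => [|p l IH] //; rewrite /= doubleS -IH.
  rewrite -sz -(card_uniqP ur); apply/subset_leq_card/subsetP => i; rewrite inE.
  by apply: contraR => ir; rewrite def_tau -/(tperm_prod r) tperm_prod_notin.
move=> [tt cU def_E]; split; first exact/involutionP.
pose r := [seq (i, tau i) | i <- enum (upper tau)].
have sz_r : size r == k.-1 by rewrite size_map -cardE -cU.
apply/existsP; exists (Tuple sz_r); apply/and3P; split=> /=.
- exact: uniq_pair_points.
- rewrite -[X in _ == X]/(tau_of (upper tau) tau); apply/eqP/permP => i.
  by rewrite tau_ofE // -upper_moved //; case: eqP.
- rewrite -def_E; apply/eqP/setP => e; rewrite inE -map_comp.
  by apply/imsetP/mapP => -[i iU ->]; exists i; rewrite ?mem_enum // -mem_enum.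
Qed.

Variable theta : 'S_n.
Hypothesis nu_theta : forall i, nu (theta i) = nu i.

(** Start from the k cycles of [theta] and multiply by one transposition at a time. The cycles built
    from the previous edges never cross the bridge given by the new edge, so its ends lie on
    different cycles and each step merges two. *)
Lemma splice_ncycle E tau : is_tree E -> k = ncycles theta -> tau \in Splice E nu ->
  #|porbits (tau * theta)%g| = 1%N.
Proof.
move=> E_tree k_def tauS; have /is_treeP[E2 _ cE] := E_tree.
move: tauS; rewrite inE => /andP[_ /existsP[r /and3P[ur /eqP def_tau /eqP def_E]]].
pose es (l : seq ('I_n * 'I_n)) := [seq [set nu p.1; nu p.2] | p <- l].
have k_gt0 : (0 < k)%N by rewrite -[X in (_ < X)%N]cE.
have u_es : uniq (es r).
  have : #|E| = size (es r).
    by apply: succn_inj; rewrite size_map size_tuple prednK.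
  by rewrite def_E cardsE => /card_uniqP.
have esE e : e \in es r -> e \in E by rewrite def_E inE.
suff main (l : seq ('I_n * 'I_n)) : uniq (es l) -> {subset es l <= E} ->
    (#|porbits (tperm_prod l * theta)| + size l = k)%N.
  have := main r u_es esE; rewrite -[tperm_prod r]def_tau size_tuple => h.
  by apply/eqP; rewrite -(eqn_add2r k.-1) h add1n prednK.
elim: l => [|p l IH] /= uq sub.
  by rewrite /tperm_prod big_nil mul1g addn0 k_def.
case/andP: uq => p_l ul; have {}IH : (#|porbits (tperm_prod l * theta)%g| + size l = k)%N.
  by apply: IH => // e el; apply: sub; rewrite inE el orbT.
have pE : [set nu p.1; nu p.2] \in E by apply: sub; rewrite mem_head.
have bridge := tree_bridge E_tree pE; set E' := E :\ _ in bridge.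
have stepE x : connect (adj E') (nu x) (nu (tperm_prod l x)).
  have sub' q : q \in l -> connect (adj E') (nu q.1) (nu q.2).
    move=> ql; apply: connect1; rewrite /adj !inE.
    have ql' : [set nu q.1; nu q.2] \in es l by apply/mapP; exists q.
    rewrite sub ?inE ?ql' ?orbT // andbT; apply: contraNneq p_l => <-; exact: ql'.
  move: sub'; rewrite /tperm_prod; elim: l x {IH ul p_l sub} => [|q l IH] x sub'.
    by rewrite big_nil perm1.
  rewrite big_cons permM; set y := tperm _ _ x.
  apply: (@connect_trans _ _ (nu y)).
    have q12 := sub' q (mem_head _ _).
    by rewrite /y; case: tpermP => [->|->|] //; rewrite connect_adj_sym.
  by apply: IH => q' ql'; apply: sub'; rewrite inE ql' orbT.
have orbE x y : y \in porbit (tperm_prod l * theta)%g x -> connect (adj E') (nu x) (nu y).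
  move=> /porbitP[i ->]; elim: i => [|i IHi]; first by rewrite expg0 perm1.
  rewrite expgSr permM; apply: connect_trans IHi _.
  by rewrite permM nu_theta.
have ne : p.2 != p.1.
  by apply: contraNneq bridge => ->.
have notin : p.2 \notin porbit (tperm_prod l * theta)%g p.1.
  by apply: contra bridge => /orbE.
have := porbits_tperm (tperm_prod l * theta)%g ne; rewrite notin /=.
rewrite /tperm_prod big_cons -/(tperm_prod l) mulgA -IH.
move: #|_| #|_| => u v; lia.
Qed.

End Splicing.

(** * Gluing splicing involutions to planar matchings *)

Section Reorganization.
Variables (n k : nat) (n_gt0 : (0 < n)%N) (theta : 'S_n) (gamma : 'I_n -> 'I_n).
Variable nu : 'I_n -> 'I_k.
Hypothesis k_def : k = ncycles theta.
Hypothesis nu_onto : forall c : 'I_k, exists i : 'I_n, nu i = c.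
Hypothesis nu_theta : forall i : 'I_n, nu (theta i) = nu i.
Implicit Types (tau iota p : 'S_n) (E : {set {set 'I_k}}) (F : {set 'I_n}).

Definition fixed tau : {set 'I_n} := [set i | tau i == i].

Definition sub_involution tau iota := [forall i, (tau i == i) || (tau i == iota i)].

Lemma porbit_subgroup (s : 'S_n) (x y : 'I_n) (G : {group 'S_n}) :
  (forall z, exists2 g : 'S_n, g \in G & s z = g z) -> y \in porbit s x ->
  exists2 g : 'S_n, g \in G & y = g x.
Proof.
move=> sG /porbitP[i ->]; elim: i => [|i [g gG IH]].
  by exists 1%g; rewrite ?group1 // expg0.
have [h hG hE] := sG ((s ^+ i)%g x); exists (g * h)%g; first exact: groupM.
by rewrite expgSr !permM hE IH.
Qed.

(** The permutations that move no point out of the connected component of its [nu]-image form a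
    group; it contains [theta], which preserves [nu], and [iota], hence the whole transitive
    group. *)
Lemma transitive_connected iota : involution iota ->
  [transitive <<[set theta; iota]>>%g, on [set: 'I_n] | 'P] ->
  connected (edge nu iota @: upper iota).
Proof.
move=> ii tr a b; have [i <-] := nu_onto a; have [j <-] := nu_onto b.
set E := edge nu iota @: _.
have /orbitP[g gG <-] : j \in orbit 'P <<[set theta; iota]>>%g i.
  by rewrite (atransP tr) ?inE.
pose H := [set h : 'S_n | [forall x, connect (adj E) (nu x) (nu (h x))]].
have HP (h : 'S_n) : reflect (forall x, connect (adj E) (nu x) (nu (h x))) (h \in H).
  by rewrite inE; exact: forallP.
have gH : group_set H.
  apply/group_setP; split=> [|u v /HP uH /HP vH]; apply/HP => x; rewrite ?perm1 //.
  by rewrite permM; apply: connect_trans (uH x) (vH _).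
suff sub : <<[set theta; iota]>>%g \subset Group gH.
  by move/subsetP/(_ g gG)/HP: sub.
rewrite gen_subG; apply/subsetP => h; rewrite !inE => /orP[]/eqP->.
  by apply/forallP => x; rewrite nu_theta.
apply/forallP => x; have [->//|x_m] := eqVneq (iota x) x.
rewrite (upper_moved _ ii) in x_m; apply: connect1; case/orP: x_m => xU.
  by apply/imsetP; exists x.
by apply/imsetP; exists (iota x); rewrite // /edge ii setUC.
Qed.

Lemma MatchP iota : reflect (involution iota /\ forall i, iota i != i) (iota \in Match n).
Proof.
rewrite inE; apply: (iffP andP) => [[/eqP o2 /forallP fp]|[ii fp]]; split=> //.
- by move=> i; rewrite -permM -[(_ * _)%g]/(iota ^+ 2)%g -o2 expg_order perm1.
- have i2 : (iota ^+ 2 = 1)%g.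
    by apply/permP => i; rewrite expgS expg1 permM ii perm1.
  have o1 : #[iota]%g != 1%N.
    by rewrite order_eq1; apply: contraNneq (fp (Ordinal n_gt0)) => ->; rewrite perm1.
  have := cyclic.order_dvdn iota 2; rewrite i2 eqxx => o2.
  exact/eqP/(elimT (@prime_nt_dvdP _ 2 isT o1) o2).
- by apply/forallP.
Qed.

Lemma SpliceCP E tau : reflect (tau \in Splice E nu /\ forall i, gamma (tau i) = gamma i)
  (tau \in SpliceC E nu gamma).
Proof.
rewrite [X in reflect _ X]in_set; apply: (iffP andP) => -[tS tg]; split=> //.
  by move=> i; apply/eqP; move/forallP: tg.
by apply/forallP => i; rewrite tg.
Qed.

(** Euler count: [tau * theta] has one cycle and [tau] has k - 1 transpositions, so planarity of
    [p = tau * iota] on the n - 2 (k - 1) fixed points says that theta o iota has 1 + (n - 2 (k -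
    1)) / 2 = 2 + n / 2 - k cycles. *)
Lemma splice_match E tau iota : is_tree E -> tau \in SpliceC E nu gamma ->
  [&& matching_on (fixed tau) (tau * iota)%g,
      planar (tau * theta)%g (fixed tau) (tau * iota)%g &
      [forall i, gamma ((tau * iota)%g i) == gamma i]] =
  (iota \in Map0 theta gamma) && sub_involution tau iota.
Proof.
move=> E_tree /SpliceCP[tS tg]; have [tt cU def_E] := elimT (spliceP nu _ E_tree) tS.
have mP : matching_on (fixed tau) (tau * iota)%g =
    (iota \in Match n) && sub_involution tau iota.
  apply/matching_onP/andP => [[pp pX]|[/MatchP[ii fp] /forallP sub]].
    have io i : iota i = (tau * iota)%g (tau i) by rewrite permM tt.
    have io_moved i : tau i != i -> iota i = tau i.
      move=> ti; rewrite io; apply/eqP; rewrite -[_ == _]negbK pX inE tt.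
      by rewrite eq_sym.
    have io_fixed i : tau i = i -> iota i = (tau * iota)%g i by move=> ti; rewrite [LHS]io ti.
    have fp i : iota i != i.
      have [ti|ti] := eqVneq (tau i) i; first by rewrite io_fixed // pX inE ti.
      by rewrite io_moved.
    split; last first.
      by apply/forallP => i; case: eqVneq => //= /io_moved ->; rewrite eqxx.
    apply/MatchP; split=> // i.
    have [ti|ti] := eqVneq (tau i) i; last first.
      by rewrite (io_moved i ti) (io_moved (tau i)) tt // eq_sym.
    have := pX i; rewrite inE ti eqxx => pi.
    have : (tau * iota)%g i \in fixed tau by rewrite -pX pp eq_sym pi.
    rewrite inE => /eqP tpi.
    by rewrite (io_fixed i ti) (io_fixed _ tpi) pp.
  have io i : tau i != i -> tau i = iota i by move=> ti; have := sub i; rewrite (negbTE ti) => /eqP.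
  have tau_fix i : tau i = i -> tau (iota i) = iota i.
    move=> ti; apply/eqP/negPn/negP => ne; have := io _ ne; rewrite ii => e.
    by have := fp i; rewrite -(tt (iota i)) e ti eqxx.
  have pE i : (tau * iota)%g i = if tau i == i then iota i else i.
    by rewrite permM; have [->//|/io ->] := eqVneq (tau i) i; rewrite ii.
  split=> i; rewrite !pE ?inE; have [ti|ti] := eqVneq (tau i) i.
  - by rewrite tau_fix // eqxx ii.
  - by rewrite (negbTE ti).
  - exact: fp.
  - by rewrite eqxx.
have [mM|nmM] := boolP (matching_on (fixed tau) (tau * iota)%g); last first.
  rewrite mP in nmM; rewrite /=; apply/esym/negbTE; apply: contra nmM.
  by rewrite inE => /andP[/andP[]]; rewrite inE => /andP[-> _] _ ->.
move: (mM); rewrite mP => /andP[iM iS]; rewrite iS andbT /=.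
have /MatchP[ii fp] := iM; rewrite inE [in RHS]inE iM /=.
(* Transitivity is automatic: at each point [tau] agrees with [iota] or with the identity, so the
   single cycle of [tau * theta] lies in one orbit of the group generated by [theta] and [iota]. *)
have -> : [transitive <<[set theta; iota]>>%g, on [set: 'I_n] | 'P].
  apply/imsetP; exists (Ordinal n_gt0) => //; apply/esym/eqP; rewrite eqEsubset subsetT /=.
  apply/subsetP => j _; pose G := <<[set theta; iota]>>%G.
  have thetaG : theta \in G by rewrite mem_gen // !inE eqxx.
  have iotaG : iota \in G by rewrite mem_gen // !inE eqxx orbT.
  have step z : exists2 g : 'S_n, g \in G & (tau * theta)%g z = g z.
    have /orP[/eqP ti|/eqP ti] := forallP iS z.
      by exists theta => //; rewrite permM ti.
    by exists (iota * theta)%g; rewrite ?groupM // !permM ti.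
  have : j \in porbit (tau * theta)%g (Ordinal n_gt0).
    have c1 := splice_ncycle nu_theta E_tree k_def tS.
    have /card_le1_eqP c2 := eq_leq c1.
    have <- : porbit (tau * theta)%g j = porbit (tau * theta)%g (Ordinal n_gt0).
      by apply: c2; exact: imset_f.
    exact: porbit_id.
  by move=> /(porbit_subgroup step)[g gG ->]; exact: (mem_orbit 'P _ gG).
have -> : [forall i, gamma ((tau * iota)%g i) == gamma i] = [forall i, gamma (iota i) == gamma i].
  apply/forallP/forallP => h i.
    by have := h (tau i); rewrite permM tt tg.
  by rewrite permM (eqP (h _)) tg.
rewrite andbC /=; congr (_ && _).
(* Since [tau] and [iota] commute, [p * (tau * theta)] is [iota * theta], that is
   [pcomp theta iota]. *)
have comm : (tau * iota = iota * tau)%g.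
  apply/permP => i; rewrite !permM; have /orP[/eqP ti|/eqP ti] := forallP iS i.
    rewrite ti; have /orP[/eqP //|/eqP e] := forallP iS (iota i).
    by have := fp i; rewrite -[iota i]tt e ii ti eqxx.
  by have := forallP iS (iota i); rewrite ti ii -ti tt; case/orP => /eqP.
rewrite /planar mulgA comm -[(iota * tau * tau)%g]mulgA (eqP (introT (involutionP _) tt)) mulg1.
have c1 := splice_ncycle nu_theta E_tree k_def tS.
rewrite /pcomp -[ncycles theta]k_def /ncycles.
have c2 := card_moved tt; have c3 := card_moved ii.
have cI : #|[set i | iota i != i]| = n.
  by rewrite (_ : [set i | _] = setT) ?cardsT ?card_ord //; apply/setP => i; rewrite !inE fp.
have cF : (#|fixed tau| + #|[set i | tau i != i]| = n)%N.
  rewrite -[RHS]card_ord -[RHS](cardC (mem (fixed tau))); congr (_ + _)%N.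
  by apply: eq_card => i; rewrite !inE.
have n2 : n./2 = #|upper iota| by rewrite -[X in X./2]cI c3 half_double.
have cF' : (#|fixed tau| + (#|upper tau|).*2 = (#|upper iota|).*2)%N.
  by rewrite -c2 cF -c3 cI.
rewrite c1 n2; move: cF' cU; move: #|porbits _| => u.
by move: #|fixed tau| #|upper tau| #|upper iota| => a b c; lia.
Qed.

Lemma Map0_involution iota : iota \in Map0 theta gamma ->
  involution iota /\ forall i, iota i != i.
Proof. by rewrite inE => /andP[/setIdP[/MatchP]]. Qed.

Lemma Map0_connected iota : iota \in Map0 theta gamma ->
  connected (edge nu iota @: upper iota).
Proof.
move=> iM; have [ii _] := Map0_involution iM; apply: transitive_connected => //.
by move: iM; rewrite inE => /andP[/setIdP[_ /andP[]]].
Qed.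

Lemma upper_splice tau iota : involution tau -> involution iota ->
  (forall i, iota i != i) -> sub_involution tau iota ->
  upper (tau * iota)%g = upper iota :\: upper tau /\
  {in upper iota :\: upper tau, (tau * iota)%g =1 iota}.
Proof.
move=> tt ii fp /forallP sub.
have pE i : (tau * iota)%g i = if tau i == i then iota i else i.
  by rewrite permM; case: eqVneq (sub i) => [->//|_ /= /eqP ->]; rewrite ii.
have upE i : (i \in upper iota :\: upper tau) = (tau i == i) && (i < iota i)%N.
  rewrite !inE; case: eqVneq (sub i) => [->|ti /= /eqP <-]; first by rewrite ltnn.
  by rewrite andNb.
split; last by move=> i; rewrite upE pE => /andP[->].
by apply/setP => i; rewrite upE inE pE; case: eqP => //; rewrite ltnn.
Qed.

Lemma upper_sub_eq tau iota i : sub_involution tau iota ->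
  i \in upper tau -> tau i = iota i.
Proof.
move=> /forallP/(_ i)/orP[]/eqP // ti; by rewrite inE ti ltnn.
Qed.

Lemma upper_sub tau iota : sub_involution tau iota -> upper tau \subset upper iota.
Proof.
move=> sub; apply/subsetP => i iU; have := iU; rewrite !inE.
by rewrite (upper_sub_eq sub iU).
Qed.

(** The extensionality hypothesis lets the matching [p] be replaced by [iota]: they agree on
    [upper p], which is [upper iota] minus [F]. *)
Lemma splice_sum (C : nmodType)
    (Phi : {set {set 'I_k}} -> {set 'I_n} -> ('I_n -> 'I_n) -> C) :
  (forall E (D : {set 'I_n}) (f g : 'I_n -> 'I_n),
     {in D, f =1 g} -> Phi E D f = Phi E D g) ->
  \sum_(E : {set {set 'I_k}} | is_tree E) \sum_(tau in SpliceC E nu gamma)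
    \sum_(p : 'S_n | [&& matching_on (fixed tau) p,
        planar (tau * theta)%g (fixed tau) p & [forall i, gamma (p i) == gamma i]])
      Phi E (upper p) p =
  \sum_(iota in Map0 theta gamma)
    \sum_(F : {set 'I_n} | [&& F \subset upper iota, is_tree (edge nu iota @: F)
                           & #|F|.+1 == k])
      Phi (edge nu iota @: F) (upper iota :\: F) iota.
Proof.
move=> Phi_ext.
transitivity (\sum_(E : {set {set 'I_k}} | is_tree E) \sum_(tau in SpliceC E nu gamma)
   \sum_(iota in Map0 theta gamma | sub_involution tau iota)
     Phi E (upper iota :\: upper tau) iota).
  apply: eq_bigr => E E_tree; apply: eq_bigr => tau tS.
  rewrite (reindex_inj (mulgI tau)) /=; apply: eq_big => [iota|iota].
    exact: (splice_match _ E_tree tS).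
  rewrite (splice_match _ E_tree tS) => /andP[/Map0_involution[ii fp] sub].
  have /SpliceCP[/(elimT (spliceP nu _ E_tree))[tt _ _] _] := tS.
  by have [-> h] := upper_splice tt ii fp sub; exact: Phi_ext.
rewrite pair_big_dep /=.
rewrite (exchange_big_dep (fun iota => iota \in Map0 theta gamma)) /=; last first.
  by move=> q iota _ /andP[].
apply: eq_bigr => iota iM; have [ii fp] := Map0_involution iM.
rewrite (reindex_onto (fun F => (edge nu iota @: F, tau_of F iota)) (fun q => upper q.2)) /=.
  apply: eq_big => [F|F]; last by case/andP=> _ /eqP ->.
  apply/idP/and3P => [/andP[/andP[/andP[E_tree tS] /andP[_ sub]] /eqP upF]|[FU E_tree cF]].
    split=> //; last first.
      have /SpliceCP[/(elimT (spliceP nu _ E_tree))[_ cU _] _] := tS.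
      by move: cU; rewrite upF => ->.
    by rewrite -upF; exact: upper_sub.
  have upF := upper_tau_of ii FU; have tF := tau_of_involution ii FU.
  have tauF i : i \in F -> tau_of F iota i = iota i by move=> iF; rewrite tau_ofE // iF.
  rewrite E_tree iM upF eqxx andbT /=; apply/andP; split; last first.
    by apply/forallP => i; rewrite tau_ofE //; case: ifP; rewrite eqxx ?orbT.
  apply/SpliceCP; split.
    apply/(spliceP nu _ E_tree); split=> //; first by rewrite upF; exact/eqP.
    by rewrite upF; apply: eq_in_imset => i iF; rewrite /edge tauF.
  move=> i; rewrite tau_ofE //; case: ifP => // _.
  by move: iM; rewrite inE => /andP[/setIdP[_ /andP[_ /forallP/(_ i)/eqP]]].
move=> [E tau] /= /andP[/andP[E_tree tS] /andP[_ sub]].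
have /SpliceCP[/(elimT (spliceP nu _ E_tree))[tt _ def_E] _] := tS.
have tauE i : i \in upper tau -> tau i = iota i by exact: upper_sub_eq.
congr (_, _).
  by rewrite -def_E; apply: eq_in_imset => i iU; rewrite /edge tauE.
apply/permP => i; rewrite tau_ofE //; last exact: upper_sub.
have [ti|ti] := eqVneq (tau i) i; last first.
  have := forallP sub i; rewrite (negbTE ti) => /eqP tiE.
  by have := upper_moved i tt; rewrite ti tiE => <-.
case: ifP => // /orP[iU|iU]; first by rewrite -tauE.
have := tauE _ iU; rewrite ii => e; have := fp i.
by rewrite -[iota i]tt e ti eqxx.
Qed.

End Reorganization.

(** * Square roots and the weight matrix *)

Section SquareRoot.
Variable R : realType.

Lemma interpolation (s : seq R) (f : R -> R) : uniq s ->
  exists q : {poly R}, {in s, forall y, q.[y] = f y}.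
Proof.
elim: s => [|t s IH] /=; first by exists 0.
case/andP=> ts /IH[q qE]; pose P := \prod_(y <- s) ('X - y%:P).
have Pt : P.[t] != 0.
  by apply: contra ts => /eqP/rootP; rewrite root_prod_XsubC.
exists (q + ((f t - q.[t]) / P.[t]) *: P) => y; rewrite inE => /predU1P[->|ys].
  by rewrite !hornerE divfK // addrC subrK.
have -> : (q + ((f t - q.[t]) / P.[t]) *: P).[y] = q.[y] + ((f t - q.[t]) / P.[t]) * P.[y].
  by rewrite !hornerE.
have /rootP -> : root P y by rewrite root_prod_XsubC.
by rewrite mulr0 addr0 qE.
Qed.

(** The root is [q(A)] for a polynomial [q] that interpolates the square root at the finitely many
    eigenvalues; its symmetry and its quadratic form are read off the spectral decomposition. *)
Lemma posdef_sqrt k (A : 'M[R]_k) : posdefmx A ->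
  exists S : 'M[R]_k, posdefmx S /\ S *m S = A.
Proof.
case: k A => [|k] A A_pd.
  by exists A; split=> //; apply/matrixP => - [].
have [d [al [be [d_gt0 _ specE]]]] := real_spectral A_pd.
have [q qE] := interpolation Num.sqrt (undup_uniq [seq d l | l <- enum 'I_k.+1]).
have qd l : q.[d l] = Num.sqrt (d l).
  by apply: qE; rewrite mem_undup; apply/mapP; exists l; rewrite ?mem_enum.
have SS : horner_mx A q *m horner_mx A q = A.
  rewrite -[LHS](rmorphM (horner_mx A)) -[RHS]horner_mx_X; apply/matrixP => i j.
  by rewrite !specE; apply: eq_bigr => l _; rewrite hornerM hornerX qd -expr2 sqr_sqrtr // ltW.
exists (horner_mx A q); split=> //; split.
  apply/matrixP => i j; rewrite mxE !specE; apply: eq_bigr => l _.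
  by rewrite [al l j * _]mulrC [be l j * _]mulrC.
move=> v v0; pose b l := (\sum_i v ord0 i * al l i) ^+ 2 + (\sum_i v ord0 i * be l i) ^+ 2.
have qfE (p : {poly R}) : (v *m horner_mx A p *m v^T) ord0 ord0 = \sum_l b l * p.[d l].
  rewrite quadratic_form.
  transitivity (\sum_i \sum_j \sum_l
     (v ord0 i * al l i * (v ord0 j * al l j) + v ord0 i * be l i * (v ord0 j * be l j)) * p.[d l]).
    apply: eq_bigr => i _; apply: eq_bigr => j _; rewrite specE mulr_sumr.
    by apply: eq_bigr => l _; ring.
  rewrite (eq_bigr _ (fun i _ => exchange_big _ _ _ _ _ _)) exchange_big /=.
  apply: eq_bigr => l _; rewrite (eq_bigr _ (fun i _ => esym (mulr_suml _ _ _ _))) -mulr_suml.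
  congr (_ * _); rewrite /b !expr2 !mulr_suml -big_split /=; apply: eq_bigr => i _.
  by rewrite !mulr_sumr -big_split.
have b_ge0 l : 0 <= b l by rewrite addr_ge0 ?sqr_ge0.
have : 0 < (v *m horner_mx A 'X *m v^T) ord0 ord0 by rewrite horner_mx_X; apply: A_pd.2.
rewrite !qfE => pos; rewrite lt_neqAle sumr_ge0 ?andbT; last first.
  by move=> l _; rewrite qd mulr_ge0 // sqrtr_ge0.
rewrite eq_sym psumr_neq0; last by move=> l _; rewrite qd mulr_ge0 // sqrtr_ge0.
move: pos; rewrite lt0r psumr_neq0; last by move=> l _; rewrite hornerX mulr_ge0 // ltW.
case/andP=> /hasP[l _ /= bl] _; apply/hasP; exists l; rewrite ?mem_index_enum //=.
rewrite qd pmulr_lgt0 ?sqrtr_gt0 //; move: bl; by rewrite hornerX pmulr_lgt0.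
Qed.

Lemma sqrtmxP k (A : 'M[R]_k) : posdefmx A ->
  posdefmx (sqrtmx A) /\ sqrtmx A *m sqrtmx A = A.
Proof.
move=> /posdef_sqrt[S S_sqrt]; rewrite /sqrtmx.
by case: xgetP => [T _ //|/(_ S)]; case.
Qed.

(* [1 - sqrt (1 - b)] is the limit of the iterates of [y |-> (b + y ^ 2) / 2],
   starting at 0, at [b = 1 - 'X / c]. *)
Fixpoint sqrt_iter (c : R) (m : nat) : {poly R} :=
  if m is m1.+1 then 2^-1 *: (1 - c^-1 *: 'X + sqrt_iter c m1 ^+ 2) else 0.

Definition sqrt_poly c m := Num.sqrt c *: (1 - sqrt_iter c m).

(** [l] is the fixed point of the iteration; one step multiplies the error [l - u] by [(l + u) / 2],
    which is at most [l] because [u <= l]. *)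
Lemma sqrt_iter_bounds c m (y : R) : 0 < c -> 0 < y -> y ^+ 2 <= c ->
  let l := 1 - y / Num.sqrt c in
  0 <= l - (sqrt_iter c m).[y ^+ 2] <= l ^+ m /\ 0 <= (sqrt_iter c m).[y ^+ 2].
Proof.
move=> c0 y0 yc l; set r := y / Num.sqrt c.
have s0 : 0 < Num.sqrt c by rewrite sqrtr_gt0.
have r2 : r ^+ 2 = y ^+ 2 / c by rewrite expr_div_n sqr_sqrtr // ltW.
have r_gt0 : 0 < r by rewrite divr_gt0.
have r_ge0 := ltW r_gt0.
have r_le1 : r <= 1 by rewrite -(@ler_pXn2r _ 2) ?nnegrE // expr1n r2 ler_pdivrMr // mul1r.
have l01 : 0 <= l < 1 by rewrite /l -/r; lra.
have lE : l = 2^-1 * (1 - c^-1 * y ^+ 2 + l ^+ 2).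
  by rewrite [c^-1 * _]mulrC -r2 /l -/r; field.
elim: m => [|m [IH1 IH2]] /=; first by rewrite horner0 expr0; lra.
set u := (sqrt_iter c m).[y ^+ 2] in IH1 IH2 *.
have -> : (2^-1 *: (1 - c^-1 *: 'X + sqrt_iter c m ^+ 2)).[y ^+ 2] =
    2^-1 * (1 - c^-1 * y ^+ 2 + u ^+ 2).
  by rewrite !hornerE.
have b0 : 0 <= 1 - c^-1 * y ^+ 2.
  by rewrite subr_ge0 mulrC ler_pdivrMr // mul1r.
rewrite {1 2}lE [l ^+ m.+1]exprS; set w := l ^+ m in IH1 *; split; last by nra.
have -> : 2^-1 * (1 - c^-1 * y ^+ 2 + l ^+ 2) - 2^-1 * (1 - c^-1 * y ^+ 2 + u ^+ 2)
  = 2^-1 * (l - u) * (l + u) by ring.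
have /andP[a1 a2] := IH1; have /andP[l0 l1] := l01.
have ul : u <= l by lra.
apply/andP; split; first by rewrite !mulr_ge0 //; lra.
have : 2^-1 * (l - u) * (l + u) <= (l - u) * l by nra.
by move=> /le_trans; apply; rewrite [leRHS]mulrC ler_wpM2r.
Qed.

Lemma sqrt_iter_cvg c (y : R) : 0 < c -> 0 < y -> y ^+ 2 <= c ->
  ((fun m => (sqrt_poly c m).[y ^+ 2]) @ \oo --> y)%classic.
Proof.
move=> c0 y0 yc; set l := 1 - y / Num.sqrt c.
have s0 : 0 < Num.sqrt c by rewrite sqrtr_gt0.
have l01 : 0 <= l < 1.
  have [/andP[h _] _] := sqrt_iter_bounds 0 c0 y0 yc.
  rewrite /= horner0 subr0 -/l in h; rewrite h /l.
  by have := divr_gt0 y0 s0; lra.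
have -> : (fun m => (sqrt_poly c m).[y ^+ 2]) =
    (fun m => Num.sqrt c * (1 - (l - (l - (sqrt_iter c m).[y ^+ 2])))).
  by apply/funext => m; rewrite /sqrt_poly !hornerE; ring.
have {2}-> : y = Num.sqrt c * (1 - (l - 0)) by rewrite /l; field; lra.
apply: cvgMr; apply: cvgB; first exact: cvg_cst.
apply: cvgB; first exact: cvg_cst.
have l_cvg : ((fun m => l ^+ m) @ \oo --> (0 : R))%classic.
  by apply: cvg_expr; rewrite ger0_norm; case/andP: l01.
apply: (squeeze_cvgr _ (cvg_cst 0) l_cvg); apply: nearW => m.
by have [] := sqrt_iter_bounds m c0 y0 yc.
Qed.

Lemma horner_mx_comp k (S : 'M[R]_k.+1) (p q : {poly R}) :
  horner_mx S (p \Po q) = horner_mx (horner_mx S q) p.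
Proof.
elim/poly_ind: p => [|p c IH]; first by rewrite comp_poly0 !rmorph0.
by rewrite comp_polyD comp_polyM comp_polyX comp_polyC !rmorphD !rmorphM /= IH
  horner_mx_X !horner_mx_C.
Qed.

(** The eigenvalues of [A] are the [d l ^+ 2], all at most the trace, so the trace is an admissible
    constant [c]; convergence on the spectrum gives convergence of the entries. This is the source
    of measurability for the root. *)
Lemma sqrtmx_cvg k (A S : 'M[R]_k.+1) i j : posdefmx S -> S *m S = A ->
  ((fun m => horner_mx A (sqrt_poly (\tr A) m) i j) @ \oo --> S i j)%classic.
Proof.
move=> S_pd SS; have [d [al [be [d_gt0 norm1 specE]]]] := real_spectral S_pd.
have A_def : A = horner_mx S ('X ^+ 2) by rewrite rmorphXn /= horner_mx_X expr2 -SS.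
have trA : \tr A = \sum_l d l ^+ 2.
  rewrite /mxtrace A_def; under eq_bigr do rewrite specE.
  rewrite exchange_big /=; apply: eq_bigr => l _.
  rewrite -mulr_suml hornerXn (_ : \sum_i _ = 1) ?mul1r // -(norm1 l).
  by apply: eq_bigr => i' _; rewrite -!expr2.
have d_tr l : d l ^+ 2 <= \tr A.
  by rewrite trA (bigD1 l) //= lerDl sumr_ge0 // => l' _; rewrite sqr_ge0.
have tr_gt0 : 0 < \tr A by apply: lt_le_trans (d_tr ord0); rewrite exprn_gt0.
have -> : S i j = \sum_l (al l i * al l j + be l i * be l j) * d l.
  rewrite -[in LHS](horner_mx_X S) specE; by under eq_bigr do rewrite hornerX.
have -> : (fun m => horner_mx A (sqrt_poly (\tr A) m) i j) =
    (fun m => \sum_l (al l i * al l j + be l i * be l j) * (sqrt_poly (\tr A) m).[d l ^+ 2]).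
  apply/funext => m; rewrite [in X in horner_mx X _]A_def -horner_mx_comp specE.
  by apply: eq_bigr => l _; rewrite horner_comp hornerXn.
apply: cvg_big => [|l _]; last by apply: cvgMr; exact: sqrt_iter_cvg.
exact: add_continuous.
Qed.

Lemma sqrtmx_bound k (A : 'M[R]_k) i j : posdefmx A -> `|sqrtmx A i j| <= Num.sqrt (A i i).
Proof.
move=> /sqrtmxP[[S_sym _] SS]; set S := sqrtmx A in S_sym SS *.
have -> : A i i = \sum_l S i l ^+ 2.
  by rewrite -SS mxE; apply: eq_bigr => l _; rewrite -{2}S_sym mxE expr2.
rewrite -sqrtr_sqr ler_sqrt; last by rewrite sumr_ge0 // => l _; rewrite sqr_ge0.
by rewrite (bigD1 j) //= lerDl sumr_ge0 // => l _; rewrite sqr_ge0.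
Qed.

End SquareRoot.

Section WeightPositive.
Variables (R : realType) (k : nat).
Implicit Types (E : {set {set 'I_k}}) (x : {set 'I_k} -> R).

(** Levels paired with jumps, for a layer-cake decomposition of the entries of [wt]. *)
Fixpoint increments (t0 : R) (s : seq R) : seq (R * R) :=
  if s is t :: s1 then (t, t - t0) :: increments t s1 else [::].

Lemma increments_pos t0 s q : path <%R t0 s -> q \in increments t0 s ->
  [/\ 0 < q.2, t0 < q.1 & q.1 \in s].
Proof.
elim: s t0 => //= t s IH t0 /andP[t0t ps]; rewrite inE => /predU1P[->|/(IH _ ps)].
  by rewrite /= subr_gt0 t0t mem_head.
by move=> [h1 h2 h3]; rewrite h1 (lt_trans t0t) // inE h3 orbT.
Qed.

Lemma increments_sum t0 s y : path <%R t0 s -> y \in t0 :: s ->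
  y - t0 = \sum_(q <- increments t0 s) q.2 * (q.1 <= y)%R%:R.
Proof.
elim: s t0 => [|t s IH] t0 /=; first by rewrite inE big_nil => _ /eqP ->; rewrite subrr.
move=> /andP[t0t ps]; rewrite inE big_cons /= => /predU1P[->|ys].
  rewrite subrr leNgt t0t mulr0 add0r big_seq big1 // => q /(increments_pos ps)[_ tq _].
  by rewrite leNgt (lt_trans t0t tq) mulr0.
rewrite -IH //; suff -> : t <= y by rewrite mulr1; ring.
move: ys; rewrite inE => /predU1P[->//|]; move: ps; rewrite lt_path_sortedE.
by case/andP=> /allP lt_s _ /lt_s /ltW.
Qed.

Lemma sum_fibers_sqr (f : 'I_k -> 'I_k) (v : 'I_k -> R) :
  \sum_i \sum_j v i * v j * (f i == f j)%:R =
  \sum_c (\sum_(i | f i == c) v i) ^+ 2.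
Proof.
transitivity (\sum_i \sum_c \sum_(j | f j == c) (f i == c)%:R * (v i * v j)).
  apply: eq_bigr => i _; rewrite (partition_big f predT) //=; apply: eq_bigr => c _.
  by apply: eq_bigr => j /eqP ->; rewrite mulrC.
rewrite exchange_big /=; apply: eq_bigr => c _; rewrite expr2 mulr_suml.
rewrite [RHS]big_mkcond; apply: eq_bigr => i _; rewrite -mulr_sumr.
case: eqP => _; last by rewrite mul0r.
by rewrite mul1r mulr_sumr.
Qed.

(** [wt] is a positive combination of the 0-1 matrices of the relations [t <= wt E x i j]. These are
    equivalence relations, so each form is a sum of squares over classes. At level 1 the matrix is
    the identity, because all [x e < 1], and this gives strictness. *)
Lemma wt_posdef E x : is_tree E -> (forall e, e \in E -> 0 < x e < 1) ->
  posdefmx (wt E x).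
Proof.
move=> E_tree x01; split=> [|v v0].
  by apply/matrixP => i j; rewrite mxE wt_sym.
pose V := [seq wt E x p.1 p.2 | p <- enum ({: 'I_k * 'I_k})].
have VP i j : wt E x i j \in V.
  by apply/mapP; exists (i, j); rewrite ?mem_enum.
pose s := sort <=%R (undup [seq y <- V | 0 < y]).
have sP y : (y \in s) = (0 < y) && (y \in V) by rewrite mem_sort mem_undup mem_filter.
have ps : path <%R 0 s.
  rewrite lt_path_sortedE sort_lt_sorted undup_uniq andbT.
  by apply/allP => y; rewrite sP => /andP[].
have wt_s i j : wt E x i j \in 0 :: s.
  have /andP[] := wt_itv i j E_tree x01; rewrite le_eqVlt => /predU1P[<- _|lt0 _].
    exact: mem_head.
  by rewrite inE sP lt0 VP orbT.
pose h (t : R) := adj [set e in E | t <= x e].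
have hE q i j : q \in increments 0 s -> (q.1 <= wt E x i j) = (fingraph.root (h q.1) i == fingraph.root (h q.1) j).
  move=> /(increments_pos ps)[_ _]; rewrite sP => /andP[_ /mapP[p _ ->]].
  rewrite le_wt //; last by have /andP[] := wt_itv p.1 p.2 E_tree x01.
  by rewrite root_connect //; exact: connect_adj_sym.
have hS q : q \in increments 0 s -> \sum_i \sum_j v ord0 i * v ord0 j * (q.1 <= wt E x i j)%R%:R =
    \sum_c (\sum_(i | fingraph.root (h q.1) i == c) v ord0 i) ^+ 2.
  move=> qs; rewrite -(sum_fibers_sqr (fingraph.root (h q.1)) (v ord0)); apply: eq_bigr => i _; apply: eq_bigr => j _.
  by rewrite hE.
have -> : (v *m wt E x *m v^T) ord0 ord0 = \sum_(q <- increments 0 s)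
    q.2 * \sum_i \sum_j v ord0 i * v ord0 j * (q.1 <= wt E x i j)%R%:R.
  rewrite quadratic_form; under [RHS]eq_bigr do rewrite mulr_sumr.
  rewrite [RHS]exchange_big /=; apply: eq_bigr => i _.
  under [RHS]eq_bigr do rewrite mulr_sumr.
  rewrite [RHS]exchange_big /=; apply: eq_bigr => j _.
  rewrite -[in LHS](subr0 (wt E x i j)) (increments_sum ps) // mulr_sumr.
  by apply: eq_bigr => q _; rewrite mulrCA.
have term_ge0 q : q \in increments 0 s ->
    0 <= q.2 * \sum_i \sum_j v ord0 i * v ord0 j * (q.1 <= wt E x i j)%R%:R.
  move=> qs; rewrite hS //; have [/ltW q0 _ _] := increments_pos ps qs.
  by rewrite mulr_ge0 // sumr_ge0 // => c _; rewrite sqr_ge0.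
have [i0 vi0] : exists i, v ord0 i != 0.
  by apply/existsP; apply: contraNT v0 => /existsPn vz; apply/eqP/rowP => i; rewrite mxE; apply/eqP; rewrite -[_ == _]negbK vz.
have : 1 \in s by rewrite sP ltr01 -(wt_diag E x i0) VP.
have mem_incr t0 t s' : t \in s' -> exists2 q, q \in increments t0 s' & q.1 = t.
  elim: s' t0 => //= t' s' IH t0; rewrite inE => /predU1P[->|/(IH t')[q qs <-]].
    by exists (t', t' - t0); rewrite ?mem_head.
  by exists q => //; rewrite inE qs orbT.
move=> /(mem_incr 0)[q qs q1]; rewrite (big_rem q) //=; apply: ltr_pwDl; last first.
  by rewrite big_seq sumr_ge0 // => q' /mem_rem; exact: term_ge0.
have [q2 _ _] := increments_pos ps qs; rewrite pmulr_rgt0 // q1.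
have eqE i j : (1 <= wt E x i j) = (i == j).
  have [->|ij] := eqVneq i j; first by rewrite wt_diag lexx.
  rewrite le_wt //; apply/negbTE/negP => /connectP[[|u p] /=].
    by move=> _ ji; rewrite ji eqxx in ij.
  rewrite {1}/adj inE -andbA => /and3P[/x01/andP[_ x1] x2] _ _.
  by have := lt_le_trans x1 x2; rewrite ltxx.
have -> : \sum_i \sum_j v ord0 i * v ord0 j * (1 <= wt E x i j)%R%:R =
    \sum_i v ord0 i ^+ 2.
  apply: eq_bigr => i _; rewrite (bigD1 i) //= eqE eqxx mulr1 big1 ?addr0 ?expr2 // => j ji.
  by rewrite eqE eq_sym (negbTE ji) mulr0.
rewrite (bigD1 i0) //=; apply: ltr_pwDl; first by rewrite exprn_even_gt0.
by rewrite sumr_ge0 // => i _; rewrite sqr_ge0.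
Qed.
End WeightPositive.

(** * The forest formula *)

Section KruskalCount.
Variables (n k N : nat) (ed : 'I_n -> {set 'I_k}) (s t : 'I_n -> 'I_k).
Implicit Types (F : {set 'I_n}) (u y : {ffun 'I_n -> 'I_N.+1}).

(* Ties between equal weights are broken by the index of the edge. *)
Definition key (c : 'I_N.+1) (f : 'I_n) : nat := (c * n + f)%N.

Lemma key_le (c c' : 'I_N.+1) f f' : (key c f < key c' f')%N -> (c <= c')%N.
Proof.
rewrite /key; have := ltn_ord f'; move: (val f) (val f') => a b ltb.
by rewrite leqNgt => h; apply/negP => lt; move: h; rewrite ltnNge; case/negP; nia.
Qed.

Lemma lt_key (c c' : 'I_N.+1) f f' : (c < c')%N -> (key c f < key c' f')%N.
Proof. rewrite /key; have := ltn_ord f; move: (val f) (val f') => a b lta lt; nia. Qed.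

Lemma key_inj u : injective (fun f => key (u f) f).
Proof.
move=> f g; rewrite /key => e; apply: val_inj => /=.
have n_gt0 : (0 < n)%N by apply: leq_ltn_trans (ltn_ord f).
by rewrite -(modn_small (ltn_ord f)) -(modn_small (ltn_ord g)) -(modnMDl (u f)) e modnMDl.
Qed.

Hypothesis edE : forall f, ed f = [set s f; t f].
Hypothesis k_gt0 : (0 < k)%N.
Variable D : {set 'I_n}.
Hypothesis D_conn : connected (ed @: D).

Definition valid_forest F := [&& F \subset D, is_tree (ed @: F) & #|F|.+1 == k].

Lemma valid_forestP F : reflect (F \subset D /\ spanning ed F) (valid_forest F).
Proof.
apply: (iffP and3P) => [[FD /is_treeP[_ Fc _] /eqP cF]|[FD Fs]]; first by split.
have [Ft _] := spanning_tree k_gt0 Fs; split=> //.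
by case: Fs => _ ->.
Qed.

(* The weights of [f] for which Kruskal's algorithm rejects it when [F] has weights [y]. *)
Definition slot F y f (c : 'I_N.+1) :=
  connect (adj (ed @: [set g in F | (key c f < key (y g) g)%N])) (s f) (t f).

Definition supp_on F : {pred {ffun 'I_n -> 'I_N.+1}} :=
  fun y => [forall i, (i \notin F) ==> (y i == ord0)].

Definition trunc_on F u : {ffun 'I_n -> 'I_N.+1} := [ffun i => if i \in F then u i else ord0].

(** Fix the weights [y] on [F]. By [kruskalP] the outcome [F] imposes on each remaining edge of [D]
    a condition on its own weight alone, and the indices outside [D] are free: the fibre is a
    product. *)
Lemma kruskal_card F : valid_forest F ->
  #|[set u : {ffun 'I_n -> 'I_N.+1} | kruskal ed s t (fun f => key (u f) f) D == F]| =
  (\sum_(y | y \in supp_on F) (\prod_(f in D :\: F) #|slot F y f|) * N.+1 ^ (n - #|D|))%N.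
Proof.
move=> /valid_forestP[FD Fs].
rewrite -sum1_card (partition_big (trunc_on F) (fun y => y \in supp_on F)) /=; last first.
  by move=> u _; apply/forallP => i; apply/implyP => iF; rewrite ffunE (negbTE iF).
apply: eq_bigr => y yF; rewrite sum1_card.
pose Q i : pred 'I_N.+1 := fun c =>
  if i \in F then c == y i else if i \in D then slot F y i c else true.
transitivity #|family Q|.
  apply: eq_card => u; apply/andP/familyP.
    move=> [krF /eqP trF] i; move: krF; rewrite in_set => /eqP/esym krF.
    rewrite unfold_in /Q.
    have yE g : g \in F -> y g = u g by move=> gF; rewrite -trF ffunE gF.
    have [iF|iF] := boolP (i \in F).
      by rewrite yE.
    have [iD|//] := boolP (i \in D).
    have [_ /(_ i iD iF) h] := (kruskalP edE k_gt0 (@key_inj u) D_conn FD).2 krF.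
    rewrite /slot (_ : [set g in F | _] = heavier (fun f => key (u f) f) F i) //.
    by apply/setP => g; rewrite !inE; apply: andb_id2l => /yE ->.
  move=> uQ; have yE g : g \in F -> y g = u g.
    by move=> gF; have := uQ g; rewrite /in_mem /= /Q gF => /eqP.
  rewrite in_set; split; last first.
    apply/eqP/ffunP => i; rewrite ffunE; case: ifP => [/yE //|iF].
    by move/forallP: yF => /(_ i); rewrite iF /= => /eqP.
  apply/eqP/esym/(kruskalP edE k_gt0 (@key_inj u) D_conn FD); split=> // f fD fF.
  have := uQ f; rewrite /in_mem /= /Q (negbTE fF) fD /slot.
  rewrite (_ : [set g in F | _] = heavier (fun f => key (u f) f) F f) //.
  by apply/setP => g; rewrite !inE; apply: andb_id2l => /yE ->.
rewrite card_family foldrE big_map big_enum /= (bigID (mem D)) /=; congr (_ * _)%N.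
  rewrite (bigID (mem F)) /= big1 ?mul1n => [|i /andP[_ iF]]; last first.
    by rewrite -(card1 (y i)); apply: eq_card => c; rewrite /in_mem /= /Q iF.
  apply: eq_big => [i|i /andP[iD iF]]; first by rewrite inE andbC.
  by apply: eq_card => c; rewrite /in_mem /= /Q iD (negbTE iF).
rewrite (eq_bigr (fun=> N.+1)) => [|i iD]; last first.
  have iF : i \notin F by apply: contra iD => /(subsetP FD).
  by rewrite -[RHS]card_ord; apply: eq_card => c; rewrite /in_mem /= /Q (negbTE iF) (negbTE iD).
rewrite prod_nat_const; congr (_ ^ _)%N.
by rewrite -[X in (X - _)%N]card_ord -(cardC (mem D)) addKn; apply: eq_card => i; rewrite !inE.
Qed.

Lemma kruskal_count :
  (\sum_(F | valid_forest F) \sum_(y | y \in supp_on F)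
     (\prod_(f in D :\: F) #|slot F y f|) * N.+1 ^ (n - #|D|) = N.+1 ^ n)%N.
Proof.
transitivity #|{: {ffun 'I_n -> 'I_N.+1}}|; last by rewrite card_ffun !card_ord.
rewrite -[RHS]sum1_card [RHS](partition_big (fun u : {ffun 'I_n -> 'I_N.+1} => kruskal ed s t (fun f => key (u f) f) D) valid_forest) /=.
  apply: eq_bigr => F FV; rewrite -kruskal_card // sum1_card.
  by apply: eq_card => u; rewrite !inE.
move=> u _; apply/valid_forestP; split; last first.
  by apply: kruskal_spanning => //; exact: key_inj.
by apply/subsetP => f; rewrite inE => /andP[].
Qed.

End KruskalCount.

Section SlotBound.
Variable R : realType.

Lemma prod_dist (I : Type) (r : seq I) (P : pred I) (a b : I -> R) :
  (forall i, P i -> 0 <= a i <= 1) -> (forall i, P i -> 0 <= b i <= 1) ->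
  `|\prod_(i <- r | P i) a i - \prod_(i <- r | P i) b i| <= \sum_(i <- r | P i) `|a i - b i|.
Proof.
move=> a01 b01.
suff [] : [/\ `|\prod_(i <- r | P i) a i - \prod_(i <- r | P i) b i|
      <= \sum_(i <- r | P i) `|a i - b i|,
    0 <= \prod_(i <- r | P i) a i <= 1 & 0 <= \prod_(i <- r | P i) b i <= 1] by [].
elim: r => [|i r [IH A B]]; first by split; rewrite !big_nil ?subrr ?normr0 ?ler01 ?lexx.
rewrite !big_cons; case: ifP => // Pi.
have /andP[ha1 ha2] := a01 i Pi; have /andP[hb1 hb2] := b01 i Pi.
move: IH A B; set u := \prod_(_ <- _ | _) a _; set v := \prod_(_ <- _ | _) b _.
move=> IH /andP[u0 u1] /andP[v0 v1]; split; last 2 first.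
- by rewrite mulr_ge0 //= mulr_ile1.
- by rewrite mulr_ge0 //= mulr_ile1.
have -> : a i * u - b i * v = (a i - b i) * u + b i * (u - v) by ring.
apply: le_trans (ler_normD _ _) _; rewrite !normrM (ger0_norm u0) (ger0_norm hb1).
apply: lerD; first by rewrite ler_piMr.
by apply: le_trans IH; rewrite ler_piMl.
Qed.

Variables (n k N : nat) (ed : 'I_n -> {set 'I_k}) (s t : 'I_n -> 'I_k).
Hypothesis edE : forall f, ed f = [set s f; t f].

(** With W the entry of [wt], a level c in the slot satisfies c <= (N + 1) W, and c + 1 <= (N + 1) W
    suffices: rounding the weights of [F] down and breaking ties costs at most one level. If T is
    the integer part of (N + 1) W, the slot has T or T + 1 elements. *)
Lemma slot_bound (F : {set 'I_n}) (x : {set 'I_k} -> R) (y : {ffun 'I_n -> 'I_N.+1}) f :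
  is_tree (ed @: F) -> (forall e, e \in ed @: F -> 0 < x e < 1) ->
  (forall g, g \in F -> (y g)%:R <= N.+1%:R * x (ed g) < (y g).+1%:R) ->
  `|#|slot ed s t F y f|%:R / N.+1%:R - wt (ed @: F) x (s f) (t f)| <= N.+1%:R^-1.
Proof.
move=> E_tree x01 yE; set E := ed @: F in E_tree x01 *; set W := wt _ _ _ _.
have /andP[W0 W1] : 0 <= W <= 1 by apply: wt_itv.
have N0 : 0 < N.+1%:R :> R by rewrite ltr0Sn.
have up c : c \in slot ed s t F y f -> c%:R <= N.+1%:R * W.
  move=> c_slot; rewrite mulrC -ler_pdivrMr // le_wt //; last first.
    by rewrite ler_pdivrMr // mul1r ler_nat ltnW.
  move: c_slot; rewrite /in_mem /=; apply: connect_adjS.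
  apply/subsetP => e /imsetP[g gS ->]; rewrite in_set in gS; case/andP: gS => gF /key_le le_c.
  rewrite in_set; apply/andP; split; first exact: imset_f.
  rewrite ler_pdivrMr // mulrC; have /andP[le_y _] := yE g gF.
  by apply: le_trans le_y; rewrite ler_nat.
have lo (c : 'I_N.+1) : c.+1%:R <= N.+1%:R * W -> c \in slot ed s t F y f.
  move=> c_W; have : c.+1%:R / N.+1%:R <= W by rewrite ler_pdivrMr // mulrC.
  rewrite le_wt //; last first.
    by rewrite ler_pdivrMr // mul1r ler_nat.
  rewrite /in_mem /=; apply: connect_adjS; apply/subsetP => e eS.
  rewrite in_set in eS; case/andP: eS => /imsetP[g gF ->].
  rewrite ler_pdivrMr // mulrC => le_x.
  rewrite imset_f // in_set gF; apply: lt_key.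
  have /andP[_ lt_y] := yE g gF; rewrite -ltnS.
  by have := le_lt_trans le_x lt_y; rewrite ltr_nat.
set M := #|_|; pose T := Num.truncn (N.+1%:R * W).
have NW0 : 0 <= N.+1%:R * W by rewrite mulr_ge0 // ltW.
have /andP[T1 T2] : T%:R <= N.+1%:R * W < T.+1%:R by apply: truncn_itv.
have TN : (T <= N.+1)%N.
  by rewrite -(ler_nat R) (le_trans T1) // ler_piMr // ltW.
have M_lo : (T <= M)%N.
  rewrite -[T]card_ord -[X in (X <= _)%N](card_image (f := widen_ord TN)).
    apply: subset_leq_card; apply/subsetP => _ /imageP[c _ ->]; apply: lo => /=.
    by apply: le_trans T1; rewrite ler_nat.
  by move=> a b /(congr1 val) /= h; exact: val_inj.
have M_up : (M <= T.+1)%N.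
  have : {subset slot ed s t F y f <= [pred c : 'I_N.+1 | (c < T.+1)%N]}.
    by move=> c c_slot; rewrite inE -(ltr_nat R) (le_lt_trans (up c c_slot)).
  move=> /subsetP/subset_leq_card /leq_trans; apply.
  rewrite cardE -(size_map val) -{2}(size_iota 0 T.+1); apply: uniq_leq_size.
    by rewrite map_inj_uniq ?enum_uniq //; exact: val_inj.
  by move=> i /mapP[c + ->]; rewrite mem_enum inE mem_iota.
rewrite -(ler_pM2l N0) mulfV ?gt_eqF // -{1}(ger0_norm (ltW N0)) -normrM.
rewrite mulrBr mulrCA mulfV ?gt_eqF // mulr1.
have M1 : T%:R <= M%:R :> R by rewrite ler_nat.
have M2 : M%:R <= T%:R + 1 :> R by rewrite natr1 ler_nat.
have T2' : N.+1%:R * W < T%:R + 1 by rewrite natr1.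
by rewrite ler_norml; apply/andP; split; lra.
Qed.

Lemma slot_itv (F : {set 'I_n}) (y : {ffun 'I_n -> 'I_N.+1}) f :
  0 <= (#|slot ed s t F y f|%:R / N.+1%:R : R) <= 1.
Proof.
rewrite divr_ge0 ?ler0n //= ler_pdivrMr ?ltr0Sn // mul1r ler_nat.
by rewrite -[leqRHS]card_ord max_card.
Qed.

End SlotBound.

(** * Uniform edge weights and their discretization *)

Section UniformEdges.
Context (R : realType) (d : measure_display) (Omega : measurableType d).
Variable P : probability Omega R.
Local Notation mu := (@lebesgue_measure R).

Lemma uniform_prob_itv (a b : R) : 0 <= a -> a < b -> b <= 1 ->
  uniform_prob (@ltr01 R) `[a, b[%classic = (b - a)%:E.
Proof.
move=> a0 ab b1; rewrite /uniform_prob (eq_integral (fun=> 1%E)).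
  by rewrite integral_cst //= mul1e lebesgue_measure_itv /= lte_fin ab.
move=> x /set_mem; rewrite /= in_itv /= => /andP[ax xb]; rewrite /uniform_pdf.
by rewrite (le_trans a0 ax) (ltW (lt_le_trans xb b1)) subr0 invr1.
Qed.

Lemma uniform_prob_open : uniform_prob (@ltr01 R) `]0, 1[%classic = 1%E.
Proof.
rewrite /uniform_prob (eq_integral (fun=> 1%E)).
  by rewrite integral_cst //= mul1e lebesgue_measure_itv /= lte_fin ltr01 oppr0 adde0.
move=> x /set_mem; rewrite /= in_itv /= => /andP[x0 x1]; rewrite /uniform_pdf.
by rewrite (ltW x0) (ltW x1) subr0 invr1.
Qed.

Variables (k : nat) (E : {set {set 'I_k}}) (x : {set 'I_k} -> {RV P >-> R}).
Hypothesis E_tree : is_tree E.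
Hypothesis x_iid : iid_uniform E x.

Lemma bigcap_preimage_measurable (B : {set 'I_k} -> set R) :
  (forall e, e \in E -> measurable (B e)) ->
  measurable (\bigcap_(e in [set` E]) (x e @^-1` B e))%classic.
Proof.
move=> mB; apply: fin_bigcap_measurable => // e eE.
by apply: measurable_funPTI; exact: mB.
Qed.

Lemma prob_edges (B : {set 'I_k} -> set R) : (forall e, e \in E -> measurable (B e)) ->
  P (\bigcap_(e in [set` E]) (x e @^-1` B e))%classic =
  (\prod_(e in E) uniform_prob (@ltr01 R) (B e))%E.
Proof.
move=> mB; have [ind unif] := x_iid; rewrite ind //.
by apply: eq_bigr => e eE; rewrite -(unif e eE) //; exact: mB.
Qed.

(** The almost sure event on which [wt] is known to be positive definite with entries in [0, 1];
    random quantities are multiplied by its indicator to be bounded everywhere. *)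
Definition good_event : set Omega :=
  (\bigcap_(e in [set` E]) (x e @^-1` `]0%R, 1%R[))%classic.

Lemma good_eventP w : good_event w -> forall e, e \in E -> 0 < x e w < 1.
Proof. by move=> Gw e eE; have := Gw e eE; rewrite /= in_itv. Qed.

Lemma measurable_good_event : measurable good_event.
Proof. exact: bigcap_preimage_measurable. Qed.

Lemma prob_good_event : P good_event = 1%E.
Proof.
rewrite prob_edges // big1 // => e _; exact: uniform_prob_open.
Qed.

Lemma measurable_bigmin (T : Type) (r : seq T) (f : T -> Omega -> R) (g : Omega -> R) :
  measurable_fun [set: Omega]%classic g -> (forall i, measurable_fun [set: Omega]%classic (f i)) ->
  measurable_fun [set: Omega]%classic (fun w => \big[Num.min/g w]_(i <- r) f i w).
Proof.
move=> mg mf; elim: r => [|i r IH].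
  suff -> : (fun w => \big[Num.min/g w]_(i <- [::]) f i w) = g by [].
  by apply/funext => w; rewrite big_nil.
suff -> : (fun w => \big[Num.min/g w]_(j <- i :: r) f j w) =
  (f i \min (fun w => \big[Num.min/g w]_(j <- r) f j w)) by exact: measurable_minr.
by apply/funext => w; rewrite big_cons.
Qed.

Lemma measurable_wt i j : measurable_fun [set: Omega]%classic (fun w => wt E (fun e => x e w) i j).
Proof.
have [->|ij] := eqVneq i j.
  suff -> : (fun w => wt E (fun e => x e w) j j) = cst 1 by exact: measurable_cst.
  by apply/funext => w; rewrite wt_diag.
suff -> : (fun w => wt E (fun e => x e w) i j) = (fun w =>
   \big[Num.min/x (head finset.set0 (path_edges E i j)) w]_(e <- path_edges E i j) x e w).
  by apply: measurable_bigmin => [|e]; exact: measurable_funP.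
by apply/funext => w; rewrite mxE (negbTE ij).
Qed.

Lemma bounded_wt i j :
  bounded_rv (fun w => wt E (fun e => x e w) i j * \1_good_event w).
Proof.
split.
  apply: measurable_funM; first exact: measurable_wt.
  exact/measurable_indic/measurable_good_event.
exists 1 => w; rewrite indicE; have [/set_mem wG|_] := boolP (w \in good_event).
  rewrite mulr1 ger0_norm; have /andP[] := wt_itv i j E_tree (good_eventP wG); by [].
by rewrite mulr0 normr0.
Qed.

Variables (n N : nat) (ed : 'I_n -> {set 'I_k}) (s t : 'I_n -> 'I_k).
Hypothesis edE : forall f, ed f = [set s f; t f].
Variables (D F : {set 'I_n}).
Hypothesis E_def : E = ed @: F.
Hypothesis ed_inj : {in F &, injective ed}.
Implicit Types (y : {ffun 'I_n -> 'I_N.+1}).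

Definition cell (c : 'I_N.+1) : set R :=
  `[(c%:R / N.+1%:R)%R, (c.+1%:R / N.+1%:R)%R[%classic.

Lemma cellP c r : cell c r <-> c%:R <= N.+1%:R * r < c.+1%:R.
Proof.
have N0 : 0 < N.+1%:R :> R by rewrite ltr0Sn.
by rewrite /cell /= in_itv /= ler_pdivrMr // ltr_pdivlMr // [r * _]mulrC.
Qed.

Definition cell_event y : set Omega :=
  (\bigcap_(e in [set` E]) (x e @^-1`
     cell (oapp y ord0 [pick f in F | ed f == e])))%classic.

Lemma pick_edge y f : f \in F -> oapp y ord0 [pick g in F | ed g == ed f] = y f.
Proof.
move=> fF; case: pickP => [g /andP[gF /eqP gf] /=|/(_ f)].
  by rewrite (ed_inj gF fF gf).
by rewrite fF eqxx.
Qed.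

Lemma measurable_cell_event y : measurable (cell_event y).
Proof. by apply: bigcap_preimage_measurable => e _; exact: measurable_itv. Qed.

Lemma prob_cell_event y : P (cell_event y) = (N.+1%:R^-1 ^+ #|F|)%:E.
Proof.
rewrite prob_edges => [|e _]; last exact: measurable_itv.
have N0 : 0 < N.+1%:R :> R by rewrite ltr0Sn.
rewrite (eq_bigr (fun=> (N.+1%:R^-1)%:E)) => [|e _].
  rewrite prodEFin prodr_const; congr ((_ ^+ _)%:E).
  by rewrite E_def card_in_imset.
rewrite /cell uniform_prob_itv.
- by rewrite -mulrBl -natr1 addrC addKr mul1r.
- by rewrite divr_ge0.
- by rewrite ltr_pM2r ?invr_gt0 // ltr_nat.
- by rewrite ler_pdivrMr // mul1r ler_nat.
Qed.

Definition discretize (w : Omega) : {ffun 'I_n -> 'I_N.+1} :=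
  [ffun f => if f \in F then inord (Num.truncn (N.+1%:R * x (ed f) w)) else ord0].

Lemma discretizeP w f : good_event w -> f \in F ->
  (discretize w f)%:R <= N.+1%:R * x (ed f) w < (discretize w f).+1%:R.
Proof.
move=> wG fF; have /andP[x0 x1] : 0 < x (ed f) w < 1.
  by apply: good_eventP => //; rewrite E_def imset_f.
rewrite ffunE fF inordK.
  by apply: truncn_itv; rewrite mulr_ge0 // ltW.
rewrite truncn_lt_nat ?mulr_ge0 ?(ltW x0) //.
by rewrite gtr_pMr ?ltr0Sn.
Qed.

Lemma cell_eventE w y : good_event w -> y \in supp_on F ->
  (w \in cell_event y) = (y == discretize w).
Proof.
move=> wG yF; have N0 : 0 < N.+1%:R :> R by rewrite ltr0Sn.
apply/idP/eqP => [/set_mem wy|->].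
  apply/ffunP => f; have [fF|fF] := boolP (f \in F); last first.
    by rewrite ffunE (negbTE fF); move/forallP: yF => /(_ f); rewrite fF => /eqP.
  have edE' : ed f \in E by rewrite E_def imset_f.
  have := wy (ed f) edE'; rewrite /preimage /= pick_edge // => /cellP h.
  have /andP[h1 h2] := discretizeP wG fF.
  have /andP[h3 h4] := h.
  have le_nat a b : a%:R < b.+1%:R :> R -> (a <= b)%N by rewrite ltr_nat ltnS.
  apply/val_inj/eqP; rewrite eqn_leq.
  by rewrite !le_nat ?(le_lt_trans h3 h2) ?(le_lt_trans h1 h4).
apply/mem_set => e; rewrite /= E_def => /imsetP[f fF ->].
by rewrite /preimage /= pick_edge //; apply/cellP; exact: discretizeP.
Qed.

(** Each cell has probability (N + 1)^-#|F|, so the sum is the mean of the step function obtained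
    from the slots of the discretized weights. Each of the at most n factors is within 1 / (N + 1)
    of its limit by [slot_bound]. *)
Lemma mean_prod_wt : F \subset D ->
  `|mean P (fun w => \prod_(f in D :\: F) wt E (fun e => x e w) (s f) (t f)) -
    \sum_(y : {ffun 'I_n -> 'I_N.+1} | y \in supp_on F) (\prod_(f in D :\: F) (#|slot ed s t F y f|%:R / N.+1%:R))
       * N.+1%:R^-1 ^+ #|F| | <= n%:R / N.+1%:R.
Proof.
move=> FD; pose g (y : {ffun 'I_n -> 'I_N.+1}) : R := \prod_(f in D :\: F) (#|slot ed s t F y f|%:R / N.+1%:R).
have mG := measurable_good_event; have PG := prob_good_event.
have b1G : bounded_rv (\1_good_event : Omega -> R) by exact: bounded_rv_indic.
pose h w : R := \sum_(y : {ffun 'I_n -> 'I_N.+1} | y \in supp_on F) g y * \1_(cell_event y) w.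
have bh : bounded_rv h.
  by apply: bounded_rv_sum => y _; apply/bounded_rvZ/bounded_rv_indic/measurable_cell_event.
have hE w : good_event w -> h w = g (discretize w).
  move=> wG; rewrite /h (bigD1 (discretize w)) /=; last first.
    by apply/forallP => f; apply/implyP => fF; rewrite ffunE (negbTE fF).
  rewrite big1 ?addr0 => [|y /andP[yF ne]]; last first.
    by rewrite indicE cell_eventE // (negbTE ne) mulr0.
  rewrite indicE cell_eventE ?eqxx ?mulr1 //.
  by apply/forallP => f; apply/implyP => fF; rewrite ffunE (negbTE fF).
have -> : \sum_(y : {ffun 'I_n -> 'I_N.+1} | y \in supp_on F) g y * N.+1%:R^-1 ^+ #|F| =
    mean P (fun w => h w * \1_good_event w).
  rewrite (mean_eq_on (g := h) mG PG) => [|w wG]; last by rewrite indicE mem_set // mulr1.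
  rewrite mean_sum => [|y _]; last first.
    exact/bounded_rvZ/bounded_rv_indic/measurable_cell_event.
  apply: eq_bigr => y _; rewrite meanZ; last exact/bounded_rv_indic/measurable_cell_event.
  by rewrite mean_indic ?prob_cell_event //; exact: measurable_cell_event.
pose W w : R := \prod_(f in D :\: F) (wt E (fun e => x e w) (s f) (t f) * \1_good_event w).
have bW : bounded_rv (fun w => W w * \1_good_event w).
  by apply: bounded_rvM => //; apply: bounded_rv_prod => f _; exact: bounded_wt.
rewrite (mean_eq_on (g := fun w => W w * \1_good_event w) mG PG) => [|w wG]; last first.
  rewrite indicE mem_set // mulr1; apply: eq_bigr => f _.
  by rewrite indicE mem_set // mulr1.
apply: mean_dist => // [|w]; first exact: bounded_rvM.
rewrite indicE; have [/set_mem wG|_] := boolP (w \in good_event); last first.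
  by rewrite !mulr0 subrr normr0 divr_ge0.
rewrite !mulr1 hE // /W /g.
have wt01 f : 0 <= wt E (fun e => x e w) (s f) (t f) <= 1.
  by apply: wt_itv => //; exact: good_eventP.
have a_wt f : wt E (fun e => x e w) (s f) (t f) * \1_good_event w =
    wt E (fun e => x e w) (s f) (t f) by rewrite indicE mem_set // mulr1.
apply: le_trans (prod_dist _ _ _) _ => [f _|f _|]; [by rewrite /= a_wt|exact: slot_itv|].
apply: (@le_trans _ _ (\sum_(f in D :\: F) N.+1%:R^-1)).
  apply: ler_sum => f _; rewrite /= a_wt distrC E_def; apply: slot_bound => //.
  - by rewrite -E_def.
  - by rewrite -E_def; exact: good_eventP.
  - by move=> f'; exact: discretizeP.
rewrite sumr_const -[leLHS]mulr_natl ler_pM2r ?invr_gt0 // ler_nat.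
by rewrite -[leqRHS]card_ord max_card.
Qed.

End UniformEdges.

Section ForestFormula.
Context (R : realType) (d : measure_display) (Omega : measurableType d).
Variable P : probability Omega R.
Variables (n k : nat) (x : {set {set 'I_k}} -> {set 'I_k} -> {RV P >-> R}).
Hypothesis x_iid : forall E : {set {set 'I_k}}, is_tree E -> iid_uniform E (x E).
Variables (ed : 'I_n -> {set 'I_k}) (s t : 'I_n -> 'I_k).
Hypothesis edE : forall f, ed f = [set s f; t f].
Hypothesis k_gt0 : (0 < k)%N.
Variable D : {set 'I_n}.
Hypothesis D_conn : connected (ed @: D).

Lemma kruskal_prob N :
  \sum_(F | valid_forest ed D F)
    \sum_(y : {ffun 'I_n -> 'I_N.+1} | y \in supp_on F)
      (\prod_(f in D :\: F) (#|slot ed s t F y f|%:R / N.+1%:R)) * N.+1%:R^-1 ^+ #|F| = 1 :> R.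
Proof.
have M0 : N.+1%:R != 0 :> R by rewrite pnatr_eq0.
have := congr1 (fun m : nat => m%:R / (N.+1 ^ n)%:R : R) (kruskal_count N edE k_gt0 D_conn).
rewrite divff ?pnatr_eq0 -?lt0n ?expn_gt0 //; apply: etrans.
rewrite natr_sum mulr_suml; apply: eq_bigr => F /and3P[FD _ _].
rewrite natr_sum mulr_suml; apply: eq_bigr => y _.
rewrite big_split /= prodr_const natrM natr_prod -!mulrA; congr (_ * _).
rewrite -exprD cardsD (setIidPr FD) subnK ?subset_leq_card //.
have Dn : (#|D| <= n)%N by rewrite -[leqRHS]card_ord max_card.
rewrite !natrX exprVn; apply: (canRL (mulfK _)); first by rewrite expf_neq0.
rewrite -[X in _ * _ ^+ X = _](subnK Dn) exprD mulrCA mulVf ?mulr1 //; exact: expf_neq0.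
Qed.

(* Up to O(1/N), the summands are the probabilities that Kruskal's algorithm returns [F]
   when the edges carry independent uniform weights on a grid of mesh 1/N. *)
Lemma forest_formula :
  \sum_(F | valid_forest ed D F)
    mean P (fun w => \prod_(f in D :\: F)
      wt (ed @: F) (fun e => x (ed @: F) e w) (s f) (t f)) = 1.
Proof.
set S := (X in X = _).
(* At most #|{set 'I_n}| forests, each with an error of at most n / (N + 1). *)
pose c : R := (#|{: {set 'I_n}}| * n)%:R.
have bound N : `|S - 1| <= c / N.+1%:R.
  rewrite -[X in _ - X](kruskal_prob N) -sumrB; apply: le_trans (ler_norm_sum _ _ _) _.
  apply: (@le_trans _ _ (\sum_(F : {set 'I_n} | valid_forest ed D F) n%:R / N.+1%:R)).
    apply: ler_sum => F FV; have [FD F_sp] := valid_forestP ed k_gt0 D F FV.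
    have [F_tree ed_inj] := spanning_tree k_gt0 F_sp.
    exact: (mean_prod_wt F_tree (x_iid F_tree) N s t erefl ed_inj FD).
  rewrite sumr_const -[leLHS]mulr_natl /c natrM -mulrA.
  by apply: ler_wpM2r; [exact: divr_ge0|rewrite ler_nat max_card].
(* [S] does not depend on [N], so a nonzero difference contradicts the bound for large [N]. *)
apply/eqP; rewrite -subr_eq0 -normr_eq0; apply/negPn/negP => S1.
have e0 : 0 < `|S - 1| by rewrite lt_def S1 normr_ge0.
have := bound (Num.truncn (c / `|S - 1|)); apply/negP; rewrite -ltNge.
by rewrite ltr_pdivrMr ?ltr0Sn // mulrC -ltr_pdivrMr // truncnS_gt.
Qed.

End ForestFormula.

(** * Exchanging the trace and the expectation *)

Section NCExpectation.
Context (R : realType) (d : measure_display) (Omega : measurableType d).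
Variables (P : probability Omega R) (I : choiceType).
Local Notation ncp := (ncpoly R[i] I).
Implicit Types (W : Omega -> ncp) (f g : Omega -> R[i]).

Definition bounded_crv f :=
  bounded_rv (fun w => complex.Re (f w)) /\ bounded_rv (fun w => complex.Im (f w)).

Lemma cexpectationE f :
  cexpectation P f = Complex (mean P (fun w => complex.Re (f w))) (mean P (fun w => complex.Im (f w))).
Proof. by []. Qed.

Lemma cexpectationD f g : bounded_crv f -> bounded_crv g ->
  cexpectation P (fun w => f w + g w) = cexpectation P f + cexpectation P g.
Proof.
move=> [bf bf'] [bg bg']; rewrite !cexpectationE.
have -> : (fun w => complex.Re (f w + g w)) = (fun w => complex.Re (f w) + complex.Re (g w)).
  by apply/funext => w; case: (f w) (g w) => [? ?] [? ?].
have -> : (fun w => complex.Im (f w + g w)) = (fun w => complex.Im (f w) + complex.Im (g w)).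
  by apply/funext => w; case: (f w) (g w) => [? ?] [? ?].
by rewrite !meanD.
Qed.

Lemma bounded_crvD f g : bounded_crv f -> bounded_crv g -> bounded_crv (fun w => f w + g w).
Proof.
move=> [bf bf'] [bg bg']; split.
  rewrite (_ : (fun w => _) = (fun w => complex.Re (f w) + complex.Re (g w))); first exact: bounded_rvD.
  by apply/funext => w; case: (f w) (g w) => [? ?] [? ?].
rewrite (_ : (fun w => _) = (fun w => complex.Im (f w) + complex.Im (g w))); first exact: bounded_rvD.
by apply/funext => w; case: (f w) (g w) => [? ?] [? ?].
Qed.

Lemma scale_crv (c : Omega -> R) (a : R[i]) : bounded_rv c ->
  bounded_crv (fun w => (c w)%:C%C * a) /\
  cexpectation P (fun w => (c w)%:C%C * a) = (mean P c)%:C%C * a.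
Proof.
move=> bc; case: a => a b; rewrite /bounded_crv cexpectationE.
have -> : (fun w => complex.Re ((c w)%:C%C * Complex a b)) = (fun w => a * c w).
  by apply/funext => w /=; rewrite mul0r subr0 mulrC.
have -> : (fun w => complex.Im ((c w)%:C%C * Complex a b)) = (fun w => b * c w).
  by apply/funext => w /=; rewrite mul0r addr0 mulrC.
split; first by split; exact: bounded_rvZ.
by rewrite !meanZ //; simpc; rewrite ![mean P c * _]mulrC.
Qed.

Lemma cexpectation_eq_on f g G : measurable G -> P G = 1%E ->
  (forall w, G w -> f w = g w) -> cexpectation P f = cexpectation P g.
Proof.
by move=> mG PG fg; rewrite !cexpectationE; congr Complex;
  apply: (mean_eq_on mG PG) => w Gw; rewrite fg.
Qed.

(** Random polynomials with values in a fixed finite-dimensional space and bounded coordinates: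
    their coefficientwise expectation is again a polynomial. *)
Inductive simple_ncrv : (Omega -> ncp) -> Prop :=
| simple_scale c q : bounded_rv c -> simple_ncrv (fun w => (c w)%:C%C *: q)
| simple_add W W' : simple_ncrv W -> simple_ncrv W' -> simple_ncrv (fun w => W w + W' w).

Lemma simple_cst q : simple_ncrv (fun=> q).
Proof.
rewrite (_ : (fun=> q) = (fun w : Omega => (1 : R)%:C%C *: q)).
  by apply: simple_scale; exact: bounded_rv_cst.
by apply/funext => w; rewrite scale1r.
Qed.

Lemma simple_sum (J : Type) (r : seq J) (Q : pred J) (W : J -> Omega -> ncp) :
  (forall j, Q j -> simple_ncrv (W j)) -> simple_ncrv (fun w => \sum_(j <- r | Q j) W j w).
Proof.
move=> sW; elim: r => [|j r IH].
  by rewrite (_ : (fun w => _) = (fun=> 0)); [exact: simple_cst|apply/funext => w; rewrite big_nil].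
case: (boolP (Q j)) => Qj.
  rewrite (_ : (fun w => _) = (fun w => W j w + \sum_(j <- r | Q j) W j w)).
    by apply: simple_add => //; exact: sW.
  by apply/funext => w; rewrite big_cons Qj.
by rewrite (_ : (fun w => _) = (fun w => \sum_(j <- r | Q j) W j w)) //;
  apply/funext => w; rewrite big_cons (negbTE Qj).
Qed.

Lemma simple_mul W W' : simple_ncrv W -> simple_ncrv W' -> simple_ncrv (fun w => W w * W' w).
Proof.
move=> sW; elim: sW W' => {W} [c q bc|W1 W2 _ IH1 _ IH2] W' sW'.
  elim: sW' => {W'} [c' q' bc'|W1 W2 _ IH1 _ IH2].
    rewrite (_ : (fun w => _) = (fun w => (c w * c' w)%:C%C *: (q * q'))).
      by apply: simple_scale; exact: bounded_rvM.
    by apply/funext => w; rewrite rmorphM -ncpoly_scalerAr -scalerAl scalerA mulrC.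
  rewrite (_ : (fun w => _) = (fun w => ((c w)%:C%C *: q) * W1 w + ((c w)%:C%C *: q) * W2 w)).
    exact: simple_add.
  by apply/funext => w; rewrite mulrDr.
rewrite (_ : (fun w => _) = (fun w => W1 w * W' w + W2 w * W' w)).
  by apply: simple_add; [exact: IH1|exact: IH2].
by apply/funext => w; rewrite mulrDl.
Qed.

Lemma simple_prod (J : Type) (r : seq J) (W : J -> Omega -> ncp) :
  (forall j, simple_ncrv (W j)) -> simple_ncrv (fun w => \prod_(j <- r) W j w).
Proof.
move=> sW; elim: r => [|j r IH].
  by rewrite (_ : (fun w => _) = (fun=> 1)); [exact: simple_cst|apply/funext => w; rewrite big_nil].
rewrite (_ : (fun w => _) = (fun w => W j w * \prod_(j <- r) W j w)).
  by apply: simple_mul => //; exact: sW.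
by apply/funext => w; rewrite big_cons.
Qed.

Lemma simple_expectation W : simple_ncrv W -> exists Q : ncp, forall l : ncp -> R[i],
  (forall p q, l (p + q) = l p + l q) -> (forall c p, l (c *: p) = c * l p) ->
  bounded_crv (fun w => l (W w)) /\ l Q = cexpectation P (fun w => l (W w)).
Proof.
elim=> {W} [c q bc|W W' _ [Q HQ] _ [Q' HQ']].
  exists ((mean P c)%:C%C *: q) => l lD lZ.
  have -> : (fun w => l ((c w)%:C%C *: q)) = (fun w => (c w)%:C%C * l q).
    by apply/funext => w; rewrite lZ.
  by have [b ->] := scale_crv (l q) bc; rewrite lZ.
exists (Q + Q') => l lD lZ; have [b e] := HQ l lD lZ; have [b' e'] := HQ' l lD lZ.
have -> : (fun w => l (W w + W' w)) = (fun w => l (W w) + l (W' w)).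
  by apply/funext => w; rewrite lD.
by rewrite lD e e' -cexpectationD //; split=> //; exact: bounded_crvD.
Qed.

Lemma linear_ncexpectation W V G (l : ncp -> R[i]) :
  (forall p q, l (p + q) = l p + l q) -> (forall c p, l (c *: p) = c * l p) ->
  measurable G -> P G = 1%E -> simple_ncrv W -> (forall w, G w -> V w = W w) ->
  l (ncexpectation P V) = cexpectation P (fun w => l (V w)).
Proof.
move=> lD lZ mG PG /simple_expectation[Q HQ] VW.
have VWE (h : ncp -> R[i]) : cexpectation P (fun w => h (V w)) = cexpectation P (fun w => h (W w)).
  by apply: (cexpectation_eq_on mG PG) => w Gw; rewrite VW.
have HQm m : mcoeff m Q = cexpectation P (fun w => mcoeff m (V w)).
  rewrite VWE; apply: (HQ (mcoeff m) _ _).2 => [p q|c p]; [exact: mcoeffD|exact: mcoeffZ].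
have -> : ncexpectation P V = Q.
  rewrite /ncexpectation; case: xgetP => [Q' _ /= hQ'|/(_ Q)/= []//].
  by apply/malgP => m; rewrite hQ' HQm.
by rewrite VWE; exact: (HQ l lD lZ).2.
Qed.

End NCExpectation.

Section SqrtWt.
Context (R : realType) (d : measure_display) (Omega : measurableType d).
Variable P : probability Omega R.

Lemma measurable_horner_mx k (A : Omega -> 'M[R]_k.+1) (p : {poly R}) :
  (forall i j, measurable_fun [set: Omega]%classic (fun w => A w i j)) ->
  forall i j, measurable_fun [set: Omega]%classic (fun w => horner_mx (A w) p i j).
Proof.
move=> mA; elim/poly_ind: p => [|p c IH] i j.
  rewrite (_ : (fun w => _) = (fun=> 0)); first exact: measurable_cst.
  by apply/funext => w; rewrite rmorph0 mxE.
rewrite (_ : (fun w => _) =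
    (fun w => \sum_l horner_mx (A w) p i l * A w l j + (c *+ (i == j)))).
  apply: measurable_funD; last exact: measurable_cst.
  by apply: measurable_sum => l; exact: measurable_funM.
by apply/funext => w; rewrite rmorphD rmorphM /= horner_mx_X horner_mx_C !mxE.
Qed.

(** A limit of polynomials in [wt]: the constant in [sqrt_poly] is the trace of [wt], which equals
    the size of the matrix at every sample point. The bound 1 holds since the rows of the root have
    norm 1. *)
Lemma bounded_sqrt_wt k (E : {set {set 'I_k}}) (x : {set 'I_k} -> {RV P >-> R}) i j :
  is_tree E -> iid_uniform E x ->
  bounded_rv (fun w => sqrtmx (wt E (fun e => x e w)) i j * \1_(good_event E x) w).
Proof.
case: k E x i j => [|k] E x i j E_tree x_iid; first by case: i.
have mG := measurable_good_event E x.
have pd w : good_event E x w -> posdefmx (wt E (fun e => x e w)).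
  by move=> wG; apply: wt_posdef => //; exact: good_eventP.
split.
  apply: (measurable_fun_cvg (h := fun m w => horner_mx (wt E (fun e => x e w))
    (sqrt_poly (k.+1%:R : R) m) i j * \1_(good_event E x) w)) => [m|w _].
    apply: measurable_funM; last exact: measurable_indic.
    by apply: measurable_horner_mx => i' j'; exact: measurable_wt.
  rewrite indicE; have [/set_mem wG|_] := boolP (w \in good_event E x).
    have [S_pd SS] := sqrtmxP (pd w wG).
    have := @sqrtmx_cvg R k _ _ i j S_pd SS; rewrite mulr1.
    have -> : \tr (wt E (fun e => x e w)) = k.+1%:R.
      by rewrite /mxtrace (eq_bigr (fun=> 1)) ?sumr_const ?card_ord // => l _; rewrite wt_diag.
    by rewrite (_ : (fun m => _ * 1) = (fun m => horner_mx (wt E (fun e => x e w))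
      (sqrt_poly (k.+1%:R : R) m) i j)) //; apply/funext => m; rewrite mulr1.
  rewrite mulr0 (_ : (fun m => _) = (fun=> 0)); first exact: cvg_cst.
  by apply/funext => m; rewrite mulr0.
exists 1 => w; rewrite indicE; have [/set_mem wG|_] := boolP (w \in good_event E x).
  rewrite mulr1; apply: le_trans (sqrtmx_bound i j (pd w wG)) _.
  by rewrite wt_diag sqrtr1.
by rewrite mulr0 normr0.
Qed.

End SqrtWt.

Section SplicingPoly.
Variables (n k : nat) (n_gt0 : (0 < n)%N).
Variables (theta : 'S_n) (gamma : 'I_n -> 'I_n) (nu : 'I_n -> 'I_k).
Variable E : {set {set 'I_k}}.

Lemma nceval_splicing_poly (C : comNzRingType) (A : lalgType C) (u : 'I_n -> A) :
  (forall (c : C) (a : A), a * c%:A = c%:A * a) ->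
  nceval u (splicing_poly C n_gt0 theta gamma nu E) =
  \sum_(tau in SpliceC E nu gamma)
    \prod_(i <- traject (Defs.pcomp theta tau) (Ordinal n_gt0) n) u i ^+ (i == tau i).
Proof.
move=> cA; rewrite nceval_sum; apply: eq_bigr => tau _.
rewrite nceval_prod //; apply: eq_bigr => i _.
by case: (i == tau i); rewrite ?expr1 ?expr0 ?nceval1 ?ncevalX.
Qed.

Context (R : realType) (d : measure_display) (Omega : measurableType d).
Variables (P : probability Omega R) (x : {set 'I_k} -> {RV P >-> R}).
Hypothesis E_tree : is_tree E.
Hypothesis x_iid : iid_uniform E x.

Let W w := nceval (fun i => ncZ (sqrtmx (wt E (fun e => x e w))) (nu i) (gamma i))
  (splicing_poly R[i] n_gt0 theta gamma nu E).

Lemma phi_ncexpectation (A : cstarAlgType R) (phi : {scalar A}) (z : 'I_k * 'I_n -> A) :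
  phi (nceval z (ncexpectation P W)) = cexpectation P (fun w => phi (nceval z (W w))).
Proof.
pose l p := phi (nceval z p).
pose S w i j := sqrtmx (wt E (fun e => x e w)) i j * \1_(good_event E x) w.
pose V w : ncpoly R[i] ('I_k * 'I_n)%type := \sum_(tau in SpliceC E nu gamma)
    \prod_(i <- traject (Defs.pcomp theta tau) (Ordinal n_gt0) n)
  (\sum_(i' < k) (S w (nu i) i')%:C%C *: ncX R[i] (i', gamma i)) ^+ (i == tau i).
rewrite -[LHS]/(l (ncexpectation P W)) -[RHS]/(cexpectation P (fun w => l (W w))).
apply: (linear_ncexpectation (W := V) _ _ (measurable_good_event E x)
  (prob_good_event x_iid)).
- by move=> p q; rewrite /l ncevalD raddfD.
- by move=> c p; rewrite /l ncevalZ scalarZ.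
- apply: simple_sum => tau _; apply: simple_prod => i.
  case: (i == tau i); last first.
    rewrite (_ : (fun w => _) = (fun=> 1)); first exact: simple_cst.
    by apply/funext => w; rewrite expr0.
  rewrite (_ : (fun w => _) =
    (fun w => \sum_(i' < k) (S w (nu i) i')%:C%C *: ncX R[i] (i', gamma i))) //.
  by apply: simple_sum => i' _; apply: simple_scale; exact: bounded_sqrt_wt.
move=> w wG; rewrite /V /W nceval_splicing_poly; last exact: ncpoly_scalar_central.
apply: eq_bigr => tau _.
apply: eq_bigr => i _.
suff -> : ncZ (sqrtmx (wt E (fun e => x e w))) (nu i) (gamma i) =
  \sum_(i' < k) (S w (nu i) i')%:C%C *: ncX R[i] (i', gamma i) by [].
have SE i' : S w (nu i) i' = sqrtmx (wt E (fun e => x e w)) (nu i) i'.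
  by rewrite /S indicE mem_set // mulr1.
by rewrite /ncZ; apply: eq_bigr => i' _; rewrite SE.
Qed.

End SplicingPoly.

(** * The trace of the splicing polynomial *)

Section PermCycle.
Variables (n : nat) (s : 'S_n) (x : 'I_n).
Hypothesis one_cycle : #|porbits s| = 1%N.

Lemma porbit_full y : y \in porbit s x.
Proof.
have /eqP/cards1P[c cE] := one_cycle.
have mem_porbits i : porbit s i \in porbits s by exact: imset_f.
have := mem_porbits x; have := mem_porbits y; rewrite cE !in_set1 => /eqP hy /eqP hx.
by rewrite hx -hy porbit_id.
Qed.

Lemma card_porbit_full : #|porbit s x| = n.
Proof. by rewrite -[RHS]card_ord; apply: eq_card => y; rewrite porbit_full. Qed.

Lemma full_traject : [/\ uniq (traject s x n), fcycle s (traject s x n)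
  & forall y, y \in traject s x n].
Proof.
rewrite -[X in traject _ _ X]card_porbit_full.
split; first exact: uniq_traject_porbit.
  have := iter_porbit s x; case: #|_| => [//|m] /= itm.
  rewrite -[X in rcons _ X]itm -iterS iterSr -trajectSr.
  exact: fpath_traject.
by move=> y; rewrite -porbit_traject porbit_full.
Qed.

End PermCycle.

Section SplicingTrace.
Variables (R : realType) (n k : nat) (n_gt0 : (0 < n)%N) (theta : 'S_n).
Variables (gamma : 'I_n -> 'I_n) (nu : 'I_n -> 'I_k).
Hypothesis k_def : k = ncycles theta.
Hypothesis nu_theta : forall i : 'I_n, nu (theta i) = nu i.
Variables (A : cstarAlgType R) (phi : {scalar A}) (z : 'I_k * 'I_n -> A).
Hypothesis phi1 : phi 1 = 1.
Hypothesis moment : forall l j,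
  4 * j%:R * phi (z l ^+ j.-1) = j.+3%:R * phi (z l ^+ j.+1).
Hypothesis z_free : free_variables phi z.
Variable S : 'M[R]_k.
Hypothesis S_sym : S^T = S.

Let alpha i (l : 'I_k * 'I_n) : R[i] := if l.2 == gamma i then (S (nu i) l.1)%:C%C else 0.
Let y i : A := \sum_l alpha i l *: z l.
(** Letters of different colours involve disjoint sets of free variables; letters of one colour have
    covariance [S *m S], later [wt]. The zero is how the condition gamma o p = gamma enters. *)
Let K a b : R[i] := if gamma a == gamma b then ((S *m S) (nu a) (nu b))%:C%C else 0.

Lemma nceval_ncZ i : nceval z (ncZ S (nu i) (gamma i)) = y i.
Proof.
rewrite /ncZ nceval_sum /y.
rewrite [RHS](eq_bigr (fun p : 'I_k * 'I_n => alpha i (p.1, p.2) *: z (p.1, p.2))) => [|[a b] _ //].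
rewrite -(pair_bigA _ (fun a b => alpha i (a, b) *: z (a, b))) /=.
apply: eq_bigr => a _; rewrite ncevalZ ncevalX (bigD1 (gamma i)) //= /alpha /= eqxx.
by rewrite big1 ?addr0 // => b /negbTE ->; rewrite scale0r.
Qed.

Lemma alpha_covariance a b : \sum_l alpha a l * alpha b l = K a b.
Proof.
rewrite (eq_bigr (fun p : 'I_k * 'I_n => alpha a (p.1, p.2) * alpha b (p.1, p.2))) => [|[c e] _ //].
rewrite -(pair_bigA _ (fun c e => alpha a (c, e) * alpha b (c, e))) /= /K /alpha /=.
case: ifP => [/eqP ab|ab]; last first.
  rewrite big1 // => c _; rewrite big1 // => e _.
  have [->|] := eqVneq e (gamma a); last by rewrite mul0r.
  by rewrite ab mulr0.
rewrite mxE rmorph_sum /=; apply: eq_bigr => c _; rewrite (bigD1 (gamma a)) //= -ab eqxx.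
rewrite big1 ?addr0 => [|e /negbTE ->]; last by rewrite mul0r.
by rewrite rmorphM /=; congr (_ * _); rewrite -[in LHS]S_sym mxE.
Qed.

Lemma pair_weight_gamma X p : matching_on X p ->
  pair_weight K p = if [forall i, gamma (p i) == gamma i]
    then (\prod_(i in upper p) (S *m S) (nu i) (nu (p i)))%:C%C else 0.
Proof.
move=> /matching_onP[pp _]; rewrite /pair_weight.
case: ifPn => [/forallP pg|].
  rewrite rmorph_prod; apply: eq_big => [i|i _]; first by rewrite inE.
  by rewrite /K eq_sym (pg i).
rewrite negb_forall => /existsP[i gi].
have [lt|lt|e] := ltngtP i (p i).
- by rewrite (bigD1 i) //= /K eq_sym (negbTE gi) mul0r.
- by rewrite (bigD1 (p i)) ?pp //= /K (negbTE gi) mul0r.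
- by move: gi; rewrite -(val_inj e) eqxx.
Qed.

(** [tau * theta] is a single cycle, so the monomial of [tau] is a word read along one cycle, and
    its trace is the planar sum over the fixed points of [tau]. *)
Lemma phi_splicing_poly E : is_tree E ->
  phi (nceval z (nceval (fun i => ncZ S (nu i) (gamma i))
    (splicing_poly R[i] n_gt0 theta gamma nu E))) =
  (\sum_(tau in SpliceC E nu gamma)
    \sum_(p | [&& matching_on (fixed tau) p, planar (tau * theta)%g (fixed tau) p
                & [forall i, gamma (p i) == gamma i]])
      \prod_(i in upper p) (S *m S) (nu i) (nu (p i)))%:C%C.
Proof.
move=> E_tree; have cA := @algType_scalar_central R[i] A.
rewrite nceval_splicing_poly; last exact: ncpoly_scalar_central.
rewrite nceval_sum raddf_sum rmorph_sum; apply: eq_bigr => tau tauS.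
have tauE : tau \in Splice E nu by move: tauS; rewrite inE => /andP[].
have [uq cyc all_in] := full_traject (Ordinal n_gt0)
  (splice_ncycle nu_theta E_tree k_def tauE).
pose G s : R[i] := phi (\prod_(b <- s) y b).
have K_sym a b : K a b = K b a.
  rewrite -!alpha_covariance; apply: eq_bigr => l _; exact: mulrC.
have G_nil : G [::] = 1 by rewrite /G big_nil.
have G_rcons w a : G (rcons w a) =
    \sum_(i < size w) K (nth a w i) a * G (drop i.+1 w) * G (take i w).
  rewrite /G (phi_word_rcons phi1 moment z_free alpha).
  by apply: eq_bigr => i _; rewrite alpha_covariance.
transitivity (planar_sum K (tau * theta)%g (fixed tau)).
  rewrite (planar_sum_cycles K_sym G_nil G_rcons (ss := [:: traject (tau * theta)%g (Ordinal n_gt0) n]));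
    rewrite /= ?cats0 ?cyc //.
  rewrite big_seq1 /G big_filter nceval_prod //; congr (phi _).
  rewrite [RHS]big_mkcond; apply: eq_bigr => i _; rewrite [in RHS]inE eq_sym.
  by case: eqP; rewrite ?expr1 ?expr0 ?nceval1 // nceval_ncZ.
rewrite /planar_sum rmorph_sum /= [LHS](bigID (fun p : 'S_n => [forall i, gamma (p i) == gamma i])) /=.
rewrite [X in _ + X]big1 ?addr0 => [|p /andP[/andP[pm _] pg]]; last first.
  by rewrite (pair_weight_gamma pm) (negbTE pg).
apply: eq_big => [p|p /andP[/andP[pm _] pg]]; first by rewrite andbA.
by rewrite (pair_weight_gamma pm) pg.
Qed.

End SplicingTrace.

(** * Expectation of the trace and conclusion *)

Lemma mean_splicing_sum (R : realType) (d : measure_display) (Omega : measurableType d)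
    (P : probability Omega R) (n k : nat) (E : {set {set 'I_k}})
    (x : {set 'I_k} -> {RV P >-> R}) (nu : 'I_n -> 'I_k)
    (T : finType) (Q : pred T) (Q' : T -> pred 'S_n) :
  is_tree E -> iid_uniform E x ->
  mean P (fun w => \sum_(t | Q t) \sum_(p | Q' t p)
    \prod_(i in upper p) wt E (fun e => x e w) (nu i) (nu (p i))) =
  \sum_(t | Q t) \sum_(p | Q' t p)
    mean P (fun w => \prod_(i in upper p) wt E (fun e => x e w) (nu i) (nu (p i))).
Proof.
move=> E_tree x_iid; have mG := measurable_good_event E x; have PG := prob_good_event x_iid.
pose a w i j := wt E (fun e => x e w) i j * \1_(good_event E x) w.
have aE w i j : good_event E x w -> wt E (fun e => x e w) i j = a w i j.
  by move=> wG; rewrite /a indicE mem_set // mulr1.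
pose b (p : 'S_n) w := \prod_(i in upper p) a w (nu i) (nu (p i)).
have bE (p : 'S_n) w : good_event E x w ->
    \prod_(i in upper p) wt E (fun e => x e w) (nu i) (nu (p i)) = b p w.
  by move=> wG; apply: eq_bigr => i _; exact: aE.
have bb p : bounded_rv (b p) by apply: bounded_rv_prod => i _; exact: bounded_wt.
rewrite (mean_eq_on (g := fun w => \sum_(t | Q t) \sum_(p | Q' t p) b p w) mG PG) => [|w wG].
  rewrite mean_sum => [|t _]; last exact: bounded_rv_sum.
  apply: eq_bigr => t _; rewrite mean_sum //; apply: eq_bigr => p _.
  by apply/esym/(mean_eq_on mG PG) => w; exact: bE.
by apply: eq_bigr => t _; apply: eq_bigr => p _; exact: bE.
Qed.

Lemma cexpectation_real (R : realType) (d : measure_display) (Omega : measurableType d)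
    (P : probability Omega R) (f : Omega -> R) :
  cexpectation P (fun w => (f w)%:C%C) = (mean P f)%:C%C.
Proof. by rewrite cexpectationE mean_cst. Qed.

Theorem theorem2p3p5 (R : realType)
    (n : nat) (n_gt0 : (0 < n)%N)
    (theta : 'S_n) (gamma : 'I_n -> 'I_n)
    (k : nat) (k_def : k = ncycles theta)
    (nu : 'I_n -> 'I_k)
    (nu_onto : forall c : 'I_k, exists i : 'I_n, nu i = c)
    (nu_theta : forall i : 'I_n, nu (theta i) = nu i)
    (d : measure_display) (Omega : measurableType d)
    (P : probability Omega R)
    (x : {set {set 'I_k}} -> {set 'I_k} -> {RV P >-> R})
    (x_iid : forall E : {set {set 'I_k}}, is_tree E -> iid_uniform E (x E))
    (A : cstarAlgType R) (phi : {scalar A})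
    (phi_state : faithful_tracial_state phi)
    (z : 'I_k * 'I_n -> A)
    (z_semicircular : forall ij, standard_semicircular phi (z ij))
    (z_free : free_variables phi z) :
  (#|Map0 theta gamma|%:R : R[i]) =
  phi (nceval z (Arb n_gt0 x theta gamma nu)).
Proof.
have k_gt0 : (0 < k)%N by case: (k) (nu (Ordinal n_gt0)) => [[]|].
have phi1 : phi 1 = 1 by case: phi_state.
have moment l j : 4 * j%:R * phi (z l ^+ j.-1) = j.+3%:R * phi (z l ^+ j.+1).
  have [_ zm] := z_semicircular l; rewrite !zm.
  have /(congr1 (real_complex R)) := @semicircle_moment R j.
  by rewrite !rmorphM /= !rmorph_nat.
pose Phi (E : {set {set 'I_k}}) (D : {set 'I_n}) (f : 'I_n -> 'I_n) : R :=
  mean P (fun w => \prod_(i in D) wt E (fun e => x E e w) (nu i) (nu (f i))).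
have Phi_ext E (D : {set 'I_n}) (f g : 'I_n -> 'I_n) : {in D, f =1 g} -> Phi E D f = Phi E D g.
  move=> fg; congr (mean P _); apply/funext => w.
  by apply: eq_bigr => i iD; rewrite fg.
have term E : is_tree E ->
    phi (nceval z (ncexpectation P (fun w => nceval
      (fun i => ncZ (sqrtmx (wt E (fun e => x E e w))) (nu i) (gamma i))
      (splicing_poly R[i] n_gt0 theta gamma nu E)))) =
    (\sum_(tau in SpliceC E nu gamma)
      \sum_(p | [&& matching_on (fixed tau) p, planar (tau * theta)%g (fixed tau) p
                  & [forall i, gamma (p i) == gamma i]]) Phi E (upper p) p)%:C%C.
  move=> E_tree; have xE := x_iid E E_tree.
  rewrite phi_ncexpectation // -mean_splicing_sum // -cexpectation_real.
  apply: (cexpectation_eq_on (measurable_good_event E (x E)) (prob_good_event xE)) => w wG.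
  (* Only the square of the root enters the trace, so [wt] itself appears under the expectation. *)
  have [[S_sym _] SS] := sqrtmxP (wt_posdef E_tree (good_eventP wG)).
  by rewrite (phi_splicing_poly n_gt0 gamma k_def nu_theta phi1 moment z_free S_sym E_tree) SS.
rewrite /Arb nceval_sum raddf_sum (eq_bigr _ term) -rmorph_sum /=.
rewrite (splice_sum n_gt0 gamma k_def nu_theta Phi_ext).
(* Each [iota] contributes exactly 1, by the forest formula for its multigraph of transpositions. *)
rewrite (eq_bigr (fun=> 1)) => [|iota iotaM].
  by rewrite sumr_const rmorph_nat.
have D_conn := Map0_connected n_gt0 nu_onto nu_theta iotaM.
exact: (forest_formula x_iid (ed := edge nu iota) (fun=> erefl) k_gt0 D_conn).
Qed.
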